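(* Let $\mathcal{C}_0$ be a generic unassuming arrangement of six lines in $\mathbb{P}^2(\mathbb{C})$. Then $\Lambda_{\{2\},\{3\}}(\mathcal{C}_0)$ is also an unassuming arrangement. Moreover, the closure of the moduli space of unassuming arrangements (up to projective equivalence) has exactly two irreducible components: one is isomorphic to $\mathbb{P}^1$, the other one is a point.
   Context: We work in the complex projective plane. For a line arrangement $\mathcal{A}$ and $k\geq 2$, a $k$-point of $\mathcal{A}$ is a point where exactly $k$ lines of $\mathcal{A}$ meet; $\mathcal{P}_{\{k\}}(\mathcal{A})$ denotes the set of $k$-points and $t_k(\mathcal{A})=|\mathcal{P}_{\{k\}}(\mathcal{A})|$. For a finite set of points $P$, $\mathcal{L}_{\{k\}}(P)$ (resp. $\mathcal{L}_k(P)$) denotes the set of lines containing exactly (resp. at least) $k$ points of $P$. The operator $\Lambda_{\{2\},\{3\}}$ sends a line arrangement $\mathcal{A}$ to $\mathcal{L}_{\{3\}}(\mathcal{P}_{\{2\}}(\mathcal{A}))$, the union of all lines containing exactly three double points of $\mathcal{A}$. $\mathcal{D}$ denotes projective duality (sending lines to points of the dual plane and vice versa). An arrangement $\mathcal{C}_0$ of six lines is called unassuming if its only singularities are $15$ double points, and the line arrangement $\check{\mathcal{C}}_0=\mathcal{L}_2(\mathcal{D}(\mathcal{C}_0))$ (the lines through at least two of the six dual points) has $t_2=27$, $t_3=6$, $t_5=6$ and no other singular points, and moreover its six $5$-points are not contained in a conic. *)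

(* Defs.v *)
From HB Require Import structures.
From mathcomp Require Import all_boot all_order all_algebra.
From mathcomp Require Import complex mpoly.
From mathcomp Require Import boolp classical_sets functions cardinality reals.

Set Implicit Arguments.
Unset Strict Implicit.
Unset Printing Implicit Defensive.

Import GRing.Theory.

Local Open Scope ring_scope.
Local Open Scope classical_set_scope.
Local Open Scope card_scope.

Section ProjectiveVarieties.

Variable F : fieldType.

Definition proj (n : nat) : Type :=
  {U : {vspace 'rV[F]_n.+1} | \dim U == 1%N}.

(* Homogeneous coordinates: well defined only up to a nonzero scalar, so this
   is used below only with homogeneous polynomials (of a common degree). *)
Definition hcoord n (p : proj n) : 'rV[F]_n.+1 := vpick (val p).

Definition polymap n m (f : 'I_m.+1 -> {mpoly F[n]}) (v : 'rV[F]_n)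
  : 'rV[F]_m.+1 := \row_i (f i).@[fun j => v 0 j].

Definition zclosed n (Z : set (proj n)) : Prop :=
  exists2 S : set {mpoly F[n.+1]},
    (forall f, S f -> exists d : nat, f \is d.-homog) &
    Z = [set p | forall f, S f -> f.@[fun j => hcoord p 0 j] = 0].

Definition zclosure n (X : set (proj n)) : set (proj n) :=
  \bigcap_(Z in [set Z | zclosed Z /\ X `<=` Z]) Z.

Definition zlocally_closed n (X : set (proj n)) : Prop :=
  exists Z W : set (proj n), [/\ zclosed Z, zclosed W & X = Z `\` W].

Definition zirreducible n (X : set (proj n)) : Prop :=
  X !=set0 /\
  forall Z W, zclosed Z -> zclosed W -> X `<=` Z `|` W -> X `<=` Z \/ X `<=` W.

Definition irreducible_component n (X C : set (proj n)) : Prop :=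
  [/\ zirreducible C, C `<=` X &
      forall D, zirreducible D -> D `<=` X -> C `<=` D -> D = C].

(* The domain {y | polymap f y != 0} of a local expression f of phi is open;
   asking for the equality on all of it loses no generality, because f can be
   multiplied by a polynomial vanishing off a given neighbourhood of x. *)
Definition regular_affine n m (X : set 'rV[F]_n) (phi : 'rV[F]_n -> proj m)
  : Prop :=
  forall x, X x -> exists f : 'I_m.+1 -> {mpoly F[n]},
    polymap f x != 0 /\
    forall y, X y -> polymap f y != 0 -> val (phi y) = <[polymap f y]>%VS.

Definition regular n m (X : set (proj n)) (phi : proj n -> proj m) : Prop :=
  forall x, X x -> exists (d : nat) (f : 'I_m.+1 -> {mpoly F[n.+1]}),
    [/\ forall i, f i \is d.-homog,
        polymap f (hcoord x) != 0 &
        forall y, X y -> polymap f (hcoord y) != 0 ->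
          val (phi y) = <[polymap f (hcoord y)]>%VS].

Definition variety_isomorphic n m (X : set (proj n)) (Y : set (proj m)) : Prop :=
  exists (phi : proj n -> proj m) (psi : proj m -> proj n),
    [/\ regular X phi, regular Y psi,
        forall x, X x -> Y (phi x) /\ psi (phi x) = x &
        forall y, Y y -> X (psi y) /\ phi (psi y) = y].

End ProjectiveVarieties.

Section LineArrangements.

Variable F : fieldType.

Local Notation point := (proj F 2).

Definition line : Type := {U : {vspace 'rV[F]_3} | \dim U == 2%N}.

Definition on_line (p : point) (l : line) : Prop := (val p <= val l)%VS.

(* P_{k}(A); meant for k >= 2 *)
Definition kpoints (k : nat) (A : set line) : set point :=
  [set p | [set l | A l /\ on_line p l] #= `I_k].

(* L_{k}(P) *)
Definition lines_exactly (k : nat) (P : set point) : set line :=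
  [set l | [set p | P p /\ on_line p l] #= `I_k].

(* L_k(P) *)
Definition lines_at_least (k : nat) (P : set point) : set line :=
  [set l | `I_k #<= [set p | P p /\ on_line p l]].

Definition Lambda23 (A : set line) : set line := lines_exactly 3 (kpoints 2 A).

(* The dual plane is identified with the plane through the standard pairing
   u *m v^T on 'rV_3: the dual point of a line is its annihilator. *)
Definition dual_points (A : set line) : set point :=
  [set p : point | exists2 l : line, A l &
     forall u v : 'rV[F]_3, u \in val p -> v \in val l -> u *m v^T = 0].

Definition on_conic (P : set point) : Prop :=
  exists q : {mpoly F[3]}, [/\ q != 0, q \is 2.-homog &
    forall p, P p -> q.@[fun j => hcoord p 0 j] = 0].

Definition unassuming (A : set line) : Prop :=
  let B := lines_at_least 2 (dual_points A) in
  [/\ A #= `I_6,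
      kpoints 2 A #= `I_15 /\ (forall k, (2 < k)%N -> kpoints k A = set0),
      [/\ kpoints 2 B #= `I_27, kpoints 3 B #= `I_6 & kpoints 5 B #= `I_6],
      (forall k, (2 <= k)%N -> k \notin [:: 2; 3; 5]%N -> kpoints k B = set0) &
      ~ on_conic (kpoints 5 B)].

Definition proj_equiv (A B : set line) : Prop :=
  exists2 g : 'End('rV[F]_3), lker g == 0%VS &
    [set val l | l in B] = [set (g @: val l)%VS | l in A].

(* The lines whose equations are given by the nonzero rows of M. *)
Definition arrangement_of n (M : 'M[F]_(n, 3)) : set line :=
  [set l : line | exists2 i, row i M != 0 &
     forall v, v \in val l -> v *m (row i M)^T = 0].

(* The 6 x 3 matrices of equations of unassuming arrangements, as a subset of
   affine 18-space: this is the parameter space of unassuming arrangements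
   with ordered lines and chosen equations. *)
Definition unassuming_equations : set 'rV[F]_(6 * 3) :=
  [set v | unassuming (arrangement_of (vec_mx v))].

(* mu identifies the set of projective equivalence classes of unassuming
   arrangements (a quotient of unassuming_equations) with a quasi-projective
   variety, the coarse moduli space: mu is algebraic, and every algebraic
   invariant factors through it.  The last clause determines the image of mu
   up to isomorphism of varieties. *)
Definition coarse_moduli n (mu : set line -> proj F n) : Prop :=
  [/\ zlocally_closed (mu @` unassuming),
      forall A B, unassuming A -> unassuming B ->
        (mu A = mu B <-> proj_equiv A B),
      regular_affine unassuming_equations
        (fun v => mu (arrangement_of (vec_mx v))) &
      forall m (phi : set line -> proj F m),
        (forall A B, unassuming A -> unassuming B -> proj_equiv A B ->
           phi A = phi B) ->
        regular_affine unassuming_equations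
          (fun v => phi (arrangement_of (vec_mx v))) ->
        exists2 psi : proj F n -> proj F m,
          regular (mu @` unassuming) psi &
          forall A, unassuming A -> phi A = psi (mu A)].

(* P holds for the arrangements whose class lies in a dense open subset of the
   moduli space; density makes this subset meet every irreducible component. *)
Definition generic_unassuming n (mu : set line -> proj F n)
    (P : set line -> Prop) : Prop :=
  exists2 W : set (proj F n),
    zclosed W /\ mu @` unassuming `<=` zclosure ((mu @` unassuming) `\` W) &
    forall A, unassuming A -> ~ W (mu A) -> P A.

End LineArrangements.

(* Main.v *)
(* Dualise to six points in the plane.  The arrangement is unassuming exactly when no
   three points are collinear, exactly six of the fifteen synthemes ab|cd|ef consist of
   three concurrent joins, and the points are not on a conic.  A three-term relation
   between brackets shows that two concurrent synthemes forming part of a triangle force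
   the third one.  Viewing synthemes as the edges of the complete graph on the six totals
   (the outer automorphism of S_6), this says that concurrency is an equivalence relation
   on the totals, so that six concurrent synthemes form K_4 or 2 K_3.
   In the case K_4 the points can be moved to (0,1,1), (0,1,-1), (1,0,1), (-1,0,1),
   (1,t,0), (1,-t,0), and the class of the arrangement is determined by
   J = t^2 + t^-2, where J is not 2, -2 or 18.  The case 2 K_3 (two triangles in sixfold
   perspective) is a single projective class.  Sending these to [J : 1 : 0] and [0 : 0 : 1]
   gives the moduli space; the operator acts by t |-> t^-2 up to equivalence, that is
   J |-> J^2 - 2, and fixes the isolated class. *)

Require Import Defs.
From HB Require Import structures.
From mathcomp Require Import all_boot all_order all_algebra.
From mathcomp Require Import complex mpoly.
From mathcomp Require Import boolp classical_sets functions cardinality reals.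
From mathcomp Require Import ring zify.

Set Implicit Arguments.
Unset Strict Implicit.
Unset Printing Implicit Defensive.

Import GRing.Theory Num.Theory.

Local Open Scope ring_scope.
Local Open Scope classical_set_scope.

(** * Dot, cross and triple products of vectors of length three *)

Section Vectors.
Variable F : fieldType.
Implicit Types (u v w x : 'rV[F]_3) (H : 'M[F]_3) (a b c : F).

(** A normal form needs an ordering of the six lines, which cannot be chosen globally, while [mu]
    has to be given locally by polynomials in the raw equations and every algebraic invariant has to
    descend to a regular map. Two devices bridge this gap. For an ordering fixed near one
    arrangement, the product of the brackets of all synthemes outside the expected six is nonzero
    only where exactly those six are concurrent, since an unassuming arrangement has exactly six.
    Each labelled combinatorial type is therefore an open condition, and multiplying by this product
    confines a local expression to its domain. In the other direction, an invariant is restricted to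
    the curve of standard equations with parameter t, and its local expression is averaged over t,
    -t, 1/t, -1/t to become a polynomial in J. The excluded values have these origins: three
    collinear points for J = 2, a conic through the points for J = -2, further concurrent synthemes
    for J = 18. A generic arrangement also avoids the preimages of these values under J |-> J^2 -
    2. *)

Definition o0 : 'I_3 := @Ordinal 3 0 isT.
Definition o1 : 'I_3 := @Ordinal 3 1 isT.
Definition o2 : 'I_3 := @Ordinal 3 2 isT.

Lemma sum3E (V : nmodType) (f : 'I_3 -> V) : \sum_i f i = f o0 + f o1 + f o2.
Proof.
rewrite !big_ord_recl big_ord0 addr0 addrA.
by congr (f _ + f _ + f _); apply: val_inj.
Qed.

Lemma ord3P (P : 'I_3 -> Prop) : P o0 -> P o1 -> P o2 -> forall i, P i.
Proof.
move=> P0 P1 P2 [[|[|[|//]]] i_lt3].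
- by rewrite (_ : Ordinal _ = o0) //; apply: val_inj.
- by rewrite (_ : Ordinal _ = o1) //; apply: val_inj.
- by rewrite (_ : Ordinal _ = o2) //; apply: val_inj.
Qed.

Definition vec3 a b c : 'rV[F]_3 := \row_j [:: a; b; c]`_j.

Lemma vec3_0 a b c : vec3 a b c 0 o0 = a. Proof. by rewrite mxE. Qed.
Lemma vec3_1 a b c : vec3 a b c 0 o1 = b. Proof. by rewrite mxE. Qed.
Lemma vec3_2 a b c : vec3 a b c 0 o2 = c. Proof. by rewrite mxE. Qed.
Definition vec3E := (vec3_0, vec3_1, vec3_2).

Lemma row3P u v :
  u 0 o0 = v 0 o0 -> u 0 o1 = v 0 o1 -> u 0 o2 = v 0 o2 -> u = v.
Proof. by move=> e0 e1 e2; apply/rowP; apply: ord3P. Qed.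

Lemma vec3_eta u : vec3 (u 0 o0) (u 0 o1) (u 0 o2) = u.
Proof. by apply: row3P; rewrite vec3E. Qed.

Lemma vec3_eq0 a b c : (vec3 a b c == 0) = [&& a == 0, b == 0 & c == 0].
Proof.
apply/eqP/and3P => [e|[/eqP-> /eqP-> /eqP->]].
  by split; apply/eqP; move/rowP: e => e; [move: (e o0)|move: (e o1)|move: (e o2)]; rewrite !mxE.
by apply: row3P; rewrite vec3E mxE.
Qed.

Definition dot u v : F := u 0 o0 * v 0 o0 + u 0 o1 * v 0 o1 + u 0 o2 * v 0 o2.

Definition cross u v : 'rV[F]_3 :=
  vec3 (u 0 o1 * v 0 o2 - u 0 o2 * v 0 o1)
       (u 0 o2 * v 0 o0 - u 0 o0 * v 0 o2)
       (u 0 o0 * v 0 o1 - u 0 o1 * v 0 o0).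

Definition br u v w : F := dot u (cross v w).

Lemma brE u v w : br u v w =
  u 0 o0 * (v 0 o1 * w 0 o2 - v 0 o2 * w 0 o1) +
  u 0 o1 * (v 0 o2 * w 0 o0 - v 0 o0 * w 0 o2) +
  u 0 o2 * (v 0 o0 * w 0 o1 - v 0 o1 * w 0 o0).
Proof. by rewrite /br /dot /cross !vec3E. Qed.

Lemma mul_tr_dot u v : u *m v^T = (dot u v)%:M.
Proof. by apply/matrixP => i j; rewrite !ord1 !mxE sum3E !mxE mulr1n. Qed.

Lemma mul_tr_eq0 u v : (u *m v^T = 0) <-> (dot u v = 0).
Proof.
rewrite mul_tr_dot; split=> [/matrixP/(_ 0 0)|->]; last by rewrite -scalemx1 scale0r.
by rewrite !mxE mulr1n.
Qed.

Lemma dotC u v : dot u v = dot v u.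
Proof. by rewrite /dot; ring. Qed.

Lemma dotZl c u v : dot (c *: u) v = c * dot u v.
Proof. by rewrite /dot !mxE; ring. Qed.

Lemma dotZr c u v : dot u (c *: v) = c * dot u v.
Proof. by rewrite dotC dotZl dotC. Qed.

Lemma dot_mulmx u v H : dot (u *m H) v = dot u (v *m H^T).
Proof.
have: (dot (u *m H) v)%:M = (dot u (v *m H^T))%:M :> 'M_1.
  by rewrite -!mul_tr_dot trmx_mul trmxK mulmxA.
by move/matrixP/(_ 0 0); rewrite !mxE !mulr1n.
Qed.

Definition mx3 u v w : 'M[F]_3 :=
  \matrix_(i, j) (if i == o0 then u else if i == o1 then v else w) 0 j.

Lemma det_mx3 u v w : \det (mx3 u v w) = br u v w.
Proof.
rewrite (expand_det_row _ o0) sum3E /cofactor.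
rewrite !(expand_det_row _ 0) !big_ord_recl !big_ord0 /cofactor !det_mx11 !mxE /=.
rewrite brE /= /bump /= !(expr0, expr1, expr2).
have L (i j : 'I_3) : val i = val j -> i = j by exact: val_inj.
rewrite !(L (lift o0 ord0) o1 erefl) !(L (lift o1 ord0) o0 erefl).
rewrite !(L (lift o2 ord0) o0 erefl) !(L (lift o0 (lift ord0 0)) o2 erefl).
rewrite !(L (lift o1 (lift ord0 0)) o2 erefl).
rewrite !(L (lift o2 (lift ord0 0)) o1 erefl).
rewrite ?(L (lift o0 (lift ord0 ord0)) o2 erefl).
rewrite ?(L (lift o1 (lift ord0 ord0)) o2 erefl).
rewrite ?(L (lift o2 (lift ord0 ord0)) o1 erefl).
rewrite ?(L (lift o0 (lift (lift ord0 ord0) 0)) o1 erefl).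
rewrite ?(L (lift o1 (lift (lift ord0 ord0) 0)) o0 erefl).
rewrite ?(L (lift o2 (lift (lift ord0 ord0) 0)) o0 erefl).
ring.
Qed.

Lemma mulmx_mx3 x u v w :
  x *m mx3 u v w = x 0 o0 *: u + x 0 o1 *: v + x 0 o2 *: w.
Proof. by apply/rowP => j; rewrite !mxE sum3E !mxE. Qed.

Lemma mulmx_mx3T x u v w :
  x *m (mx3 u v w)^T = vec3 (dot x u) (dot x v) (dot x w).
Proof. by apply: row3P; rewrite vec3E /dot !mxE sum3E !mxE. Qed.

Lemma mx3_mulmx u v w H : mx3 u v w *m H = mx3 (u *m H) (v *m H) (w *m H).
Proof.
apply/matrixP => i j; rewrite !mxE sum3E !mxE.
by case: ifP => _; [|case: ifP => _]; rewrite mxE sum3E.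
Qed.

Lemma br_mulmx u v w H : br (u *m H) (v *m H) (w *m H) = br u v w * \det H.
Proof. by rewrite -!det_mx3 -mx3_mulmx det_mulmx. Qed.

Lemma brZ a b c u v w :
  br (a *: u) (b *: v) (c *: w) = a * b * c * br u v w.
Proof. by rewrite !brE !mxE; ring. Qed.

Lemma dot_cross_l u v : dot u (cross u v) = 0.
Proof. by rewrite /cross /dot !vec3E; ring. Qed.

Lemma dot_cross_r u v : dot v (cross u v) = 0.
Proof. by rewrite /cross /dot !vec3E; ring. Qed.

Lemma crossC u v : cross u v = - cross v u.
Proof. by apply: row3P; rewrite /cross !mxE ?vec3E //=; ring. Qed.

Lemma cross_cross u v x :
  cross (cross u v) x = dot x u *: v - dot x v *: u.
Proof. by apply: row3P; rewrite /cross /dot !mxE /=; ring. Qed.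

Lemma crossZl c u v : cross (c *: u) v = c *: cross u v.
Proof. by apply: row3P; rewrite /cross !mxE /=; ring. Qed.

Lemma crossZr c u v : cross u (c *: v) = c *: cross u v.
Proof. by rewrite crossC crossZl -scalerN -crossC. Qed.

(** A nonzero coordinate of [v] gives the factor; the components of the cross product settle the
    remaining coordinates. *)
Lemma cross_prop u v : v != 0 -> cross u v = 0 -> exists c, u = c *: v.
Proof.
move=> v0 /rowP e; have := e o0; have := e o1; have := e o2; rewrite !mxE /=.
move=> e2 e1 e0.
have [z0|v0'] := eqVneq (v 0 o0) 0; last first.
  exists (u 0 o0 / v 0 o0); apply: row3P; rewrite !mxE.
  - by field.
  - apply: (mulIf v0'); rewrite mulrAC divfK // mulrC; apply/eqP.
    by rewrite eq_sym -subr_eq0 -e2; apply/eqP; ring.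
  - apply: (mulIf v0'); rewrite mulrAC divfK // mulrC; apply/eqP.
    by rewrite -subr_eq0 -e1; apply/eqP; ring.
have [z1|v1'] := eqVneq (v 0 o1) 0; last first.
  exists (u 0 o1 / v 0 o1); apply: row3P; rewrite !mxE.
  - apply: (mulIf v1'); rewrite mulrAC divfK // mulrC; apply/eqP.
    by rewrite -subr_eq0 -e2; apply/eqP; ring.
  - by field.
  - apply: (mulIf v1'); rewrite mulrAC divfK // mulrC; apply/eqP.
    by rewrite eq_sym -subr_eq0 -e0; apply/eqP; ring.
have v2' : v 0 o2 != 0.
  by apply: contraNneq v0 => z2; apply/eqP; apply: row3P; rewrite mxE.
exists (u 0 o2 / v 0 o2); apply: row3P; rewrite !mxE.
- apply: (mulIf v2'); rewrite mulrAC divfK // mulrC; apply/eqP.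
  by rewrite eq_sym -subr_eq0 -e1; apply/eqP; ring.
- apply: (mulIf v2'); rewrite mulrAC divfK // mulrC; apply/eqP.
  by rewrite -subr_eq0 -e0; apply/eqP; ring.
- by field.
Qed.

(** By [cross_cross], [cross (cross u v) x] is a combination of [v] and [u] with coefficients
    [dot x u] and [dot x v], which vanish. *)
Lemma cross_meet u v x : cross u v != 0 ->
  dot x u = 0 -> dot x v = 0 -> exists c, x = c *: cross u v.
Proof.
move=> uv0 xu xv; apply: cross_prop => //.
by rewrite crossC cross_cross xu xv !scale0r subrr oppr0.
Qed.

Lemma dot_nondeg u : (forall z, dot z u = 0) -> u = 0.
Proof.
move=> e; apply: row3P; rewrite mxE.
- by have := e (vec3 1 0 0); rewrite /dot !vec3E !mul0r mul1r !addr0.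
- by have := e (vec3 0 1 0); rewrite /dot !vec3E !mul0r mul1r addr0 add0r.
- by have := e (vec3 0 0 1); rewrite /dot !vec3E !mul0r mul1r !add0r.
Qed.

End Vectors.

(** * Points of projective space as classes of nonzero vectors *)

Section ProjectivePoints.
Variables (F : fieldType) (n : nat).
Implicit Types (u v : 'rV[F]_n.+1) (p : proj F n).

Fact default_proj_proof : \dim <[delta_mx ord0 ord0 : 'rV[F]_n.+1]>%VS == 1%N.
Proof.
rewrite dim_vline eqb1; apply/eqP => /matrixP/(_ ord0 ord0)/eqP.
by rewrite !mxE !eqxx oner_eq0.
Qed.

Definition default_proj : proj F n :=
  exist (fun U : {vspace 'rV[F]_n.+1} => \dim U == 1%N) _ default_proj_proof.

(* Only meaningful for v != 0. *)
Definition pt v : proj F n := insubd default_proj <[v]>%VS.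

Lemma val_pt v : v != 0 -> val (pt v) = <[v]>%VS.
Proof. by move=> v0; rewrite val_insubd dim_vline v0. Qed.

Lemma vline_eq u v : u != 0 ->
  (<[u]>%VS = <[v]>%VS) <-> (exists2 c, c != 0 & u = c *: v).
Proof.
move=> u0; split=> [e|[c c0 ->]].
  have /vlineP[c uE] : u \in <[v]>%VS by rewrite -e memv_line.
  by exists c => //; apply: contraNneq u0 => c0; rewrite uE c0 scale0r.
apply/eqP; rewrite -dimv_leqif_eq ?dim_vline ?scaler_eq0 ?(negPf c0) //.
by rewrite -memvE memvZ // memv_line.
Qed.

Lemma pt_eq u v : u != 0 -> v != 0 ->
  (pt u = pt v) <-> (exists2 c, c != 0 & u = c *: v).
Proof.
move=> u0 v0; rewrite -vline_eq // -!val_pt //.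
by split=> [->//|/val_inj].
Qed.

Lemma hcoord_neq0 p : hcoord p != 0.
Proof. by rewrite vpick0 -dimv_eq0 (eqP (valP p)). Qed.

Lemma pt_hcoord p : pt (hcoord p) = p.
Proof.
apply: val_inj; rewrite val_pt ?hcoord_neq0 //.
apply/eqP; rewrite -dimv_leqif_eq.
  by rewrite dim_vline hcoord_neq0 (eqP (valP p)).
by rewrite -memvE memv_pick.
Qed.

Lemma ptP p : exists2 v, v != 0 & p = pt v.
Proof. by exists (hcoord p); rewrite ?hcoord_neq0 ?pt_hcoord. Qed.

Lemma hcoord_pt v : v != 0 -> exists2 c, c != 0 & hcoord (pt v) = c *: v.
Proof. by move=> v0; apply/pt_eq; rewrite ?hcoord_neq0 ?pt_hcoord. Qed.

Lemma ptZ c v : c != 0 -> v != 0 -> pt (c *: v) = pt v.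
Proof.
by move=> c0 v0; apply/pt_eq; rewrite ?scaler_eq0 ?negb_or ?c0 //; exists c.
Qed.

End ProjectivePoints.

(** * Lines of the plane as kernels of their coordinate vectors *)

Section Lines.
Variable F : fieldType.
Implicit Types (u v w x : 'rV[F]_3) (l : line F).

Definition dot_hom v : 'Hom('rV[F]_3, 'rV[F]_1) := linfun (mulmxr v^T).

Definition ker_dot v : {vspace 'rV[F]_3} := lker (dot_hom v).

Lemma mem_ker_dot u v : (u \in ker_dot v) = (dot u v == 0).
Proof.
rewrite memv_ker lfunE /=; apply/eqP/eqP => /mul_tr_eq0 //.
Qed.

Lemma dim_ker_dot v : v != 0 -> \dim (ker_dot v) == 2%N.
Proof.
move=> v0; have := limg_ker_dim (dot_hom v) fullv.
rewrite capfv -/(ker_dot v) dimvf dim_matrix mul1r.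
suff -> : \dim (dot_hom v @: fullv) = 1%N by rewrite addn1 => -[->].
apply/eqP; rewrite eqn_leq (leq_trans (dimvS (subvf _))) ?dimvf ?dim_matrix //=.
rewrite lt0n dimv_eq0; apply: contra v0 => /eqP e; apply/eqP/dot_nondeg => z.
apply/mul_tr_eq0; apply/eqP; rewrite -memv0 -e.
by have := memv_img (dot_hom v) (memvf z); rewrite lfunE.
Qed.

Fact default_line_proof : \dim (ker_dot (vec3 1 0 0 : 'rV[F]_3)) == 2%N.
Proof. by rewrite dim_ker_dot // vec3_eq0 oner_eq0. Qed.

Definition default_line : line F :=
  exist (fun U : {vspace 'rV[F]_3} => \dim U == 2%N) _ default_line_proof.

(* Only meaningful for v != 0. *)
Definition ln v : line F := insubd default_line (ker_dot v).

Lemma val_ln v : v != 0 -> val (ln v) = ker_dot v.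
Proof. by move=> v0; rewrite val_insubd dim_ker_dot. Qed.

Lemma on_lineE u v : u != 0 -> v != 0 -> on_line (pt u) (ln v) <-> dot u v = 0.
Proof.
move=> u0 v0; rewrite /on_line val_pt // val_ln // -memvE mem_ker_dot.
by split=> /eqP.
Qed.

(** The coordinate vector is the cross product of a basis of the underlying plane. *)
Lemma lnP l : exists2 v, v != 0 & l = ln v.
Proof.
have dl : \dim (val l) = 2 := eqP (valP l).
have /andP[] := vbasisP (val l); have := size_tuple (vbasis (val l)).
move: (tval _) => b; rewrite dl; case: b => [//|b0 [//|b1 [|//]]] _ /eqP sb.
rewrite free_cons span_seq1 => /andP[n0 b1_free].
have b1_neq0 : b1 != 0 by move: b1_free; rewrite free_cons span_nil memv0 => /andP[].
have c0 : cross b0 b1 != 0.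
  by apply: contra n0 => /eqP /(cross_prop b1_neq0)[c ->]; rewrite memvZ // memv_line.
exists (cross b0 b1) => //; apply: val_inj; rewrite val_ln //.
apply/eqP; rewrite -dimv_leqif_eq ?dl ?(eqP (dim_ker_dot c0)) //.
rewrite -sb; apply/span_subvP => x; rewrite !inE mem_ker_dot.
by case/orP => /eqP ->; rewrite ?dot_cross_l ?dot_cross_r.
Qed.

(** Every [cross v z] lies in the kernel of [v], and its product with [w], as a linear form in [z],
    has coefficients [cross w v]. *)
Lemma ker_dot_sub v w : v != 0 -> (ker_dot v <= ker_dot w)%VS -> cross v w = 0.
Proof.
move=> v0 /subvP e; rewrite crossC; apply/eqP; rewrite oppr_eq0; apply/eqP.
apply: dot_nondeg => z; have : cross v z \in ker_dot v.
  by rewrite mem_ker_dot dotC dot_cross_l.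
move=> /e; rewrite mem_ker_dot => /eqP <-.
by rewrite /dot /cross !vec3E; ring.
Qed.

Lemma ln_eq v w : v != 0 -> w != 0 -> (ln v = ln w) <-> (pt v = pt w).
Proof.
move=> v0 w0; split=> [|/(pt_eq v0 w0)[c c0 ->]].
  move/(congr1 val); rewrite !val_ln // => e.
  have [|c cE] := @cross_prop _ v w w0; first by apply: ker_dot_sub; rewrite ?e.
  apply/pt_eq => //; exists c => //.
  by apply: contraNneq v0 => c0; rewrite cE c0 scale0r.
have cw0 : c *: w != 0 by rewrite scaler_eq0 negb_or c0.
apply: val_inj; rewrite !val_ln //; apply/vspaceP => x.
by rewrite !mem_ker_dot dotZr mulf_eq0 (negPf c0).
Qed.

End Lines.

(** * Cardinalities of finite sets *)

Section Cardinality.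
Local Open Scope card_scope.

Lemma card_II_uniq T (A : set T) m n : A #= `I_m -> A #= `I_n -> m = n.
Proof. by move=> Am An; apply/card_eq_II; exact: card_eq_trans (card_esym Am) An. Qed.

Lemma card_image_seq (I : eqType) T (f : I -> T) (s : seq I) :
  uniq s -> {in s &, injective f} -> f @` [set` s] #= `I_(size s).
Proof.
case: s => [|x0 s']; first by rewrite II0 set_nil image_set0 card_eq00.
move: (x0 :: s') => s us injf.
have -> : f @` [set` s] = (fun i => f (nth x0 s i)) @` `I_(size s).
  apply/seteqP; split=> [_ [i si <-]|_ [i /= is_ <-]].
    by exists (index i s); rewrite /= ?index_mem ?nth_index.
  by exists (nth x0 s i) => //=; rewrite mem_nth.
apply: inj_card_eq => i j.
rewrite !inE /= => li lj /injf; rewrite !mem_nth // => /(_ isT isT)/eqP.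
by rewrite nth_uniq // => /eqP.
Qed.

Lemma card_II_enum T (A : set T) n : A #= `I_n.+1 -> exists f : nat -> T,
  (forall i j, (i < n.+1)%N -> (j < n.+1)%N -> f i = f j -> i = j) /\
  A = f @` `I_n.+1.
Proof.
elim/Ppointed: T => T in A *.
  by rewrite emptyE => /eqP/seteqP[/(_ 0%N (ltn0Sn _))].
move=> /card_esym/card_set_bijP[f [fA finj fsurj]]; exists f; split.
  by move=> i j li lj; apply: finj; rewrite inE.
by apply/seteqP; split=> [x /fsurj //|_ [i /fA Afi <-]].
Qed.

Lemma card_le2P T (A : set T) : (`I_2 #<= A) -> exists x y, [/\ A x, A y & x <> y].
Proof.
elim/Ppointed: T => T in A *.
  by rewrite emptyE => /eqP/seteqP[/(_ 0%N (ltn0Sn _))].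
move=> /pcard_leP[f]; exists (f 0%N), (f 1%N); split.
- exact: funS.
- exact: funS.
- by have := @inj _ _ _ f 0%N 1%N; rewrite !inE => /(_ isT isT) h /h.
Qed.

Lemma card_le2 T (A : set T) x y : A x -> A y -> x <> y -> `I_2 #<= A.
Proof.
move=> Ax Ay xy; pose f i := if i == 0%N then x else y.
have e2 : f @` `I_2 #= `I_2.
  by apply: inj_card_eq => -[|[|i]] [|[|j]]; rewrite !inE //= /f /= => _ _ // e;
    case: xy.
by rewrite -(card_le_eql e2); apply: subset_card_le => _ [i _ <-]; rewrite /f; case: ifP.
Qed.

End Cardinality.

(** * Duads, matchings and synthemes on six indices *)

Section Duads.

Definition duads : seq (nat * nat) :=
  [:: (0, 1); (0, 2); (0, 3); (0, 4); (0, 5); (1, 2); (1, 3); (1, 4); (1, 5);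
      (2, 3); (2, 4); (2, 5); (3, 4); (3, 5); (4, 5)]%N.

Definition meets (d e : nat * nat) : bool :=
  [|| d.1 == e.1, d.1 == e.2, d.2 == e.1 | d.2 == e.2].

(** A matching keeps the order of [s]. The joins through a point form a filter of [duads], so they
    can be compared with matchings by equality of lists, and statements about matchings are decided
    by enumeration. *)
Fixpoint matchings (s : seq (nat * nat)) : seq (seq (nat * nat)) :=
  if s is d :: s' then
    matchings s' ++ [seq d :: t | t <- matchings s' & ~~ has (meets d) t]
  else [:: [::]].

Definition synthemes := [seq t <- matchings duads | size t == 3%N].

Definition star i := [seq d <- duads | (d.1 == i) || (d.2 == i)].

Lemma mem_matchings t s :
  subseq t s -> pairwise (fun d e => ~~ meets d e) t -> t \in matchings s.
Proof.
elim: s t => [|d s IHs] t /=; first by move=> /eqP ->.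
case: t => [|e t] /=; first by move=> _ _; rewrite mem_cat IHs ?sub0seq.
rewrite mem_cat; case: eqP => [-> st /andP[dt tP]|_ st tP]; apply/orP.
  right; apply: map_f; rewrite mem_filter IHs // andbT -all_predC.
  by apply: sub_all dt.
by left; apply: IHs.
Qed.

Lemma duadsP d : (d \in duads) = (d.1 < d.2 < 6)%N.
Proof.
apply/idP/idP => [|/andP[]]; last first.
  by case: d => [[|[|[|[|[|[|i]]]]]] [|[|[|[|[|[|j]]]]]]] //=; lia.
by apply: (allP (_ : all (fun d : nat * nat => d.1 < d.2 < 6)%N duads)).
Qed.

Lemma third_index i j : exists2 k, (k < 6)%N & (k != i) && (k != j).
Proof.
have [i0|i0] := eqVneq i 0%N; have [j0|j0] := eqVneq j 0%N.
- by exists 1%N; rewrite // i0 j0.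
- have [j1|j1] := eqVneq j 1%N; first by exists 2%N; rewrite // i0 j1.
  by exists 1%N; rewrite // i0 /= eq_sym.
- have [i1|i1] := eqVneq i 1%N; first by exists 2%N; rewrite // j0 i1.
  by exists 1%N; rewrite // j0 andbT eq_sym.
- by exists 0%N; rewrite // ![0%N == _]eq_sym i0 j0.
Qed.

Lemma size_star i : (i < 6)%N -> size (star i) = 5%N.
Proof.
have /allP h : all (fun i => size (star i) == 5%N) (iota 0 6) by vm_compute.
by move=> li; apply/eqP/h; rewrite mem_iota.
Qed.

(** The duads of a star share an index, so no star contains two disjoint duads. This separates the
    crossings of disjoint joins from the six points themselves. *)
Lemma matching_star t i : t \in matchings duads -> (1 < size t)%N -> (i < 6)%N ->
  ~~ all (mem (star i)) t.
Proof.
have /allP h : let M := matchings duads in all (fun i => all (fun t =>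
  (1 < size t)%N ==> ~~ all (mem (star i)) t) M) (iota 0 6) by vm_compute.
move=> tM st li; have := h i; rewrite mem_iota => /(_ li)/allP/(_ t tM).
by rewrite st.
Qed.

Lemma size_matching t : t \in matchings duads -> (size t < 4)%N.
Proof.
have /allP h : all (fun t => size t < 4)%N (matchings duads) by vm_compute.
exact: h.
Qed.

Lemma matching_uniq t : t \in matchings duads -> uniq t.
Proof. have /allP h : all uniq (matchings duads) by vm_compute. exact: h. Qed.

Lemma matching_sub t : t \in matchings duads -> {subset t <= duads}.
Proof.
have /allP h : all (fun t => all (mem duads) t) (matchings duads) by vm_compute.
by move/h/allP.
Qed.

Lemma syntheme_maximal s t : s \in matchings duads -> t \in matchings duads ->
  size s = 3%N -> {subset s <= t} -> t = s.
Proof.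
have /allP h : let M := matchings duads in let S := [seq s <- M | size s == 3%N] in
  all (fun t : seq (nat * nat) =>
    all (fun s : seq (nat * nat) => all (mem t) s ==> (t == s)) S) M by vm_compute.
move=> sM /h/allP/(_ s) + s3 /allP st; rewrite mem_filter s3 sM => /(_ isT).
by move/implyP/(_ st)/eqP.
Qed.

(** Two disjoint duads leave only one duad that can be added, and adding it completes a syntheme. *)
Lemma matching_extension s t : s \in matchings duads -> t \in matchings duads ->
  size s = 2%N -> {subset s <= t} -> t = s \/ size t = 3%N.
Proof.
have /allP h : let M := matchings duads in let S := [seq s <- M | size s == 2%N] in
  all (fun t : seq (nat * nat) =>
    all (fun s : seq (nat * nat) => all (mem t) s ==> (t == s) || (size t == 3%N)) S) M
  by vm_compute.
move=> sM /h/allP/(_ s) + s2 /allP st; rewrite mem_filter s2 sM => /(_ isT).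
by move=> /implyP/(_ st)/orP[]/eqP; [left|right].
Qed.

End Duads.

Arguments matchings : simpl never.
Arguments star : simpl never.
Arguments synthemes : simpl never.

(** * Six points in general position and the incidences of their fifteen joins *)

Section Configurations.
Variable F : fieldType.
Implicit Types (p : nat -> 'rV[F]_3) (u v w x : 'rV[F]_3).

Lemma br_rotl u v w : br u v w = br v w u.
Proof. by rewrite !brE; ring. Qed.

Lemma br_swapl u v w : br u v w = - br v u w.
Proof. by rewrite !brE; ring. Qed.

Lemma br_swapr u v w : br u v w = - br u w v.
Proof. by rewrite !brE; ring. Qed.

Lemma br_same1 u v : br u u v = 0. Proof. by rewrite brE; ring. Qed.
Lemma br_same2 u v : br u v u = 0. Proof. by rewrite brE; ring. Qed.

Lemma crossvv u : cross u u = 0.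
Proof. by apply: row3P; rewrite !mxE /=; ring. Qed.

Definition gen p := forall i j k,
  (i < j)%N -> (j < k)%N -> (k < 6)%N -> br (p i) (p j) (p k) != 0.

Definition join p (d : nat * nat) := cross (p d.1) (p d.2).

Definition inc p x := [seq d <- duads | dot x (join p d) == 0].

Definition conc p s :=
  br (join p (nth (0, 0)%N s 0)) (join p (nth (0, 0)%N s 1))
     (join p (nth (0, 0)%N s 2)) == 0.

Definition concurrent p := [seq s <- synthemes | conc p s].

(** These pairs index the double points of the arrangement of joins. *)
Definition crossings p := [seq t <- matchings duads |
  (size t == 2%N) && ~~ has (fun s => all (mem s) t) (concurrent p)].

Section General.
Variables (p : nat -> 'rV[F]_3) (genp : gen p).

Lemma gen_uniq i j k : (i < 6)%N -> (j < 6)%N -> (k < 6)%N ->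
  uniq [:: i; j; k] -> br (p i) (p j) (p k) != 0.
Proof.
rewrite /= !inE negb_or andbT => li lj lk /andP[/andP[ij ik] jk].
have [ij'|ij'|e] := ltngtP i j; last by rewrite e eqxx in ij.
  have [jk'|jk'|e] := ltngtP j k; last by rewrite e eqxx in jk.
    exact: genp.
  have [ik'|ik'|e] := ltngtP i k; last by rewrite e eqxx in ik.
    by rewrite br_swapr oppr_eq0; apply: genp.
  by rewrite -br_rotl; apply: genp.
have [jk'|jk'|e] := ltngtP j k; last by rewrite e eqxx in jk.
  have [ik'|ik'|e] := ltngtP i k; last by rewrite e eqxx in ik.
    by rewrite br_swapl oppr_eq0; apply: genp.
  by rewrite br_rotl; apply: genp.
by rewrite br_swapl -br_rotl oppr_eq0; apply: genp.
Qed.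

Lemma gen_neq0 i : (i < 6)%N -> p i != 0.
Proof.
move=> li; have [j [k [lj lk u]]] :
    exists j k, [/\ (j < 6)%N, (k < 6)%N & uniq [:: i; j; k]].
  by case: i li => [|[|i]] li; [exists 1%N, 2%N|exists 0%N, 2%N|exists 0%N, 1%N].
by apply: contraNneq (gen_uniq li lj lk u) => ->; rewrite brE !mxE !mul0r !addr0.
Qed.

Lemma gen_cross i j : (i < 6)%N -> (j < 6)%N -> i != j -> cross (p i) (p j) != 0.
Proof.
move=> li lj ij; have [k lk /andP[ki kj]] := third_index i j.
have u : uniq [:: k; i; j] by rewrite /= !inE negb_or ki kj ij.
apply: contraNneq (gen_uniq lk li lj u) => e.
by rewrite /br e /dot !mxE !mulr0 !addr0.
Qed.

Lemma join_neq0 d : d \in duads -> join p d != 0.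
Proof.
rewrite duadsP => /andP[l1 l2]; apply: gen_cross => //; first exact: ltn_trans l2.
by rewrite ltn_eqF.
Qed.

Lemma dot_join i d : (i < 6)%N -> d \in duads ->
  (dot (p i) (join p d) == 0) = (d.1 == i) || (d.2 == i).
Proof.
move=> li; rewrite duadsP => /andP[l1 l2].
have [<-|n1] := eqVneq d.1 i; first by rewrite dot_cross_l eqxx.
have [<-|n2] := eqVneq d.2 i; first by rewrite dot_cross_r eqxx.
apply: negPf; apply: gen_uniq => //; first exact: ltn_trans l2.
by rewrite /= !inE negb_or eq_sym n1 eq_sym n2 (ltn_eqF l1).
Qed.

(** The hypothesis says that [dot x u *: v] equals [dot x v *: u]; crossing with [v] or with [u]
    isolates one of the two coefficients. *)
Lemma cross_lin u v x : cross u v != 0 -> cross (cross u v) x = 0 ->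
  dot u x = 0 /\ dot v x = 0.
Proof.
move=> uv0; rewrite cross_cross => e; rewrite ![dot _ x]dotC.
have e1 : dot x v *: cross u v = 0.
  rewrite -crossZl -[RHS](_ : cross (dot x u *: v) v = 0).
    by congr cross; apply/esym/eqP; rewrite -subr_eq0 e.
  by rewrite crossZl crossvv scaler0.
have e2 : dot x u *: cross u v = 0.
  rewrite -crossZr -[RHS](_ : cross u (dot x v *: u) = 0).
    by congr cross; apply/eqP; rewrite -subr_eq0 e.
  by rewrite crossZr crossvv scaler0.
by move/eqP: e1; move/eqP: e2; rewrite !scaler_eq0 (negPf uv0) !orbF => /eqP-> /eqP->.
Qed.

(** If two joins were the same line, both ends of [d] would lie on the join of [e]; general position
    makes them the ends of [e]. *)
Lemma cross_join_neq0 d e : d \in duads -> e \in duads -> d != e ->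
  cross (join p d) (join p e) != 0.
Proof.
move=> dP eP; apply: contraNneq => ce.
have [l1 l2] : (d.1 < 6)%N /\ (d.2 < 6)%N.
  by move: dP; rewrite duadsP => /andP[l1 l2]; split=> //; apply: ltn_trans l2.
have [/eqP + /eqP] := cross_lin (join_neq0 dP) ce; rewrite !dot_join //.
move: dP eP; rewrite !duadsP; case: d e {ce l1 l2} => a b [i j] /=.
move=> /andP[ab _] /andP[ij _] /orP[]/eqP e1 /orP[]/eqP e2; subst=> //.
- by rewrite ltnn in ab.
- by have := ltn_trans ab ij; rewrite ltnn.
- by rewrite ltnn in ab.
Qed.

Lemma inc_sub x s : {subset s <= duads} ->
  all (mem (inc p x)) s = all (fun d => dot x (join p d) == 0) s.
Proof.
by move=> sd; apply: eq_in_all => d /sd dP; rewrite /= mem_filter dP andbT.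
Qed.

Lemma inc_star i c : (i < 6)%N -> c != 0 -> inc p (c *: p i) = star i.
Proof.
move=> li c0; apply: eq_in_filter => d dP.
by rewrite dotZl mulf_eq0 (negPf c0) dot_join.
Qed.

(** The cross product of the lines ab and ac is the bracket of a, b, c times a, so joins with a
    common end meet only there. *)
Lemma meet_joins a b c x : br a b c != 0 ->
  dot x (cross a b) = 0 -> dot x (cross a c) = 0 -> exists k, x = k *: a.
Proof.
move=> abc xab xac; have a0 : a != 0.
  by apply: contraNneq abc => ->; rewrite brE !mxE !mul0r !addr0.
have E : cross (cross a b) (cross a c) = br a b c *: a.
  by apply: row3P; rewrite brE !mxE /=; ring.
have [|k ->] := cross_meet _ xab xac; last by rewrite E scalerA; exists (k * br a b c).
by rewrite E scaler_eq0 negb_or abc.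
Qed.

Lemma meets_center d e x : d \in duads -> e \in duads -> d != e -> meets d e ->
  dot x (join p d) = 0 -> dot x (join p e) = 0 ->
  exists i c, (i < 6)%N /\ x = c *: p i.
Proof.
rewrite !duadsP; case: d e => a b [i j]; rewrite /join /meets /= xpair_eqE.
move=> /andP[ab lb] /andP[ij lj] ne m; have la := ltn_trans ab lb.
have li := ltn_trans ij lj.
have flip k l : dot x (cross (p k) (p l)) = 0 -> dot x (cross (p l) (p k)) = 0.
  by move=> e; rewrite crossC -scaleN1r dotZr e mulr0.
have key k l m' : (k < 6)%N -> (l < 6)%N -> (m' < 6)%N -> uniq [:: k; l; m'] ->
    dot x (cross (p k) (p l)) = 0 -> dot x (cross (p k) (p m')) = 0 ->
    exists i c, (i < 6)%N /\ x = c *: p i.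
  move=> lk ll lm u e1 e2; have [c ->] := meet_joins (gen_uniq lk ll lm u) e1 e2.
  by exists k, c.
case/or4P: m ne => /eqP E; subst; rewrite ?eqxx /= ?andbT => ne e1 e2.
- by apply: (key i b j) => //; rewrite /= !inE negb_or ne (ltn_eqF ab) (ltn_eqF ij).
- apply: (key j b i) => //; last exact: flip.
  by rewrite /= !inE negb_or (ltn_eqF ab) (gtn_eqF ij) (gtn_eqF (ltn_trans ij ab)).
- apply: (key i a j) => //; last exact: flip.
  by rewrite /= !inE negb_or (gtn_eqF ab) (ltn_eqF ij) (ltn_eqF (ltn_trans ab ij)).
- apply: (key j a i); rewrite //; try exact: flip.
  by rewrite /= !inE negb_or (gtn_eqF ab) (gtn_eqF ij) ne.
Qed.

(** By [meets_center], two joins with a common index meet only in one of the six points. *)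
Lemma inc_matching x : (forall i c, (i < 6)%N -> x != c *: p i) ->
  inc p x \in matchings duads.
Proof.
move=> xp; apply: mem_matchings; first exact: filter_subseq.
have ui : uniq (inc p x) by apply: filter_uniq.
have : pairwise (fun d e => d != e) (inc p x) by rewrite -uniq_pairwise.
apply: (@sub_in_pairwise _ (mem (inc p x))); last exact/allP.
move=> d e di ei de; move: (di : d \in inc p x) (ei : e \in inc p x); rewrite !mem_filter => /andP[/eqP xd dP] /andP[/eqP xe eP].

apply/negP => /(meets_center dP eP de)/(_ xd xe)[i [c [li xE]]].
by have /eqP := xp i c li; apply.
Qed.

Lemma inc_cases x : x != 0 ->
  (exists i c, [/\ (i < 6)%N, c != 0, x = c *: p i & inc p x = star i]) \/
  (forall i c, (i < 6)%N -> x != c *: p i) /\ inc p x \in matchings duads.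
Proof.
move=> x0; case: (pselect (exists i c, (i < 6)%N /\ x = c *: p i)).
  case=> i [c [li xE]]; left; exists i, c; have c0 : c != 0.
    by apply: contraNneq x0 => c0; rewrite xE c0 scale0r.
  by split=> //; rewrite xE inc_star.
move=> h; right; have xp i c : (i < 6)%N -> x != c *: p i.
  by move=> li; apply/eqP => xE; apply: h; exists i, c.
by split=> //; exact: inc_matching.
Qed.

Lemma size_inc x : x != 0 -> size (inc p x) \in [:: 0; 1; 2; 3; 5]%N.
Proof.
move/inc_cases => [[i [c [li _ _ ->]]]|[_ /size_matching]].
  by rewrite size_star.
by case: (size _) => [|[|[|[|]]]].
Qed.

Lemma size_inc5 x : x != 0 ->
  size (inc p x) = 5%N <-> exists i c, (i < 6)%N /\ x = c *: p i.
Proof.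
move=> x0; split=> [|[i [c [li xE]]]]; last first.
  have c0 : c != 0 by apply: contraNneq x0 => c0; rewrite xE c0 scale0r.
  by rewrite xE inc_star // size_star.
have [[i [c [li _ xE _]]]|[_ /size_matching + s5]] := inc_cases x0; first by exists i, c.
by rewrite s5.
Qed.

Lemma inc_matching_small x : x != 0 -> (size (inc p x) < 4)%N ->
  inc p x \in matchings duads.
Proof.
by move/inc_cases => [[i [c [li _ _ ->]]]|[]//]; rewrite size_star.
Qed.

Lemma inc_vanish x : all (fun d => dot x (join p d) == 0) (inc p x).
Proof. exact: filter_all. Qed.

(** The first two joins of [t] already determine [x] up to a factor. Since [t] contains two disjoint
    duads, [x] is none of the six points, so [inc p x] is a matching again. *)
Lemma center_inc t x : t \in matchings duads -> (1 < size t)%N -> x != 0 ->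
  all (fun d => dot x (join p d) == 0) t ->
  [/\ exists2 c, c != 0 & x = c *: cross (join p (nth (0, 0)%N t 0)) (join p (nth (0, 0)%N t 1)),
      inc p x \in matchings duads & {subset t <= inc p x}].
Proof.
move=> tM st x0 xt; have td := matching_sub tM.
have sub : {subset t <= inc p x} by apply/allP; rewrite inc_sub.
split=> //.
  have l0 : (0 < size t)%N by apply: leq_trans st.
  have d0 := mem_nth (0, 0)%N l0; have d1 := mem_nth (0, 0)%N st.
  have ne : nth (0, 0)%N t 0 != nth (0, 0)%N t 1 by rewrite nth_uniq ?matching_uniq.
  have /allP xt' := xt.
  have [c xE] := cross_meet (cross_join_neq0 (td _ d0) (td _ d1) ne)
     (eqP (xt' _ d0)) (eqP (xt' _ d1)).
  by exists c => //; apply: contraNneq x0 => c0; rewrite xE c0 scale0r.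
have [[i [c [li _ _ iE]]]|[]//] := inc_cases x0; exfalso.
have : all (mem (star i)) t by rewrite -iE; apply/allP.
by rewrite (negPf (matching_star tM st li)).
Qed.

Lemma concurrent_matching s : s \in concurrent p ->
  [/\ s \in matchings duads, size s = 3%N & conc p s].
Proof. by rewrite !mem_filter => /and3P[-> /eqP-> ->]. Qed.

Lemma inc3P x : x != 0 -> size (inc p x) = 3%N -> inc p x \in concurrent p.
Proof.
move=> x0 s3; have iM : inc p x \in matchings duads.
  by apply: inc_matching_small; rewrite ?s3.
rewrite !mem_filter s3 eqxx iM !andbT.
have := inc_vanish x.
rewrite /conc; case: (inc p x) s3 => [|d0 [|d1 [|d2 [|]]]] //= _.
rewrite andbT => /and3P[/eqP e0 /eqP e1 /eqP e2].
apply: contraNT x0 => nz; apply/eqP.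
have cn : cross (join p d1) (join p d2) != 0.
  by apply: contraNneq nz => e; rewrite /br e /dot !mxE !mulr0 !addr0.
have [c xE] := cross_meet cn e1 e2; move: e0; rewrite dotC xE dotZr => /eqP.
by rewrite mulf_eq0 -/(br _ _ _) (negPf nz) orbF => /eqP->; rewrite scale0r.
Qed.

Definition center t := cross (join p (nth (0, 0)%N t 0)) (join p (nth (0, 0)%N t 1)).

Lemma center_neq0 t : t \in matchings duads -> (1 < size t)%N -> center t != 0.
Proof.
move=> tM st; have l0 : (0 < size t)%N by apply: leq_trans st.
apply: cross_join_neq0; rewrite ?nth_uniq ?matching_uniq //;
  by apply: (matching_sub tM); rewrite mem_nth.
Qed.

Lemma inc_center s : s \in concurrent p -> inc p (center s) = s.
Proof.
move=> /concurrent_matching[sM s3 sc].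
have x0 : center s != 0 by apply: center_neq0; rewrite ?s3.
have xs : all (fun d => dot (center s) (join p d) == 0) s.
  move: sc; rewrite /conc /center; case: s s3 {sM x0} => [|d0 [|d1 [|d2 []]]] //= _ c.
  by rewrite dotC dot_cross_l dotC dot_cross_r !eqxx /= dotC -/(br _ _ _) br_rotl c.
have [|_ iM sub] := center_inc sM _ x0 xs; first by rewrite s3.
exact: syntheme_maximal.
Qed.

(** If the two duads belonged to a concurrent syntheme, [x] would be its centre and would lie on a
    third join. *)
Lemma inc2P x : x != 0 -> size (inc p x) = 2%N -> inc p x \in crossings p.
Proof.
move=> x0 s2; have iM : inc p x \in matchings duads.
  by apply: inc_matching_small; rewrite ?s2.
rewrite mem_filter s2 iM andbT /=; apply/hasPn => s sC; apply/negP => sub.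
have [sM s3 _] := concurrent_matching sC; have cE := inc_center sC.
have c0 : center s != 0 by apply: center_neq0; rewrite ?s3.
have ci : all (fun d => dot (center s) (join p d) == 0) (inc p x).
  by rewrite -inc_sub ?cE //; apply: matching_sub.
have [|[a a0 xE] _ _] := center_inc iM _ x0 (inc_vanish x); first by rewrite s2.
have [|[b b0 cE'] _ _] := center_inc iM _ c0 ci; first by rewrite s2.
suff : size (inc p x) = size (inc p (center s)) by rewrite s2 cE s3.
congr size; apply: eq_filter => d; rewrite [in LHS]xE cE' !dotZl !mulf_eq0.
by rewrite (negPf a0) (negPf b0).
Qed.

(** A third join through the crossing would complete [t] to a concurrent syntheme, which membership
    in [crossings] forbids. *)
Lemma inc_crossing t : t \in crossings p -> center t != 0 /\ inc p (center t) = t.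
Proof.
rewrite mem_filter => /andP[/andP[/eqP s2 /hasPn nc] tM].
have x0 : center t != 0 by apply: center_neq0; rewrite ?s2.
split=> //; have xt : all (fun d => dot (center t) (join p d) == 0) t.
  rewrite /center; case: t s2 {tM x0 nc} => [|d0 [|d1 []]] //= _.
  by rewrite dotC dot_cross_l dotC dot_cross_r !eqxx.
have [|_ iM sub] := center_inc tM _ x0 xt; first by rewrite s2.
have [//|s3] := matching_extension tM iM s2 sub.
by have := nc _ (inc3P x0 s3); move/negP; case; apply/allP.
Qed.

End General.
End Configurations.

(** * The arrangement dual to six points, its joins and its singular points *)

Section Arrangements.
Variable F : fieldType.
Implicit Types (p : nat -> 'rV[F]_3) (u v w x : 'rV[F]_3) (A : set (line F)).

Definition arr p : set (line F) := [set ln (p i) | i in `I_6].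

Lemma annihilator_ln v w : v != 0 -> w != 0 ->
  (forall y z, y \in val (pt w) -> z \in val (ln v) -> y *m z^T = 0) <->
  pt w = pt v.
Proof.
move=> v0 w0; split=> [h|/pt_eq[] // c c0 wE].
  have [|c vE] := @cross_prop _ v w w0.
    apply: ker_dot_sub => //; apply/subvP => z; rewrite !mem_ker_dot => zv.
    rewrite dotC; apply/eqP/mul_tr_eq0/h; first by rewrite val_pt ?memv_line.
    by rewrite val_ln // mem_ker_dot.
  apply/esym/pt_eq => //; exists c => //.
  by apply: contraNneq v0 => c0; rewrite vE c0 scale0r.
move=> y z; rewrite val_pt // val_ln // mem_ker_dot => /vlineP[k ->] /eqP e.
by apply/mul_tr_eq0; rewrite wE scalerA dotZl dotC e mulr0.
Qed.

Lemma dual_points_arr p : (forall i, (i < 6)%N -> p i != 0) ->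
  dual_points (arr p) = [set pt (p i) | i in `I_6].
Proof.
move=> p0; apply/seteqP; split=> [q [l [i li <-]]|_ [i li <-]].
  have [w w0 ->] := ptP q => /(annihilator_ln (p0 i li) w0) ->.
  by exists i.
by exists (ln (p i)); [exists i|apply/annihilator_ln => //; exact: p0].
Qed.

Definition joins p : set (line F) := [set ln (join p d) | d in [set` duads]].

Section General.
Variables (p : nat -> 'rV[F]_3) (genp : gen p).

Let p0 i : (i < 6)%N -> p i != 0. Proof. exact: gen_neq0. Qed.

Lemma pt_inj i j : (i < 6)%N -> (j < 6)%N -> pt (p i) = pt (p j) -> i = j.
Proof.
move=> li lj; case: (eqVneq i j) => // ij /(pt_eq (p0 li) (p0 lj))[c _ e].
have := gen_cross genp li lj ij; rewrite e crossZl crossvv scaler0.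
by rewrite eqxx.
Qed.

Lemma ln_inj i j : (i < 6)%N -> (j < 6)%N -> ln (p i) = ln (p j) -> i = j.
Proof. by move=> li lj /ln_eq e; apply: pt_inj => //; apply: e; apply: p0. Qed.

Lemma pt_join_inj : {in duads &, injective (fun d => pt (join p d))}.
Proof.
move=> d e dP eP /(pt_eq (join_neq0 genp dP) (join_neq0 genp eP))[c _ E].
apply/eqP; apply: contraT => de; have := cross_join_neq0 genp dP eP de.
by rewrite E crossZl crossvv scaler0 eqxx.
Qed.

Lemma ln_join_inj : {in duads &, injective (fun d => ln (join p d))}.
Proof.
move=> d e dP eP /ln_eq h; apply: pt_join_inj => //.
by apply: h; apply: (join_neq0 genp).
Qed.

Lemma lines_at_least2_arr : lines_at_least 2 (dual_points (arr p)) = joins p.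
Proof.
rewrite dual_points_arr //; apply/seteqP; split=> [l|_ [d dP <-]].
  have [v v0 ->] := lnP l => /card_le2P[_ [_ [[[i li <-] iv] [[j lj <-] jv] ne]]].
  wlog ij : i j li lj iv jv ne / (i < j)%N => [th|].
    have [ij|ij|e] := ltngtP i j; first exact: (th i j).
      by apply: (th j i) => // e; apply: ne.
    by case: ne; rewrite e.
  exists (i, j); first by rewrite /= duadsP ij lj.
  have dP : (i, j) \in duads by rewrite duadsP ij lj.
  have cn := join_neq0 genp dP; apply/esym/ln_eq => //.
  have iv' : dot v (p i) = 0 by rewrite dotC; exact: (iffLR (on_lineE (p0 li) v0) iv).
  have jv' : dot v (p j) = 0 by rewrite dotC; exact: (iffLR (on_lineE (p0 lj) v0) jv).
  have [c vE] := cross_meet (cn : cross (p i) (p j) != 0) iv' jv'.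
  have c0 : c != 0 by apply: contraNneq v0 => c0; rewrite vE c0 scale0r.
  by apply/pt_eq => //; exists c.
have cn := join_neq0 genp dP; move: dP; rewrite /= duadsP => /andP[l1 l2].
have l1' := ltn_trans l1 l2.
apply: (@card_le2 _ _ (pt (p d.1)) (pt (p d.2))).
- by split; [exists d.1|apply/on_lineE; rewrite ?p0 // dot_cross_l].
- by split; [exists d.2|apply/on_lineE; rewrite ?p0 // dot_cross_r].
- by move/pt_inj => /(_ l1' l2) e; rewrite e ltnn in l1.
Qed.

Local Open Scope card_scope.

Lemma joins_through x : x != 0 ->
  [set l | joins p l /\ on_line (pt x) l] #= `I_(size (inc p x)).
Proof.
move=> x0; have -> : [set l | joins p l /\ on_line (pt x) l] =
    [set ln (join p d) | d in [set` inc p x]].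
  apply/seteqP; split=> [_ [[d dP <-]]|_ [d + <-]].
    move/on_lineE => /(_ x0 (join_neq0 genp dP)) e; exists d => //=.
    by rewrite mem_filter e eqxx.
  rewrite /= mem_filter => /andP[/eqP xd dP]; split; first by exists d.
  by apply/on_lineE => //; exact: join_neq0.
apply: card_image_seq; first by rewrite filter_uniq.
by move=> d e; rewrite !mem_filter => /andP[_ dP] /andP[_ eP]; exact: ln_join_inj.
Qed.

Lemma kpoints_joins k x : x != 0 ->
  kpoints k (joins p) (pt x) <-> size (inc p x) = k.
Proof.
move=> x0; split=> [h|<-]; last exact: joins_through.
exact: card_II_uniq (joins_through x0) h.
Qed.

Lemma inc_inj x y : x != 0 -> y != 0 -> inc p x = inc p y ->
  inc p x \in matchings duads -> (1 < size (inc p x))%N -> pt x = pt y.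
Proof.
move=> x0 y0 e iM s; have [[a a0 xE] _ _] := center_inc genp iM s x0 (inc_vanish p x).
have yv : all (fun d => dot y (join p d) == 0) (inc p x).
  by rewrite e; exact: inc_vanish.
have [[b b0 yE] _ _] := center_inc genp iM s y0 yv.
apply/pt_eq => //; exists (a / b); first by rewrite mulf_neq0 ?invr_eq0.
by rewrite yE scalerA divfK.
Qed.

(** A point on several joins of a matching is recovered from its incidence list as a centre, so
    counting k-points becomes counting lists. *)
Lemma kpoints_joins_card k (L : seq (seq (nat * nat))) :
  uniq L -> (1 < k)%N ->
  (forall x, x != 0 -> size (inc p x) = k -> inc p x \in L) ->
  (forall t, t \in L -> [/\ size t = k, t \in matchings duads, center p t != 0 &
                            inc p (center p t) = t]) ->
  kpoints k (joins p) #= `I_(size L).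
Proof.
move=> uL k1 LP PL.
have -> : kpoints k (joins p) = [set pt (center p t) | t in [set` L]].
  apply/seteqP; split=> [q|_ [t tL <-]].
    have [x x0 ->] := ptP q => /(kpoints_joins _ x0) sx.
    have xL := LP x x0 sx; exists (inc p x) => //.
    have [_ iM c0 iE] := PL _ xL.
    by apply/esym; apply: inc_inj; rewrite ?iE // sx.
  have [st tM c0 iE] := PL _ tL.
  by apply/kpoints_joins => //; rewrite iE.
apply: card_image_seq => // s t sL tL.
have [_ _ s0 sE] := PL _ sL; have [_ _ t0 tE] := PL _ tL.
move/(pt_eq s0 t0) => [c c0 e]; rewrite -sE -tE e.
by apply: eq_filter => d; rewrite dotZl mulf_eq0 (negPf c0).
Qed.

Lemma kpoints2_joins : kpoints 2 (joins p) #= `I_(size (crossings p)).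
Proof.
apply: kpoints_joins_card => //.
- by rewrite filter_uniq //; vm_compute.
- by move=> x; exact: inc2P.
move=> t tC; have [c0 iE] := inc_crossing genp tC; split=> //.
  by move: tC; rewrite mem_filter => /andP[/andP[/eqP]].
by move: tC; rewrite mem_filter => /andP[].
Qed.

Lemma kpoints3_joins : kpoints 3 (joins p) #= `I_(size (concurrent p)).
Proof.
apply: kpoints_joins_card => //.
- by rewrite filter_uniq //; vm_compute.
- by move=> x; exact: inc3P.
move=> t tC; have [tM t3 _] := concurrent_matching tC; split=> //.
  by apply: center_neq0; rewrite ?t3.
exact: inc_center.
Qed.

Lemma kpoints5_joinsE : kpoints 5 (joins p) = [set pt (p i) | i in `I_6].
Proof.
apply/seteqP; split=> [q|_ [i li <-]].
  have [x x0 ->] := ptP q => /(kpoints_joins _ x0)/(size_inc5 genp x0)[i [c [li xE]]].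
  exists i => //; apply/esym/pt_eq; rewrite ?p0 //; exists c => //.
  by apply: contraNneq x0 => c0; rewrite xE c0 scale0r.
apply/kpoints_joins; first exact: p0.
by apply/(size_inc5 genp (p0 li)); exists i, 1; rewrite scale1r.
Qed.

Lemma kpoints_joins0 k : (2 <= k)%N -> k \notin [:: 2; 3; 5]%N ->
  kpoints k (joins p) = set0.
Proof.
move=> k2 kn; apply/seteqP; split=> // q; have [x x0 ->] := ptP q.
move=> /(kpoints_joins _ x0) sx; move: (size_inc genp x0) k2 kn; rewrite sx.
by rewrite !inE => /or4P[|||/orP[]] /eqP ->.
Qed.

Lemma arr_card : arr p #= `I_6.
Proof. by apply: inj_card_eq => i j; rewrite !inE => li lj; exact: ln_inj. Qed.

Definition zeros x := [seq i <- iota 0 6 | dot x (p i) == 0].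

Lemma arr_through x : x != 0 ->
  [set l | arr p l /\ on_line (pt x) l] #= `I_(size (zeros x)).
Proof.
move=> x0; have -> : [set l | arr p l /\ on_line (pt x) l] =
    [set ln (p i) | i in [set` zeros x]].
  apply/seteqP; split=> [_ [[i li <-]]|_ [i + <-]].
    move/on_lineE => /(_ x0 (p0 li)) e; exists i => //=.
    by rewrite mem_filter e eqxx mem_iota.
  rewrite /= mem_filter mem_iota => /andP[/eqP xd li]; split; first by exists i.
  by apply/on_lineE => //; exact: p0.
apply: card_image_seq; first by rewrite filter_uniq ?iota_uniq.
move=> i j; rewrite !mem_filter !mem_iota => /andP[_ li] /andP[_ lj].
exact: ln_inj.
Qed.

Lemma kpoints_arr k x : x != 0 -> kpoints k (arr p) (pt x) <-> size (zeros x) = k.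
Proof.
move=> x0; split=> [h|<-]; last exact: arr_through.
exact: card_II_uniq (arr_through x0) h.
Qed.

Lemma zeros_le2 x : x != 0 -> (size (zeros x) <= 2)%N.
Proof.
move=> x0; rewrite leqNgt; apply/negP.
have : uniq (zeros x) by rewrite filter_uniq ?iota_uniq.
have : all (fun i => (i < 6)%N && (dot x (p i) == 0)) (zeros x).
  by apply/allP => i; rewrite mem_filter mem_iota andbC => /andP[li ->]; rewrite andbT.
case: (zeros x) => [|i [|j [|k s]]] //= /and4P[].
move=> /andP[li /eqP xi] /andP[lj /eqP xj] /andP[lk /eqP xk] _ u _.
have u' : uniq [:: i; j; k].
  move: u; rewrite /= !inE !negb_or => /and3P[/and3P[-> -> _] /andP[-> _] _] //.
have ij : j != k by move: u'; rewrite /= !inE => /and3P[].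
have [c xE] := cross_meet (gen_cross genp lj lk ij) xj xk.
have := gen_uniq genp li lj lk u'; rewrite /br.
have c0 : c != 0 by apply: contraNneq x0 => c0; rewrite xE c0 scale0r.
by move: xi; rewrite xE dotZl dotC => /eqP; rewrite mulf_eq0 (negPf c0) /= => ->.
Qed.

(** The lines [ln (p i)] and [ln (p j)] meet in [cross (p i) (p j)], which is also the coordinate
    vector of the join of the dual points. The same fifteen vectors serve as double points and as
    joins. *)
Lemma kpoints2_arrE : kpoints 2 (arr p) = [set pt (join p d) | d in [set` duads]].
Proof.
apply/seteqP; split=> [q|_ [d dP <-]].
  have [x x0 ->] := ptP q => /(kpoints_arr _ x0).
  have : sorted ltn (zeros x) by apply: sorted_filter => //; apply: ltn_trans.
  have : all (fun i => (i < 6)%N && (dot x (p i) == 0)) (zeros x).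
    by apply/allP => i; rewrite mem_filter mem_iota andbC => /andP[li ->]; rewrite andbT.
  case: (zeros x) => [|i [|j [|k s]]] //= /and3P[].
  move=> /andP[li /eqP xi] /andP[lj /eqP xj] _; rewrite andbT => ij _.
  exists (i, j) => /=; first by rewrite duadsP ij lj.
  have dP : (i, j) \in duads by rewrite duadsP ij lj.
  have [c xE] := cross_meet (join_neq0 genp dP : cross (p i) (p j) != 0) xi xj.
  apply/esym/pt_eq => //; first exact: (join_neq0 genp dP).
  by exists c => //; apply: contraNneq x0 => c0; rewrite xE c0 scale0r.
have jn := join_neq0 genp dP; apply/kpoints_arr => //; apply/eqP.
rewrite eqn_leq zeros_le2 //=; move: dP; rewrite /= duadsP => /andP[l1 l2].
apply: (@uniq_leq_size _ [:: d.1; d.2]); first by rewrite /= inE (ltn_eqF l1).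
move=> i; rewrite !inE mem_filter mem_iota => /orP[] /eqP->.
  by rewrite dotC dot_cross_l eqxx (ltn_trans l1).
by rewrite dotC dot_cross_r eqxx.
Qed.

Lemma unassuming_arr : size (concurrent p) = 6%N -> size (crossings p) = 27%N ->
  ~ on_conic [set pt (p i) | i in `I_6] -> unassuming (arr p).
Proof.
move=> s3 s2 nc; rewrite /unassuming lines_at_least2_arr; split.
- exact: arr_card.
- split.
    rewrite kpoints2_arrE; apply: (@card_image_seq _ _ _ duads) => //.
    exact: pt_join_inj.
  move=> k k2; apply/seteqP; split=> // q; have [x x0 ->] := ptP q.
  move=> /(kpoints_arr _ x0) kE; have := zeros_le2 x0.
  by rewrite kE leqNgt k2.
- split; first by rewrite -s2; exact: kpoints2_joins.
    by rewrite -s3; exact: kpoints3_joins.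
  rewrite kpoints5_joinsE; apply: inj_card_eq => i j; rewrite !inE => li lj.
  exact: pt_inj.
- exact: kpoints_joins0.
- by rewrite kpoints5_joinsE.
Qed.

(** The line [ln x] passes through the double point [pt (join p d)] exactly when the dual point [x]
    lies on that join, so the new lines are dual to the triple points of the joins. *)
Lemma Lambda23_arr :
  Lambda23 (arr p) = [set ln x | x in [set x | x != 0 /\ size (inc p x) = 3%N]].
Proof.
rewrite /Lambda23 /lines_exactly kpoints2_arrE.
have key v : v != 0 ->
  [set q | [set pt (join p d) | d in [set` duads]] q /\ on_line q (ln v)]
    #= `I_(size (inc p v)).
  move=> v0; have -> : [set q | [set pt (join p d) | d in [set` duads]] q /\
      on_line q (ln v)] = [set pt (join p d) | d in [set` inc p v]].
    apply/seteqP; split=> [_ [[d dP <-]]|_ [d + <-]].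
      move/on_lineE => /(_ (join_neq0 genp dP) v0) e; exists d => //=.
      by rewrite mem_filter dotC e eqxx.
    rewrite /= mem_filter dotC => /andP[/eqP xd dP]; split; first by exists d.
    by apply/on_lineE => //; exact: join_neq0.
  apply: card_image_seq; first by rewrite filter_uniq.
  by move=> d e; rewrite !mem_filter => /andP[_ dP] /andP[_ eP]; exact: pt_join_inj.
apply/seteqP; split=> [l|_ [v [v0 s3] <-]] /=; last by rewrite -s3; exact: key.
have [v v0 ->] := lnP l => h; exists v => //; split=> //.
exact: card_II_uniq (key v v0) h.
Qed.

End General.

(** Three collinear dual points give three distinct lines through [cross (p j) (p k)], hence a
    k-point with k > 2. *)
Lemma arr_gen p : (forall i, (i < 6)%N -> p i != 0) ->
  (forall i j, (i < 6)%N -> (j < 6)%N -> ln (p i) = ln (p j) -> i = j) ->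
  (forall k, (2 < k)%N -> kpoints k (arr p) = set0) -> gen p.
Proof.
move=> p0 inj nk i j k ij jk lk; apply/negP => /eqP e.
have lj := ltn_trans jk lk; have li := ltn_trans ij lj.
have c0 : cross (p j) (p k) != 0.
  apply/eqP => /(cross_prop (p0 k lk))[c jE].
  have cn0 : c != 0 by apply: contraNneq (p0 j lj) => c0; rewrite jE c0 scale0r.
  have : ln (p j) = ln (p k) by apply/ln_eq; rewrite ?p0 //; apply/pt_eq; rewrite ?p0 //; exists c.
  by move/inj => /(_ lj lk) jkE; rewrite jkE ltnn in jk.
set x := cross _ _ in c0.
pose z := [seq m <- iota 0 6 | dot x (p m) == 0].
have zE : [set l | arr p l /\ on_line (pt x) l] = [set ln (p m) | m in [set` z]].
  apply/seteqP; split=> [_ [[m lm <-]]|_ [m + <-]].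
    move/on_lineE => /(_ c0 (p0 m lm)) ee; exists m => //=.
    by rewrite mem_filter ee eqxx mem_iota.
  rewrite /= mem_filter mem_iota => /andP[/eqP xd lm]; split; first by exists m.
  by apply/on_lineE => //; exact: p0.
have zc : kpoints (size z) (arr p) (pt x).
  rewrite /kpoints /= zE; apply: card_image_seq; first by rewrite filter_uniq ?iota_uniq.
  move=> a b; rewrite !mem_filter !mem_iota => /andP[_ la] /andP[_ lb].
  exact: inj.
have : (2 < size z)%N.
  apply: (@uniq_leq_size _ [:: i; j; k]).
    by rewrite /= !inE negb_or (ltn_eqF ij) (ltn_eqF jk) (ltn_eqF (ltn_trans ij jk)).
  move=> m; rewrite !inE mem_filter mem_iota => /or3P[] /eqP->; rewrite /= ?li ?lj ?lk andbT.
  - by rewrite /x dotC; apply/eqP; exact: e.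
  - by rewrite dotC dot_cross_l.
  - by rewrite dotC dot_cross_r.
by move/nk => /seteqP[/(_ _ zc)].
Qed.

Lemma unassuming_ex A : unassuming A -> exists p,
  [/\ A = arr p, gen p, size (concurrent p) = 6%N &
      ~ on_conic [set pt (p i) | i in `I_6]].
Proof.
move=> uA; case: (uA) => /card_II_enum[f [finj AE]] [_ nk] _ _ _.
have [p pE] : {p : nat -> 'rV[F]_3 & forall i, p i != 0 /\ f i = ln (p i)}.
  apply: (@boolp.choice _ _ (fun i v => v != 0 /\ f i = ln v)) => i.
  by have [v v0 ->] := lnP (f i); exists v.
have AE' : A = arr p by rewrite AE; apply: eq_imagel => i _; case: (pE i).
have genp : gen p.
  apply: arr_gen => [i _|i j li lj|]; [by case: (pE i)| |by rewrite -AE'].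
  by case: (pE i) => _ <-; case: (pE j) => _ <-; exact: finj.
exists p; split=> //; move: uA; rewrite /unassuming AE' lines_at_least2_arr //.
  by case=> _ _ [_ k3 _] _ _; apply: card_II_uniq (kpoints3_joins genp) k3.
by rewrite kpoints5_joinsE //; case.
Qed.

End Arrangements.

(** * The 720 relabellings and the possible sets of concurrent synthemes *)

Section Relabelling.

Definition sort_duad i j : nat * nat := if (i <= j)%N then (i, j) else (j, i).

Definition relabel (l : seq nat) (d : nat * nat) : nat * nat :=
  sort_duad (nth 0%N l d.1) (nth 0%N l d.2).

Definition insert_duad (d : nat * nat) (s : seq (nat * nat)) :=
  if s is [:: e; f] then
    if (d.1 <= e.1)%N then [:: d; e; f]
    else if (d.1 <= f.1)%N then [:: e; d; f] else [:: e; f; d]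
  else s.

Definition sort_duads (s : seq (nat * nat)) :=
  if s is [:: d; e; f] then
    insert_duad d (if (e.1 <= f.1)%N then [:: e; f] else [:: f; e])
  else s.

(** Sorting within and between the duads brings the image of a syntheme back to its canonical list
    in [synthemes]. *)
Definition relabels l s := sort_duads [seq relabel l d | d <- s].

Definition hexads := permutations (iota 0 6).

(** These are the six synthemes sharing a duad with 01|23|45. Two synthemes share a duad when they
    are disjoint edges on the totals, so these are the edges on the four totals off 01|23|45. *)
Definition synthemesK4 : seq (seq (nat * nat)) :=
  [:: [:: (0, 1); (2, 4); (3, 5)]; [:: (0, 1); (2, 5); (3, 4)];
      [:: (0, 2); (1, 3); (4, 5)]; [:: (0, 3); (1, 2); (4, 5)];
      [:: (0, 4); (1, 5); (2, 3)]; [:: (0, 5); (1, 4); (2, 3)]]%N.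

(** These are the six bijections between {0,1,2} and {3,4,5}; the even and the odd ones form the two
    triangles. *)
Definition synthemes2K3 : seq (seq (nat * nat)) :=
  [:: [:: (0, 3); (1, 4); (2, 5)]; [:: (0, 3); (1, 5); (2, 4)];
      [:: (0, 4); (1, 3); (2, 5)]; [:: (0, 4); (1, 5); (2, 3)];
      [:: (0, 5); (1, 3); (2, 4)]; [:: (0, 5); (1, 4); (2, 3)]]%N.

Definition triangle : seq (seq (nat * nat)) :=
  [:: [:: (0, 3); (1, 4); (2, 5)]; [:: (0, 4); (1, 5); (2, 3)];
      [:: (0, 5); (1, 3); (2, 4)]]%N.

(* Three synthemes whose brackets sum to 0 by [cross_jacobi_triangle], so that
   exactly two of them cannot be concurrent; encoded by indices in [synthemes]. *)
Definition triangles : seq (seq nat) :=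
  undup [seq sort leq [seq index (relabels l s) synthemes | s <- triangle] | l <- hexads].

(** The lists are decreasing. Discarding a list as soon as some triangle with all indices below [n]
    is met in exactly two members keeps the enumeration far below all 2^15 subsets. *)
Fixpoint closed_sets (ts : seq (seq nat)) (n : nat) : seq (seq nat) :=
  if n is n'.+1 then
    let Ks := closed_sets ts n' in
    [seq K <- Ks ++ [seq n' :: K | K <- Ks] |
      all (fun t => all (fun i => i < n)%N t ==> (count (mem K) t != 2%N)) ts]
  else [:: [::]].

Lemma mem_closed_sets ts (c : pred nat) n :
  {in ts, forall t, count c t != 2%N} ->
  [seq i <- rev (iota 0 n) | c i] \in closed_sets ts n.
Proof.
move=> tsP; elim: n => // n IHn; rewrite [closed_sets _ _]/=.
have -> : rev (iota 0 n.+1) = n :: rev (iota 0 n) by rewrite -addn1 iotaD rev_cat.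
rewrite /=.
rewrite mem_filter; apply/andP; split; last first.
  by rewrite mem_cat; case: ifP => _; [rewrite map_f ?orbT | rewrite IHn].
apply/allP => t tT; apply/implyP => /allP tn.
rewrite (@eq_in_count _ _ c) ?tsP // => i /tn li.
have -> : (if c n then n :: [seq i <- rev (iota 0 n) | c i]
           else [seq i <- rev (iota 0 n) | c i]) = [seq i <- rev (iota 0 n.+1) | c i].
  by rewrite -addn1 iotaD rev_cat.
rewrite [LHS]mem_filter mem_rev mem_iota leq0n add0n.
by rewrite li /= andbT.
Qed.

Definition images (K : seq (seq (nat * nat))) : seq (seq nat) :=
  [seq sort geq [seq index (relabels l s) synthemes | s <- K] | l <- hexads].

Definition covered (I J Ks : seq (seq nat)) :=
  all (fun K => (size K == 6%N) ==> (K \in I) || (K \in J)) Ks.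

Lemma coveredP I J Ks K : covered (undup I) (undup J) Ks -> K \in Ks ->
  size K = 6%N -> (K \in I) || (K \in J).
Proof.
by rewrite /covered => /allP h /h; rewrite !mem_undup => /implyP h6 /eqP /h6.
Qed.

(** Removing repetitions before the computation leaves 15 sets of the first kind, one for each
    choice of the syntheme playing the role of 01|23|45, and 10 of the second kind, one for each
    splitting of the indices into two triples. *)
Lemma closed_sets_images K : K \in closed_sets triangles 15 -> size K = 6%N ->
  (K \in images synthemesK4) || (K \in images synthemes2K3).
Proof.
have : covered (undup (images synthemesK4)) (undup (images synthemes2K3))
  (closed_sets triangles 15) by vm_compute.
exact: coveredP.
Qed.

Lemma relabels_syntheme l s : l \in hexads -> s \in synthemes ->
  relabels l s \in synthemes.
Proof.
have /allP h : let syn := synthemes in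
  all (fun l => all (fun s => relabels l s \in syn) syn) hexads by vm_compute.
by move=> /h/allP; apply.
Qed.

Lemma relabels_K4_complement l : l \in hexads ->
  relabels l [:: (0, 1); (2, 3); (4, 5)]%N \notin [seq relabels l s | s <- synthemesK4].
Proof.
have /allP h : all (fun l => relabels l [:: (0, 1); (2, 3); (4, 5)]%N
  \notin [seq relabels l s | s <- synthemesK4]) hexads by vm_compute.
exact: h.
Qed.

Lemma hexadsP l : l \in hexads ->
  [/\ size l = 6%N, uniq l & forall i, (i < 6)%N -> (nth 0%N l i < 6)%N].
Proof.
rewrite mem_permutations => pl; have sl := perm_size pl; rewrite size_iota in sl.
split=> //; first by rewrite (perm_uniq pl) iota_uniq.
move=> i li; have : nth 0%N l i \in l by rewrite mem_nth ?sl.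
by rewrite (perm_mem pl) mem_iota.
Qed.

End Relabelling.

(** * Six concurrent synthemes form one of two patterns *)

Section Classification.
Variable F : fieldType.
Implicit Types (p q : nat -> 'rV[F]_3) (u v w x : 'rV[F]_3).

(** With a1, a2, a3 the points 0, 1, 2 and b1, b2, b3 the points 3, 4, 5, the three terms are the
    brackets of the members of [triangle]. If two of them vanish, so does the third. *)
Lemma cross_jacobi_triangle (a1 a2 a3 b1 b2 b3 : 'rV[F]_3) :
  br (cross a1 b1) (cross a2 b2) (cross a3 b3) +
  br (cross a1 b2) (cross a2 b3) (cross a3 b1) +
  br (cross a1 b3) (cross a2 b1) (cross a3 b2) = 0.
Proof. by rewrite !brE /cross !vec3E; ring. Qed.

Lemma br_eq0_perm u v w :
  ((br u w v == 0) = (br u v w == 0)) * ((br v u w == 0) = (br u v w == 0)) *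
  ((br v w u == 0) = (br u v w == 0)) * ((br w u v == 0) = (br u v w == 0)) *
  ((br w v u == 0) = (br u v w == 0)).
Proof.
do !split; first 1 [by rewrite br_swapr oppr_eq0].
- by rewrite br_swapl oppr_eq0.
- by rewrite -br_rotl.
- by rewrite br_rotl.
- by rewrite br_swapl -br_rotl oppr_eq0.
Qed.

Definition conc3 p d e f := br (join p d) (join p e) (join p f) == 0.

Lemma conc_sort p d e f : conc p (sort_duads [:: d; e; f]) = conc3 p d e f.
Proof.
rewrite /conc /conc3 /=; repeat (case: ifP => _ /=).
all: by rewrite ?(br_eq0_perm (join p d) (join p e) (join p f)).
Qed.

Definition compose_seq p (l : seq nat) i := p (nth 0%N l i).

Lemma conc_relabels p l d e f :
  conc p (relabels l [:: d; e; f]) = conc (compose_seq p l) [:: d; e; f].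
Proof.
rewrite conc_sort /conc /conc3 /=.
have E g : exists2 k : F, k != 0 & join p (relabel l g) = k *: join (compose_seq p l) g.
  rewrite /relabel /sort_duad; case: ifP => _.
    by exists 1; rewrite ?oner_eq0 // scale1r.
  by exists (-1); rewrite ?oppr_eq0 ?oner_eq0 // scaleN1r /join /= crossC.
have [a a0 ->] := E d; have [b b0 ->] := E e; have [c c0 ->] := E f.
by rewrite brZ mulf_eq0 !mulf_eq0 (negPf a0) (negPf b0) (negPf c0).
Qed.

Lemma conc_triangle p : count (conc p) triangle != 2%N.
Proof.
have key (x y z : F) : x + y + z = 0 ->
    ((x == 0%R) + ((y == 0%R) + ((z == 0%R) + 0)))%N != 2%N.
  case: (eqVneq x 0) => [->|x0]; case: (eqVneq y 0) => [->|y0];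
    case: (eqVneq z 0) => [->|z0] //; rewrite ?add0r ?addr0 => e.
  - by rewrite e eqxx in z0.
  - by rewrite e eqxx in y0.
  - by rewrite e eqxx in x0.
exact/key/cross_jacobi_triangle.
Qed.

Lemma gen_compose p l : gen p -> l \in hexads -> gen (compose_seq p l).
Proof.
move=> gp /hexadsP[sl ul hl] i j k ij jk lk; rewrite /compose_seq.
have lj := ltn_trans jk lk; have li := ltn_trans ij lj.
apply: (gen_uniq gp); rewrite ?hl //= !inE negb_or !nth_uniq ?sl //.
by rewrite (ltn_eqF ij) (ltn_eqF jk) (ltn_eqF (ltn_trans ij jk)).
Qed.

Lemma classification p : size (concurrent p) = 6%N -> exists2 l, l \in hexads &
  ((forall s, s \in synthemesK4 -> conc (compose_seq p l) s) /\
   ~~ conc (compose_seq p l) [:: (0, 1); (2, 3); (4, 5)]%N) \/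
  (forall s, s \in synthemes2K3 -> conc (compose_seq p l) s).
Proof.
move=> s6; pose c i := conc p (nth [::] synthemes i).
have size3 l s : s \in synthemes -> conc p (relabels l s) = conc (compose_seq p l) s.
  rewrite mem_filter => /andP[+ _]; case: s => [|d [|e [|f []]]] // _.
  exact: conc_relabels.
have triangleS : {subset triangle <= synthemes} by apply/allP; vm_compute.
have cE l s : l \in hexads -> s \in synthemes ->
    c (index (relabels l s) synthemes) = conc (compose_seq p l) s.
  by move=> lH sS; rewrite /c nth_index ?relabels_syntheme ?size3.
have cT : {in triangles, forall t, count c t != 2%N}.
  move=> t; rewrite mem_undup => /mapP[l lH ->]; rewrite count_sort count_map.
  rewrite (@eq_in_count _ _ (conc (compose_seq p l))) ?conc_triangle //.
  by move=> s sT; exact: (cE _ _ lH (triangleS _ sT)).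
have size_syn : size synthemes = 15%N by vm_compute.
set K := [seq i <- rev (iota 0 15) | c i].
have SE : size K = 6%N.
  rewrite -s6 /concurrent -(mkseq_nth [::] synthemes) /mkseq size_syn.
  by rewrite /K filter_rev size_rev filter_map size_map.
have mapS SS l : {subset SS <= synthemes} -> l \in hexads ->
    K = sort geq [seq index (relabels l s) synthemes | s <- SS] ->
    forall s, s \in SS -> conc (compose_seq p l) s.
  move=> sub lH e s sS; rewrite -(cE _ _ lH (sub _ sS)).
  have : index (relabels l s) synthemes \in K.
    by rewrite e mem_sort; apply: (map_f (fun s => index (relabels l s) synthemes)).
  by rewrite mem_filter => /andP[].
case/orP: (closed_sets_images (mem_closed_sets 15 cT) SE) => /mapP[l lH e]; exists l;
  do ?[exact: lH]; rewrite -/K in e; [left|right]; last first.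
  by apply: (mapS _ _ _ lH e); apply/allP; vm_compute.
split; first by apply: (mapS _ _ _ lH e); apply/allP; vm_compute.
(* [K] lists all concurrent synthemes, and it consists of the relabelled six; by
   [relabels_K4_complement] the relabelling of this syntheme is not one of them. *)
set s0 : seq (nat * nat) := [:: _; _; _].
have s0S : s0 \in synthemes by vm_compute.
have rS := relabels_syntheme lH s0S.
apply/negP; rewrite -(cE _ _ lH s0S) => cs; have := relabels_K4_complement lH.
suff -> : relabels l s0 \in [seq relabels l s | s <- synthemesK4] by [].
have : index (relabels l s0) synthemes \in K.
  by rewrite mem_filter cs mem_rev mem_iota leq0n add0n -size_syn index_mem.
rewrite e mem_sort => /mapP[s sS /(congr1 (nth [::] synthemes))].
have sS' : s \in synthemes by move: s sS {e}; apply/allP; vm_compute.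
rewrite (nth_index _ rS) (nth_index _ (relabels_syntheme lH sS')) => ->.
exact: (map_f (relabels l)).
Qed.

End Classification.

(** * Projective changes of coordinates *)

Section ProjectiveChange.
Variable F : fieldType.
Implicit Types (p q : nat -> 'rV[F]_3) (u v w x : 'rV[F]_3) (H K : 'M[F]_3).

Definition peq p q H := \det H != 0 /\
  forall i, (i < 6)%N -> exists2 c, c != 0 & q i = c *: (p i *m H).

Lemma peq_trans p q r H K : peq p q H -> peq q r K -> peq p r (H *m K).
Proof.
move=> [dH pq] [dK qr]; split; first by rewrite det_mulmx mulf_neq0.
move=> i li; have [c c0 qE] := pq i li; have [d d0 ->] := qr i li.
exists (d * c); first by rewrite mulf_neq0.
by rewrite qE -scalemxAl scalerA mulmxA.
Qed.

Lemma peq_mulmx p H : \det H != 0 -> peq p (fun i => p i *m H) H.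
Proof. by split=> // i _; exists 1; rewrite ?oner_eq0 // scale1r. Qed.

Lemma peq_inv p q H : peq p q H -> peq q p (invmx H).
Proof.
move=> [dH pq]; have uH : H \in unitmx by rewrite unitmxE unitfE.
split; first by rewrite det_inv invr_eq0.
move=> i li; have [c c0 ->] := pq i li; exists c^-1; first by rewrite invr_eq0.
by rewrite -scalemxAl scalerA mulVf // scale1r mulmxK.
Qed.

Lemma br_peq p q H i j k : peq p q H -> (i < 6)%N -> (j < 6)%N -> (k < 6)%N ->
  (br (q i) (q j) (q k) == 0) = (br (p i) (p j) (p k) == 0).
Proof.
move=> [dH pq] li lj lk.
have [a a0 ->] := pq i li; have [b b0 ->] := pq j lj; have [c c0 ->] := pq k lk.
rewrite brZ br_mulmx !mulf_eq0 (negPf a0) (negPf b0) (negPf c0) (negPf dH).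
by rewrite /= orbF.
Qed.

Lemma gen_peq p q H : peq p q H -> gen p -> gen q.
Proof.
move=> pq gp i j k ij jk lk; have lj := ltn_trans jk lk; have li := ltn_trans ij lj.
by rewrite (br_peq pq) //; apply: gp.
Qed.

(** This turns concurrency of joins into a polynomial in brackets of points. Each product contains
    every point once, so under a projective change both products acquire the same factor. *)
Lemma br_cross3 a b c d e f : br (cross a b) (cross c d) (cross e f) =
  br a b e * br c d f - br a b f * br c d e :> F.
Proof. by rewrite !brE /cross !vec3E; ring. Qed.

Lemma conc3_peq p q H d e f : peq p q H ->
  all (fun g : nat * nat => (g.1 < 6)%N && (g.2 < 6)%N) [:: d; e; f] ->
  conc q [:: d; e; f] = conc p [:: d; e; f].
Proof.
move=> [dH pq] /= /and4P[/andP[l1 l2] /andP[l3 l4] /andP[l5 l6] _].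
rewrite /conc /join /= !br_cross3.
have [c1 n1 ->] := pq _ l1; have [c2 n2 ->] := pq _ l2; have [c3 n3 ->] := pq _ l3.
have [c4 n4 ->] := pq _ l4; have [c5 n5 ->] := pq _ l5; have [c6 n6 ->] := pq _ l6.
rewrite !brZ !br_mulmx.
rewrite [X in (X == 0) = _](_ : _ = c1 * c2 * c3 * c4 * c5 * c6 * \det H * \det H *
  (br (p d.1) (p d.2) (p f.1) * br (p e.1) (p e.2) (p f.2) -
   br (p d.1) (p d.2) (p f.2) * br (p e.1) (p e.2) (p f.1))); last by ring.
rewrite !mulf_eq0 (negPf n1) (negPf n2) (negPf n3) (negPf n4) (negPf n5) (negPf n6).
by rewrite (negPf dH).
Qed.

Lemma conc_peq p q H s : peq p q H -> s \in synthemes -> conc q s = conc p s.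
Proof.
move=> pq; rewrite mem_filter => /andP[/eqP s3 /matching_sub].
case: s s3 => [|d [|e [|f []]]] // _ sub; apply: conc3_peq pq _.
apply/allP => g /sub; rewrite duadsP => /andP[g1 g2].
by rewrite g2 (ltn_trans g1 g2).
Qed.

Lemma concurrent_peq p q H : peq p q H -> concurrent q = concurrent p.
Proof. by move=> pq; apply: eq_in_filter => s; exact: conc_peq pq. Qed.

Lemma crossings_peq p q H : peq p q H -> crossings q = crossings p.
Proof. by move=> pq; rewrite /crossings (concurrent_peq pq). Qed.

Definition moved p H i := p i *m H.

Lemma arr_peq p q H : (forall i, (i < 6)%N -> q i != 0) -> peq p q H ->
  arr q = arr (moved p H).
Proof.
move=> q0 [_ pq]; apply: eq_imagel => i li; have qi := q0 i li.
have [c c0 qE] := pq i li; have m0 : moved p H i != 0.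
  by apply: contraNneq qi => e; rewrite qE -/(moved p H i) e scaler0.
by apply/ln_eq => //; apply/pt_eq => //; exists c.
Qed.

End ProjectiveChange.

(** * Normal forms for the two patterns *)

Section NormalForms.
Variable F : numClosedFieldType.
Implicit Types (p q : nat -> 'rV[F]_3) (t : F) (u v w x : 'rV[F]_3) (H K : 'M[F]_3).

(** The pairs 01, 23 and 45 lie on the three sides of the coordinate triangle. *)
Definition NK4 t i : 'rV[F]_3 :=
  match i with
  | 0 => vec3 0 1 1 | 1 => vec3 0 1 (-1)
  | 2 => vec3 1 0 1 | 3 => vec3 (-1) 0 1
  | 4 => vec3 1 t 0 | _ => vec3 1 (- t) 0
  end.

(** For [z] a primitive cube root of unity, the points 3, 4, 5 form the orbit of (1,1,1) under the
    diagonal matrix with entries 1, z, z^2. *)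
Definition N2K3 (z : F) i : 'rV[F]_3 :=
  match i with
  | 0 => vec3 1 0 0 | 1 => vec3 0 1 0 | 2 => vec3 0 0 1
  | 3 => vec3 1 1 1 | 4 => vec3 1 z (z ^+ 2) | _ => vec3 1 (z ^+ 2) z
  end.

Lemma mulmx_diag3 a b c d e f : vec3 a b c *m mx3 (vec3 d 0 0) (vec3 0 e 0) (vec3 0 0 f) =
  vec3 (a * d) (b * e) (c * f) :> 'rV[F]_3.
Proof. by rewrite mulmx_mx3; apply: row3P; rewrite !mxE /=; ring. Qed.

Lemma det_diag3 d e f : \det (mx3 (vec3 d 0 0) (vec3 0 e 0) (vec3 0 0 f)) = d * e * f :> F.
Proof. by rewrite det_mx3 brE !vec3E; ring. Qed.

Lemma ord6P (P : nat -> Prop) : P 0%N -> P 1%N -> P 2%N -> P 3%N -> P 4%N -> P 5%N ->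
  forall i, (i < 6)%N -> P i.
Proof. by move=> ? ? ? ? ? ? [|[|[|[|[|[|i]]]]]]. Qed.

Lemma scale_vec3 k a b c : k *: vec3 a b c = vec3 (k * a) (k * b) (k * c) :> 'rV[F]_3.
Proof. by apply: row3P; rewrite !mxE. Qed.

Lemma triangle_coordinates_K4 (c : nat -> 'rV[F]_3)
    (y0 z0 y1 z1 x2 z2 x3 z3 x4 y4 x5 y5 : F) :
  c 0%N = vec3 0 y0 z0 -> c 1%N = vec3 0 y1 z1 -> c 2%N = vec3 x2 0 z2 ->
  c 3%N = vec3 x3 0 z3 -> c 4%N = vec3 x4 y4 0 -> c 5%N = vec3 x5 y5 0 ->
  all (fun a => a != 0) [:: y0; z0; y1; z1; x2; z2; x3; z3; x4; y4; x5; y5] ->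
  gen c -> (forall s, s \in synthemesK4 -> conc c s) ->
  exists t H, peq (NK4 t) c H.
Proof.
move=> c0 c1 c2 c3 c4 c5 /and5P[y0n z0n y1n z1n /and5P[x2n z2n x3n z3n]].
move=> /and5P[x4n y4n x5n y5n _] gc cc.
have E1 : (y0 * z1 - z0 * y1) * (z2 * x4 * x3 * y5 - x2 * y4 * z3 * x5) = 0.
  have := cc [:: (0, 1); (2, 4); (3, 5)]%N isT.
  by rewrite /conc /join /= c0 c1 c2 c3 c4 c5 brE /cross !vec3E => /eqP <-; ring.
have E2 : (y0 * z1 - z0 * y1) * (z2 * x5 * x3 * y4 - x2 * y5 * z3 * x4) = 0.
  have := cc [:: (0, 1); (2, 5); (3, 4)]%N isT.
  by rewrite /conc /join /= c0 c1 c2 c3 c4 c5 brE /cross !vec3E => /eqP <-; ring.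
have E3 : (x2 * z3 - z2 * x3) * (z0 * y4 * y1 * x5 - y0 * x4 * z1 * y5) = 0.
  have := cc [:: (0, 4); (1, 5); (2, 3)]%N isT.
  by rewrite /conc /join /= c0 c1 c2 c3 c4 c5 brE /cross !vec3E => /eqP <-; ring.
have n1 : y0 * z1 - z0 * y1 != 0.
  apply: contraNneq (gc 0%N 1%N 2%N isT isT isT) => e.
  rewrite c0 c1 c2 brE !vec3E; apply/eqP.
  by transitivity (x2 * (y0 * z1 - z0 * y1)); [ring|rewrite e mulr0].
have n2 : x2 * z3 - z2 * x3 != 0.
  apply: contraNneq (gc 0%N 2%N 3%N isT isT isT) => e.
  rewrite c0 c2 c3 brE !vec3E; apply/eqP.
  by transitivity (- y0 * (x2 * z3 - z2 * x3)); [ring|rewrite e mulr0].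
have n3 : x4 * y5 - x5 * y4 != 0.
  apply: contraNneq (gc 0%N 4%N 5%N isT isT isT) => e.
  rewrite c0 c4 c5 brE !vec3E; apply/eqP.
  by transitivity (z0 * (x4 * y5 - x5 * y4)); [ring|rewrite e mulr0].
move/eqP: E1; rewrite mulf_eq0 (negPf n1) /= => /eqP {}E1.
move/eqP: E2; rewrite mulf_eq0 (negPf n1) /= => /eqP {}E2.
move/eqP: E3; rewrite mulf_eq0 (negPf n2) /= => /eqP {}E3.
(* b2 c4 = b3 c5 and b2 c5 = b3 c4 in the affine coordinates a = z/y, b = x/z
   and c = y/x on the three lines *)
have y5E : y5 = - (y4 / x4) * x5.
  (* Eliminating b2 and b3 gives c4^2 = c5^2, and c4 = c5 would make the points 4 and 5 coincide. *)
  have : (x4 * y5 - x5 * y4) * (x4 * y5 + x5 * y4) * (z2 * x3) = 0.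
    transitivity (x4 * y5 * (z2 * x4 * x3 * y5 - x2 * y4 * z3 * x5)
      - x5 * y4 * (z2 * x5 * x3 * y4 - x2 * y5 * z3 * x4)); first by ring.
    by rewrite E1 E2 !mulr0 subrr.
  move/eqP; rewrite !mulf_eq0 (negPf n3) (negPf z2n) (negPf x3n) !orbF /= => /eqP e.
  by apply: (mulfI x4n); rewrite -[RHS]addr0 -e; field.
have x3E : x3 = - (x2 / z2) * z3.
  apply: (mulIf (mulf_neq0 (mulf_neq0 z2n x4n) y5n)).
  apply/eqP; rewrite -subr_eq0; apply/eqP.
  by rewrite -[RHS]E1 y5E; field; rewrite ?x4n ?z2n.
have z1E : z1 = - (z0 / y0) * y1.
  apply: (mulIf (mulf_neq0 (mulf_neq0 y0n x4n) y5n)).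
  apply/eqP; rewrite -subr_eq0 -oppr_eq0; apply/eqP.
  by rewrite -[RHS]E3 y5E; field; rewrite ?x4n ?y0n.
(* These are the affine coordinates of the points 0, 2, 4 on their sides. Diagonal changes can alter
   each of them but preserve their product, which is therefore the parameter of the normal form. *)
pose a := z0 / y0; pose b := x2 / z2; pose cc' := y4 / x4.
have an : a != 0 by rewrite mulf_neq0 ?invr_eq0.
have bn : b != 0 by rewrite mulf_neq0 ?invr_eq0.
exists (a * b * cc'), (mx3 (vec3 (a * b) 0 0) (vec3 0 1 0) (vec3 0 0 a)).
split; first by rewrite det_diag3; exact: mulf_neq0 (mulf_neq0 (mulf_neq0 an bn) (oner_neq0 _)) an.
apply: ord6P; rewrite /= ?c0 ?c1 ?c2 ?c3 ?c4 ?c5.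
- exists y0 => //; rewrite mulmx_diag3 scale_vec3 /a; congr vec3; field => //.
- exists y1 => //; rewrite mulmx_diag3 scale_vec3 z1E /a; congr vec3; field => //.
- exists (z2 / a); first exact: mulf_neq0 z2n (invr_neq0 an).
  rewrite mulmx_diag3 scale_vec3 /b; congr vec3; field; rewrite ?an ?z2n //.
- exists (z3 / a); first exact: mulf_neq0 z3n (invr_neq0 an).
  rewrite mulmx_diag3 scale_vec3 x3E /b; congr vec3; field; rewrite ?an ?z2n //.
- exists (x4 / (a * b)); first exact: mulf_neq0 x4n (invr_neq0 (mulf_neq0 an bn)).
  rewrite mulmx_diag3 scale_vec3 /cc'; congr vec3; field; rewrite ?an ?bn ?x4n //.
- exists (x5 / (a * b)); first exact: mulf_neq0 x5n (invr_neq0 (mulf_neq0 an bn)).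
  rewrite mulmx_diag3 scale_vec3 y5E /cc'; congr vec3; field; rewrite ?an ?bn ?x4n //.
Qed.

(** Since 01|23|45 is not concurrent, its three joins can be taken as the sides of the coordinate
    triangle: the new coordinates of a point are its brackets with the three pairs. *)
Lemma normal_form_K4 q : gen q -> (forall s, s \in synthemesK4 -> conc q s) ->
  ~~ conc q [:: (0, 1); (2, 3); (4, 5)]%N -> exists t H, peq (NK4 t) q H.
Proof.
move=> gq qc q0; pose K := (mx3 (join q (0, 1)%N) (join q (2, 3)%N) (join q (4, 5)%N))^T.
have dK : \det K != 0 by rewrite det_tr det_mx3.
pose c := moved q K.
have qc' : peq q c K by exact: peq_mulmx.
have cE i : c i = vec3 (br (q i) (q 0%N) (q 1%N)) (br (q i) (q 2%N) (q 3%N))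
    (br (q i) (q 4%N) (q 5%N)) by rewrite /c /moved mulmx_mx3T.
have nz i j k : (i < 6)%N -> (j < 6)%N -> (k < 6)%N -> uniq [:: i; j; k] ->
  br (q i) (q j) (q k) != 0 by exact: gen_uniq.
have [t [H NH]] : exists t H, peq (NK4 t) c H.
  have := cE 0%N; have := cE 1%N; have := cE 2%N; have := cE 3%N; have := cE 4%N.
  have := cE 5%N; rewrite ?br_same1 ?br_same2 => c5 c4 c3 c2 c1 c0.
  apply: triangle_coordinates_K4 c0 c1 c2 c3 c4 c5 _ _ _.
  - by rewrite /= !nz //.
  - exact: gen_peq qc' gq.
  - move=> s sS; rewrite (conc_peq qc') ?qc //.
    by move: s sS; apply/allP; vm_compute.
by exists t, (H *m invmx K); apply: peq_trans NH (peq_inv qc').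
Qed.

Lemma normal_form_2K3 q : gen q -> (forall s, s \in synthemes2K3 -> conc q s) ->
  exists z H, z ^+ 2 + z + 1 = 0 /\ peq (N2K3 z) q H.
Proof.
move=> gq qc; pose B := mx3 (q 0%N) (q 1%N) (q 2%N).
have dB : \det B != 0 by rewrite det_mx3; apply: gq.
have uB : B \in unitmx by rewrite unitmxE unitfE.
pose c := moved q (invmx B); have dB' : \det (invmx B) != 0 by rewrite det_inv invr_eq0.
have qc' : peq q c (invmx B) by exact: peq_mulmx.
have rowB i (e : 'rV[F]_3) : e *m B = q i -> c i = e.
  by move=> h; rewrite /c /moved -h mulmxK.
have c0 : c 0%N = vec3 1 0 0.
  by apply: rowB; rewrite mulmx_mx3 !vec3E scale1r !scale0r !addr0.
have c1 : c 1%N = vec3 0 1 0.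
  by apply: rowB; rewrite mulmx_mx3 !vec3E scale1r !scale0r addr0 add0r.
have c2 : c 2%N = vec3 0 0 1.
  by apply: rowB; rewrite mulmx_mx3 !vec3E scale1r !scale0r !add0r.
have gc := gen_peq qc' gq.
have cc s : s \in synthemes2K3 -> conc c s.
  move=> sS; rewrite (conc_peq qc') ?qc //.
  by move: s sS; apply/allP; vm_compute.
have nz i : (2 < i)%N -> (i < 6)%N -> [/\ c i 0 o0 != 0, c i 0 o1 != 0 & c i 0 o2 != 0].
  move=> i2 li; split.
  - have := gc 1%N 2%N i isT i2 li; rewrite c1 c2 brE !vec3E.
    by apply: contraNneq => ->; apply/eqP; ring.
  - have := gc 0%N 2%N i isT i2 li; rewrite c0 c2 brE !vec3E.
    by apply: contraNneq => ->; apply/eqP; ring.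
  - have := gc 0%N 1%N i isT (ltnW i2) li; rewrite c0 c1 brE !vec3E.
    by apply: contraNneq => ->; apply/eqP; ring.
move: (nz 3%N isT isT) (nz 4%N isT isT) (nz 5%N isT isT).
have := vec3_eta (c 3%N); have := vec3_eta (c 4%N); have := vec3_eta (c 5%N).
move: (c 3%N 0 o0) (c 3%N 0 o1) (c 3%N 0 o2) => x3 y3 z3.
move: (c 4%N 0 o0) (c 4%N 0 o1) (c 4%N 0 o2) => x4 y4 z4.
move: (c 5%N 0 o0) (c 5%N 0 o1) (c 5%N 0 o2) => x5 y5 z5.
move=> /esym c5 /esym c4 /esym c3 [x3n y3n z3n] [x4n y4n z4n] [x5n y5n z5n].
have E1 : z3 * x4 * y5 - y3 * z4 * x5 = 0.
  have := cc [:: (0, 3); (1, 4); (2, 5)]%N isT.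
  rewrite /conc /join /= c0 c1 c2 c3 c4 c5 brE /cross !vec3E => /eqP e.
  by apply: oppr_inj; rewrite oppr0 -[RHS]e; ring.
have E2 : z4 * x5 * y3 - y4 * z5 * x3 = 0.
  have := cc [:: (0, 4); (1, 5); (2, 3)]%N isT.
  rewrite /conc /join /= c0 c1 c2 c3 c4 c5 brE /cross !vec3E => /eqP e.
  by apply: oppr_inj; rewrite oppr0 -[RHS]e; ring.
have E3 : z3 * x5 * y4 - y3 * z5 * x4 = 0.
  have := cc [:: (0, 3); (1, 5); (2, 4)]%N isT.
  rewrite /conc /join /= c0 c1 c2 c3 c4 c5 brE /cross !vec3E => /eqP e.
  by apply: oppr_inj; rewrite oppr0 -[RHS]e; ring.
have E4 : z4 * x3 * y5 - y4 * z3 * x5 = 0.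
  have := cc [:: (0, 4); (1, 3); (2, 5)]%N isT.
  rewrite /conc /join /= c0 c1 c2 c3 c4 c5 brE /cross !vec3E => /eqP e.
  by apply: oppr_inj; rewrite oppr0 -[RHS]e; ring.
(* Scaling the point 3 to (1,1,1) turns the points 4 and 5 into (1, p4, r4) and (1, p5, r5). *)
pose p4 := (y4 * x3) / (x4 * y3); pose r4 := (z4 * x3) / (x4 * z3).
pose p5 := (y5 * x3) / (x5 * y3); pose r5 := (z5 * x3) / (x5 * z3).
have F1 : p5 = r4.
  apply/eqP; rewrite -subr_eq0.
  have -> : p5 - r4 = x3 * (z3 * x4 * y5 - y3 * z4 * x5) / (x4 * x5 * y3 * z3).
    by rewrite /p4 /p5 /r4 /r5; field; rewrite ?x4n ?x5n ?y3n ?z3n.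
  by rewrite E1 mulr0 mul0r.
have F2 : r4 = p4 * r5.
  apply/eqP; rewrite -subr_eq0.
  have -> : r4 - p4 * r5 = x3 * (z4 * x5 * y3 - y4 * z5 * x3) / (x4 * x5 * y3 * z3).
    by rewrite /p4 /p5 /r4 /r5; field; rewrite ?x4n ?x5n ?y3n ?z3n.
  by rewrite E2 mulr0 mul0r.
have F3 : p4 = r5.
  apply/eqP; rewrite -subr_eq0.
  have -> : p4 - r5 = x3 * (z3 * x5 * y4 - y3 * z5 * x4) / (x4 * x5 * y3 * z3).
    by rewrite /p4 /p5 /r4 /r5; field; rewrite ?x4n ?x5n ?y3n ?z3n.
  by rewrite E3 mulr0 mul0r.
have F4 : r4 * p5 = p4.
  apply/eqP; rewrite -subr_eq0.
  have -> : r4 * p5 - p4 = x3 * (z4 * x3 * y5 - y4 * z3 * x5) / (x4 * x5 * y3 * z3).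
    by rewrite /p4 /p5 /r4 /r5; field; rewrite ?x4n ?x5n ?y3n ?z3n.
  by rewrite E4 mulr0 mul0r.
have p4n : p4 != 0 := mulf_neq0 (mulf_neq0 y4n x3n) (invr_neq0 (mulf_neq0 x4n y3n)).
have r4E : r4 = p4 ^+ 2 by rewrite F2 -F3 expr2.
have r5E : r5 = p4 by rewrite F3.
have p5E : p5 = p4 ^+ 2 by rewrite F1.
(* If p4 were 1, then r4 would be 1 as well and the points 3 and 4 would coincide. *)
have p41 : p4 - 1 != 0.
  apply: contraNneq (gc 3%N 4%N 5%N isT isT isT) => e1.
  have {}e1 : p4 = 1 by apply/eqP; rewrite -subr_eq0 e1.
  have e2 : y4 * x3 = x4 * y3.
    by move: e1; rewrite /p4 => /divr1_eq ->.
  have e3 : z4 * x3 = x4 * z3.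
    by move: r4E; rewrite e1 expr1n /r4 => /divr1_eq ->.
  apply/eqP; apply: (mulIf x3n); rewrite c3 c4 c5 brE !vec3E mul0r.
  transitivity (x3 * (y4 * x3 * z5 - z4 * x3 * y5) + y3 * (z4 * x3 * x5 - x4 * x3 * z5)
    + z3 * (x4 * x3 * y5 - y4 * x3 * x5)); first by ring.
  by rewrite e2 e3; ring.
exists p4, (mx3 (vec3 x3 0 0) (vec3 0 y3 0) (vec3 0 0 z3) *m B); split.
  apply: (mulfI p41); rewrite mulr0.
  have p43 : p4 ^+ 3 = 1.
    apply: (mulfI p4n); rewrite mulr1; transitivity (r4 * p5); last exact: F4.
    by rewrite r4E p5E -exprS -exprD.
  by transitivity (p4 ^+ 3 - 1); [ring|rewrite p43 subrr].
apply: peq_trans (_ : peq _ c _) _; last first.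
  by have := peq_inv qc'; rewrite invmxK.
split; first by rewrite det_diag3 !mulf_neq0.
apply: ord6P; rewrite /= ?c0 ?c1 ?c2 ?c3 ?c4 ?c5.
- exists x3^-1; first by rewrite invr_eq0.
  by rewrite mulmx_diag3 scale_vec3; congr vec3; field.
- exists y3^-1; first by rewrite invr_eq0.
  by rewrite mulmx_diag3 scale_vec3; congr vec3; field.
- exists z3^-1; first by rewrite invr_eq0.
  by rewrite mulmx_diag3 scale_vec3; congr vec3; field.
- exists 1; first by rewrite oner_eq0.
  by rewrite mulmx_diag3 scale_vec3; congr vec3; ring.
- exists (x4 / x3); first by rewrite mulf_neq0 ?invr_eq0.
  rewrite mulmx_diag3 scale_vec3 -r4E /p4 /r4; congr vec3; field; rewrite ?x3n ?x4n ?y3n ?z3n //.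
- exists (x5 / x3); first by rewrite mulf_neq0 ?invr_eq0.
  rewrite mulmx_diag3 scale_vec3 -p5E -r5E /p5 /r5.
  by congr vec3; field; rewrite ?x3n ?x5n ?y3n ?z3n //.
Qed.

End NormalForms.

(** * Quadratic forms and conics through six points *)

Section Conics.
Variable F : numClosedFieldType.
Implicit Types (p q : nat -> 'rV[F]_3) (u v w x : 'rV[F]_3) (H K C : 'M[F]_3).

Definition quad C v : F := dot (v *m C) v.

Definition qpoly C : {mpoly F[3]} := \sum_i \sum_j C i j *: ('X_i * 'X_j).

Lemma quadE C v : quad C v = \sum_i \sum_j C i j * (v 0 i * v 0 j).
Proof. by rewrite /quad /dot !mxE !sum3E; ring. Qed.

Lemma qpoly_eval C v : (qpoly C).@[fun j => v 0 j] = quad C v.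
Proof.
rewrite quadE /qpoly raddf_sum /=; apply: eq_bigr => i _.
rewrite raddf_sum /=; apply: eq_bigr => j _.
by rewrite mevalZ mevalM !mevalXU.
Qed.

Lemma qpolyD C K : qpoly (C + K) = qpoly C + qpoly K.
Proof.
rewrite /qpoly -big_split; apply: eq_bigr => i _.
by rewrite -big_split; apply: eq_bigr => j _; rewrite mxE scalerDl.
Qed.

Lemma qpolyT C : qpoly C^T = qpoly C.
Proof.
rewrite /qpoly exchange_big; apply: eq_bigr => i _; apply: eq_bigr => j _.
by rewrite mxE mulrC.
Qed.

(** Transposing the matrix does not change the form, so twice the form belongs to [C + C^T];
    division by 2 is possible in characteristic zero. *)
Lemma qpoly_antisym C : C + C^T = 0 -> qpoly C = 0.
Proof.
move=> C0; have : qpoly C + qpoly C = 0.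
  rewrite -{2}[qpoly C]qpolyT -qpolyD C0 /qpoly.
  by apply: big1 => i _; apply: big1 => j _; rewrite mxE scale0r.
rewrite -mulr2n -scaler_nat => /eqP; rewrite scaler_eq0 pnatr_eq0 /=.
by move/eqP.
Qed.

Lemma qpoly_homog C : qpoly C \is 2.-homog.
Proof.
rewrite /qpoly; apply: rpred_sum => i _; apply: rpred_sum => j _; apply: dhomogZ.
by rewrite -[2%N]/(1 + 1)%N; apply: dhomogM; rewrite dhomogX /= mdeg1.
Qed.

(** A monomial of degree two is a product of two variables, and its coefficient is put into the
    single corresponding entry; the matrix need not be symmetric. *)
Lemma homog2_qpoly (q : {mpoly F[3]}) : q \is 2.-homog -> exists C, q = qpoly C.
Proof.
move=> /dhomogP hq; rewrite [q]mpolyE big_seq.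
apply: (big_ind (fun r : {mpoly F[3]} => exists C, r = qpoly C)).
- by exists 0; rewrite qpoly_antisym // trmx0 addr0.
- by move=> _ _ [C ->] [K ->]; exists (C + K); rewrite qpolyD.
move=> m /hq /= m2; have [i mi] : exists i, m i != 0%N.
  apply/existsP; apply: contraT => /existsPn h; move: m2; rewrite mdegE big1 //.
  by move=> i _; apply/eqP; have := h i; rewrite negbK.
have mK : (m = (m - U_(i)) + U_(i))%MM by rewrite submK // lep1mP.
have /mdeg1P[j /eqP jE] : mdeg (m - U_(i))%MM == 1%N.
  by move: m2; rewrite {1}mK mdegD mdeg1 addn1 => -[->].
exists (q@_m *: delta_mx j i); rewrite /qpoly (bigD1 j) //= (bigD1 i) //= !mxE !eqxx mulr1.
have -> : 'X_[m] = 'X_j * 'X_i :> {mpoly F[3]} by rewrite mK jE mpolyXD.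
rewrite big1 ?big1 ?addr0 //.
  move=> k kj; apply: big1 => l _.
  by rewrite !mxE (negPf kj) mulr0 scale0r.
by move=> k ki; rewrite !mxE (negPf ki) andbF mulr0 scale0r.
Qed.

Lemma quad_polar C u v : quad C (u + v) - quad C u - quad C v = dot (u *m (C + C^T)) v.
Proof. by rewrite /quad /dot !mxE !sum3E !mxE; ring. Qed.

Lemma quad_eq0 C : (forall v, quad C v = 0) -> C + C^T = 0.
Proof.
move=> C0; apply/row_matrixP => i; rewrite row0 rowE.
apply: dot_nondeg => z; rewrite dotC -quad_polar.
by rewrite !C0 !subr0.
Qed.

Lemma quad_mulmx C H v : quad C (v *m H) = quad (H *m C *m H^T) v.
Proof. by rewrite /quad dotC dot_mulmx dotC !mulmxA. Qed.

Lemma quadZ C c v : quad C (c *: v) = c ^+ 2 * quad C v.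
Proof. by rewrite /quad -scalemxAl dotZl dotZr mulrA expr2. Qed.

Definition six_points p : set (proj F 2) := [set pt (p i) | i in `I_6].

Lemma quad_pt C v : v != 0 -> (quad C (hcoord (pt v)) = 0) <-> (quad C v = 0).
Proof.
move=> v0; have [c c0 ->] := hcoord_pt v0; rewrite quadZ; split=> [/eqP|->].
  by rewrite mulf_eq0 expf_eq0 (negPf c0) => /eqP.
by rewrite mulr0.
Qed.

Lemma quad_peq p q H C i : peq p q H -> (i < 6)%N ->
  (quad C (q i) = 0) <-> (quad (H *m C *m H^T) (p i) = 0).
Proof.
move=> [_ pq] li; have [c c0 ->] := pq i li; rewrite quadZ quad_mulmx.
split=> [/eqP|->]; last by rewrite mulr0.
by rewrite mulf_eq0 expf_eq0 (negPf c0) => /eqP.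
Qed.

Lemma not_on_conic_peq p q H : peq p q H -> (forall i, (i < 6)%N -> q i != 0) ->
  (forall C, (forall i, (i < 6)%N -> quad C (p i) = 0) -> forall v, quad C v = 0) ->
  ~ on_conic (six_points q).
Proof.
move=> pq q0 pC [r [r0 /homog2_qpoly[C rE] rP]]; move/eqP: r0; apply.
rewrite rE; apply/qpoly_antisym/quad_eq0 => v.
have uH : H \in unitmx by rewrite unitmxE unitfE; case: pq.
rewrite -[v](mulmxKV uH) quad_mulmx; apply: pC => i li; apply/(quad_peq _ pq li).
apply/(quad_pt _ (q0 i li)); rewrite -qpoly_eval -rE; apply: rP.
by exists i.
Qed.

Lemma on_conic_peq p q H C : peq p q H -> (forall i, (i < 6)%N -> q i != 0) ->
  (forall i, (i < 6)%N -> quad C (p i) = 0) -> (exists v, quad C v != 0) ->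
  on_conic (six_points q).
Proof.
move=> pq q0 pC [v v0]; have [dK qp] := peq_inv pq.
have uH : H \in unitmx by rewrite unitmxE unitfE; case: pq.
pose D := invmx H *m C *m (invmx H)^T.
have DE : H *m D *m H^T = C.
  by rewrite /D trmx_inv !mulmxA mulmxV // mul1mx mulmxKV // unitmx_tr.
exists (qpoly D); split; last 1 first.
- move=> _ [i li <-]; rewrite qpoly_eval; apply/(quad_pt _ (q0 i li)).
  by apply/(quad_peq _ pq li); rewrite DE; apply: pC.
- apply: contra_neq v0 => D0.
  have := quad_mulmx D H v; rewrite DE => <-; rewrite -qpoly_eval D0.
  exact: meval0.
exact: qpoly_homog.
Qed.

End Conics.

(** * Parameters for which the normal forms are unassuming *)

Section NormalFormProperties.
Variable F : numClosedFieldType.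
Implicit Types (p q : nat -> 'rV[F]_3) (t z : F) (H K C : 'M[F]_3).

(* On NK4 t: t^2 = 1 gives three collinear points, t^2 = -1 puts the six points on
   a conic, and t^2 + 4t = 1 or t^2 - 4t = 1 makes further synthemes concurrent. *)
Definition good t : bool :=
  [&& t != 0, t ^+ 2 - 1 != 0, t ^+ 2 + 1 != 0, t ^+ 2 + 4%:R * t - 1 != 0 &
      t ^+ 2 - 4%:R * t - 1 != 0].

Lemma two_neq0 : (2%:R : F) != 0. Proof. by rewrite pnatr_eq0. Qed.

(** Case analysis over the fifteen synthemes, so that each bracket becomes an explicit
    polynomial. *)
Lemma synthemes_ind (P : seq (nat * nat) -> Prop) :
  P [:: (0, 1); (2, 3); (4, 5)]%N -> P [:: (0, 1); (2, 4); (3, 5)]%N ->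
  P [:: (0, 1); (2, 5); (3, 4)]%N -> P [:: (0, 2); (1, 3); (4, 5)]%N ->
  P [:: (0, 2); (1, 4); (3, 5)]%N -> P [:: (0, 2); (1, 5); (3, 4)]%N ->
  P [:: (0, 3); (1, 2); (4, 5)]%N -> P [:: (0, 3); (1, 4); (2, 5)]%N ->
  P [:: (0, 3); (1, 5); (2, 4)]%N -> P [:: (0, 4); (1, 2); (3, 5)]%N ->
  P [:: (0, 4); (1, 3); (2, 5)]%N -> P [:: (0, 4); (1, 5); (2, 3)]%N ->
  P [:: (0, 5); (1, 2); (3, 4)]%N -> P [:: (0, 5); (1, 3); (2, 4)]%N ->
  P [:: (0, 5); (1, 4); (2, 3)]%N -> forall s, s \in synthemes -> P s.
Proof.
move=> P1 P2 P3 P4 P5 P6 P7 P8 P9 P10 P11 P12 P13 P14 P15.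
suff h : forall s, s \in [:: [:: (0, 1); (2, 3); (4, 5)]; [:: (0, 1); (2, 4); (3, 5)];
  [:: (0, 1); (2, 5); (3, 4)]; [:: (0, 2); (1, 3); (4, 5)];
  [:: (0, 2); (1, 4); (3, 5)]; [:: (0, 2); (1, 5); (3, 4)];
  [:: (0, 3); (1, 2); (4, 5)]; [:: (0, 3); (1, 4); (2, 5)];
  [:: (0, 3); (1, 5); (2, 4)]; [:: (0, 4); (1, 2); (3, 5)];
  [:: (0, 4); (1, 3); (2, 5)]; [:: (0, 4); (1, 5); (2, 3)];
  [:: (0, 5); (1, 2); (3, 4)]; [:: (0, 5); (1, 3); (2, 4)];
  [:: (0, 5); (1, 4); (2, 3)]]%N -> P s.
  move=> s sS; apply: h; move: s sS; apply/allP; vm_compute; reflexivity.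
move=> s; rewrite !inE.
by repeat (case/orP; first by move/eqP ->); move/eqP ->.
Qed.

Lemma neq0_eq (x y : F) : x != 0 -> y = x -> y != 0.
Proof. by move=> x0 ->. Qed.

(** Up to sign every bracket of three of these points is 2, 2t, t + 1 or t - 1. *)
Lemma gen_NK4 t : t != 0 -> t ^+ 2 - 1 != 0 -> gen (NK4 t).
Proof.
move=> t0; rewrite (_ : t ^+ 2 - 1 = (t + 1) * (t - 1)); last by ring.
rewrite mulf_eq0 negb_or => /andP[tp tm].
have n2 := two_neq0; have n2' : - (2%:R : F) != 0 by rewrite oppr_eq0.
have t2 : 2%:R * t != 0 by rewrite mulf_neq0.
have t2' : - (2%:R * t) != 0 by rewrite oppr_eq0.
have tp' : - (t + 1) != 0 by rewrite oppr_eq0.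
have tm' : - (t - 1) != 0 by rewrite oppr_eq0.
move=> i j k; case: i => [|[|[|[|[|[|i]]]]]]; case: j => [|[|[|[|[|[|j]]]]]];
  case: k => [|[|[|[|[|[|k]]]]]] // _ _ _; rewrite brE !vec3E;
  first [ by apply: (neq0_eq n2); ring | by apply: (neq0_eq n2'); ring
        | by apply: (neq0_eq tp); ring | by apply: (neq0_eq tm); ring
        | by apply: (neq0_eq tp'); ring | by apply: (neq0_eq tm'); ring
        | by apply: (neq0_eq t2); ring | by apply: (neq0_eq t2'); ring ].
Qed.

Lemma cube_root_neq z : z ^+ 2 + z + 1 = 0 ->
  [/\ z != 0, z - 1 != 0, z + 1 != 0 & z + 2%:R != 0].
Proof.
move=> zE; have n3 : (3%:R : F) != 0 by rewrite pnatr_eq0.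
have z0 : z != 0.
  apply/eqP => e; move/eqP: zE; rewrite e expr0n /= !add0r oner_eq0 //.
split=> //; apply/eqP => e.
- move/eqP: n3; apply; rewrite -[RHS]zE; have -> : z = 1 by apply/eqP; rewrite -subr_eq0 e.
  by ring.
- move/eqP: z0; apply; have : z ^+ 2 = 0 by rewrite -[RHS]zE -[RHS]addrA e addr0.
  by move/eqP; rewrite expf_eq0 => /eqP.
- move/eqP: n3; apply; rewrite -[RHS]zE.
  have -> : z = - 2%:R by apply/eqP; rewrite -subr_eq0 opprK e.
  by ring.
Qed.

(** The factor z + 2 comes from the bracket of the points 3, 4, 5, which is z (z - 1)^2 (z + 2) up
    to sign. *)
Lemma gen_N2K3 z : z ^+ 2 + z + 1 = 0 -> gen (N2K3 z).
Proof.
move=> zE; have [z0 zm zp z2] := cube_root_neq zE.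
have c1 : (1 : F) != 0 by rewrite oner_eq0.
have c2 : z ^+ 2 != 0 by rewrite expf_eq0.
have c3 : (z - 1) * (z + 1) != 0 by rewrite mulf_neq0.
have c4 : z * (z - 1) != 0 by rewrite mulf_neq0.
have c5 : z ^+ 2 * ((z - 1) * (z + 1)) != 0 by rewrite mulf_neq0.
have c6 : z * (z - 1) * (z - 1) * (z + 2%:R) != 0 by rewrite !mulf_neq0.
have opp (x : F) : x != 0 -> - x != 0 by rewrite oppr_eq0.
move=> i j k; case: i => [|[|[|[|[|[|i]]]]]]; case: j => [|[|[|[|[|[|j]]]]]];
  case: k => [|[|[|[|[|[|k]]]]]] // _ _ _; rewrite brE !vec3E;
  first [ by apply: (neq0_eq c1); ring | by apply: (neq0_eq (opp _ c1)); ring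
        | by apply: (neq0_eq z0); ring | by apply: (neq0_eq (opp _ z0)); ring
        | by apply: (neq0_eq zm); ring | by apply: (neq0_eq (opp _ zm)); ring
        | by apply: (neq0_eq c2); ring | by apply: (neq0_eq (opp _ c2)); ring
        | by apply: (neq0_eq c3); ring | by apply: (neq0_eq (opp _ c3)); ring
        | by apply: (neq0_eq c4); ring | by apply: (neq0_eq (opp _ c4)); ring
        | by apply: (neq0_eq c5); ring | by apply: (neq0_eq (opp _ c5)); ring
        | by apply: (neq0_eq c6); ring | by apply: (neq0_eq (opp _ c6)); ring ].
Qed.

Lemma conc_NK4 t s : s \in synthemesK4 -> conc (NK4 t) s.
Proof.
rewrite !inE; repeat (case/orP); move/eqP->; apply/eqP;
  by rewrite /conc /join /= brE /cross !vec3E; ring.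
Qed.

(** Up to sign the brackets of the nine other synthemes are 8t, t^2 + 4t - 1 or t^2 - 4t - 1. *)
Lemma conc_NK4_good t s : good t -> s \in synthemes ->
  conc (NK4 t) s = (s \in synthemesK4).
Proof.
case/and5P => t0 t1 t2 tp tm sS.
case: (boolP (s \in synthemesK4)) => [sK|]; first exact: conc_NK4.
have n8 : (8%:R : F) * t != 0 by rewrite mulf_neq0 // pnatr_eq0.
have opp (x : F) : x != 0 -> - x != 0 by rewrite oppr_eq0.
move: s sS; apply: synthemes_ind => // _; apply: negPf; rewrite /conc /join /= brE /cross !vec3E;
  first [ by apply: (neq0_eq n8); ring | by apply: (neq0_eq (opp _ n8)); ring
        | by apply: (neq0_eq tp); ring | by apply: (neq0_eq (opp _ tp)); ring
        | by apply: (neq0_eq tm); ring | by apply: (neq0_eq (opp _ tm)); ring ].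
Qed.

Lemma concurrent_NK4 t : good t ->
  concurrent (NK4 t) = [seq s <- synthemes | s \in synthemesK4].
Proof. by move=> gt; apply: eq_in_filter => s sS; rewrite conc_NK4_good. Qed.

(** There are 45 pairs of disjoint duads, and each of the six concurrent synthemes absorbs three of
    them: 45 - 18 = 27. *)
Lemma crossings_NK4 t : good t -> size (crossings (NK4 t)) = 27%N.
Proof. by move=> gt; rewrite /crossings concurrent_NK4 //; vm_compute. Qed.

(** A seventh concurrent syntheme is excluded by the count, and the brackets of 02|14|35 and
    02|15|34 are the negatives of t^2 + 4t - 1 and t^2 - 4t - 1. *)
Lemma good_NK4 t : gen (NK4 t) -> size (concurrent (NK4 t)) = 6%N ->
  t ^+ 2 + 1 != 0 -> good t.
Proof.
move=> gt s6 tp; have H s : s \in synthemes -> s \notin synthemesK4 ->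
    ~~ conc (NK4 t) s.
  move=> sS sK; apply/negP => sc; have : (size (s :: synthemesK4) <= 6)%N.
    rewrite -s6; apply: uniq_leq_size; first by rewrite /= sK.
    move=> r; rewrite inE => /orP[/eqP->|rK]; rewrite mem_filter ?sc ?sS //.
    by rewrite conc_NK4 //; move: r rK; apply/allP; vm_compute.
  by [].
have b1 := gt 0%N 4%N 5%N isT isT isT; have b2 := gt 0%N 2%N 4%N isT isT isT.
have b3 := gt 0%N 2%N 5%N isT isT isT.
have c1 := H [:: (0, 2); (1, 4); (3, 5)]%N isT isT.
have c2 := H [:: (0, 2); (1, 5); (3, 4)]%N isT isT.
apply/and5P; split=> //.
- by apply: contraNneq b1 => ->; rewrite brE !vec3E; apply/eqP; ring.
- rewrite (_ : t ^+ 2 - 1 = (t + 1) * (t - 1)); last by ring.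
  rewrite mulf_neq0 //.
    by apply: contra_neq b2 => e; rewrite brE !vec3E -[RHS]e; ring.
  by apply: contra_neq b3 => e; rewrite brE !vec3E -[RHS]oppr0 -[in RHS]e; ring.
- apply: contraNneq c1 => e; rewrite /conc /join /= brE /cross !vec3E; apply/eqP.
  by transitivity (- (t ^+ 2 + 4%:R * t - 1)); [ring|rewrite e oppr0].
- apply: contraNneq c2 => e; rewrite /conc /join /= brE /cross !vec3E; apply/eqP.
  by transitivity (- (t ^+ 2 - 4%:R * t - 1)); [ring|rewrite e oppr0].
Qed.

Lemma conc_N2K3 z s : z ^+ 2 + z + 1 = 0 -> s \in synthemes ->
  conc (N2K3 z) s = (s \in synthemes2K3).
Proof.
move=> zE; have [z0 zm zp z2] := cube_root_neq zE.
have n2 := two_neq0.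
have d1 : 2%:R * z * (z - 1) != 0 by rewrite !mulf_neq0.
(* Modulo the equation of [z], the last factor is the constant -2. *)
have d2 : z * (z - 1) * (z ^+ 2 + z - 1) != 0.
  rewrite !mulf_neq0 // (_ : _ - 1 = z ^+ 2 + z + 1 - 2%:R); last by ring.
  by rewrite zE sub0r oppr_eq0.
have opp (x : F) : x != 0 -> - x != 0 by rewrite oppr_eq0.
move: s; apply: synthemes_ind; rewrite /conc /join /= brE /cross !vec3E;
  first [ by apply: negPf; apply: (neq0_eq d1); ring
        | by apply: negPf; apply: (neq0_eq (opp _ d1)); ring
        | by apply: negPf; apply: (neq0_eq d2); ring
        | by apply: negPf; apply: (neq0_eq (opp _ d2)); ring
        | by apply/eqP; ring
        | apply/eqP; transitivity (z * (z - 1) * (z ^+ 2 + z + 1)); [ring|by rewrite zE mulr0]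
        | apply/eqP; transitivity (- z * (z - 1) * (z ^+ 2 + z + 1)); [ring|by rewrite zE mulr0] ].
Qed.

Lemma concurrent_N2K3 z : z ^+ 2 + z + 1 = 0 ->
  concurrent (N2K3 z) = [seq s <- synthemes | s \in synthemes2K3].
Proof. by move=> zE; apply: eq_in_filter => s sS; rewrite conc_N2K3. Qed.

Lemma crossings_N2K3 z : z ^+ 2 + z + 1 = 0 -> size (crossings (N2K3 z)) = 27%N.
Proof. by move=> zE; rewrite /crossings concurrent_N2K3 //; vm_compute. Qed.

Lemma quad_vec3 C a b c : quad C (vec3 a b c) =
  C o0 o0 * a ^+ 2 + C o1 o1 * b ^+ 2 + C o2 o2 * c ^+ 2 +
  (C o1 o2 + C o2 o1) * (b * c) + (C o0 o2 + C o2 o0) * (a * c) +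
  (C o0 o1 + C o1 o0) * (a * b).
Proof. by rewrite quadE !sum3E !vec3E; ring. Qed.

(** The two points of a pair differ by one sign, which kills the mixed coefficients. The square
    coefficients then satisfy three linear equations with determinant t^2 + 1 up to sign. *)
Lemma quad_NK4_eq0 t C : t != 0 -> t ^+ 2 + 1 != 0 ->
  (forall i, (i < 6)%N -> quad C (NK4 t i) = 0) -> forall v, quad C v = 0.
Proof.
move=> t0 t1 h v; have := h 0%N isT; have := h 1%N isT; have := h 2%N isT.
have := h 3%N isT; have := h 4%N isT; have := h 5%N isT.
rewrite -(vec3_eta v) !quad_vec3.
set A := C o0 o0; set B := C o1 o1; set D := C o2 o2.
set X := C o1 o2 + _; set Y := C o0 o2 + _; set Z := C o0 o1 + _.
move=> h5 h4 h3 h2 h1 h0; have n2 := two_neq0.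
have X0 : X = 0.
  apply: (mulfI n2); rewrite mulr0.
  by have := congr2 (fun a b => a - b) h0 h1; rewrite subrr => <-; ring.
have Y0 : Y = 0.
  apply: (mulfI n2); rewrite mulr0.
  by have := congr2 (fun a b => a - b) h2 h3; rewrite subrr => <-; ring.
have Z0 : Z = 0.
  apply: (mulfI (mulf_neq0 n2 t0)); rewrite mulr0.
  by have := congr2 (fun a b => a - b) h4 h5; rewrite subrr => <-; ring.
have D0 : D = 0.
  apply: (mulfI t1); rewrite mulr0 -[RHS](_ : t ^+ 2 * (B + D) + (A + D) - (A + t ^+ 2 * B) = 0).
    by ring.
  have -> : B + D = 0 by rewrite -[RHS]h0 X0; ring.
  have -> : A + D = 0 by rewrite -[RHS]h2 Y0; ring.
  have -> : A + t ^+ 2 * B = 0 by rewrite -[RHS]h4 Z0; ring.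
  by rewrite mulr0 addr0 subrr.
have A0 : A = 0 by rewrite -[RHS]h2 Y0 D0; ring.
have B0 : B = 0 by rewrite -[RHS]h0 X0 D0; ring.
by rewrite A0 B0 D0 X0 Y0 Z0 !mul0r !addr0.
Qed.

(** The coordinate points kill the squares; the points 3, 4, 5 give the discrete Fourier transform
    of order three of the mixed coefficients, which is invertible. *)
Lemma quad_N2K3_eq0 z C : z ^+ 2 + z + 1 = 0 ->
  (forall i, (i < 6)%N -> quad C (N2K3 z i) = 0) -> forall v, quad C v = 0.
Proof.
move=> zE h v; have := h 0%N isT; have := h 1%N isT; have := h 2%N isT.
have := h 3%N isT; have := h 4%N isT; have := h 5%N isT.
rewrite -(vec3_eta v) !quad_vec3.
set A := C o0 o0; set B := C o1 o1; set D := C o2 o2.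
set X := C o1 o2 + _; set Y := C o0 o2 + _; set Z := C o0 o1 + _.
move=> h5 h4 h3 h2 h1 h0; have n3 : (3%:R : F) != 0 by rewrite pnatr_eq0.
have A0 : A = 0 by rewrite -[RHS]h0; ring.
have B0 : B = 0 by rewrite -[RHS]h1; ring.
have D0 : D = 0 by rewrite -[RHS]h2; ring.
move: h3 h4 h5; rewrite A0 B0 D0 => h3 h4 h5.
have e3 : X + Y + Z = 0 by rewrite -[RHS]h3; ring.
have e4 : X * z ^+ 3 + Y * z ^+ 2 + Z * z = 0 by rewrite -[RHS]h4; ring.
have e5 : X * z ^+ 3 + Y * z + Z * z ^+ 2 = 0 by rewrite -[RHS]h5; ring.
have z3 : z ^+ 3 = 1.
  apply/eqP; rewrite -subr_eq0; apply/eqP.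
  by transitivity ((z - 1) * (z ^+ 2 + z + 1)); [ring|rewrite zE mulr0].
rewrite z3 !mulr1 in e4 e5.
have [z0 zm zp z2] := cube_root_neq zE.
have X0 : X = 0.
  apply: (mulfI n3); rewrite mulr0.
  transitivity (X + Y + Z + (X + Y * z ^+ 2 + Z * z) + (X + Y * z + Z * z ^+ 2)
     - (Y + Z) * (z ^+ 2 + z + 1)); first by ring.
  by rewrite e3 e4 e5 zE mulr0 !addr0 subrr.
have YZ : Y = - Z by apply/eqP; rewrite -addr_eq0 -[X in _ == X]e3 X0 add0r.
have Z0 : Z = 0.
  apply: (mulfI (mulf_neq0 z0 zm)); rewrite mulr0 -[RHS]e5 X0 YZ; ring.
by rewrite X0 YZ Z0 oppr0 !mul0r !addr0.
Qed.

(** The conic x^2 + y^2 = z^2 contains the points 0 to 3 for every t, and the points 4 and 5 when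
    t^2 = -1. *)
Definition conicK4 : 'M[F]_3 := mx3 (vec3 1 0 0) (vec3 0 1 0) (vec3 0 0 (-1)).

Lemma quad_conicK4 t i : t ^+ 2 + 1 = 0 -> (i < 6)%N -> quad conicK4 (NK4 t i) = 0.
Proof.
move=> t1; move: i; apply: ord6P; rewrite quad_vec3 !mxE /=.
all: first [by ring | by rewrite -[RHS]t1; ring].
Qed.

Lemma unassuming_moved p H : \det H != 0 -> gen p -> size (concurrent p) = 6%N ->
  size (crossings p) = 27%N ->
  (forall C, (forall i, (i < 6)%N -> quad C (p i) = 0) -> forall v, quad C v = 0) ->
  unassuming (arr (moved p H)).
Proof.
move=> dH gp s6 s27 pC; have pq := peq_mulmx p dH.
apply: (unassuming_arr (gen_peq pq gp)).
- by rewrite (concurrent_peq pq).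
- by rewrite (crossings_peq pq).
apply: (not_on_conic_peq pq _ pC) => i li.
exact: gen_neq0 (gen_peq pq gp) _ li.
Qed.

Lemma unassuming_NK4 t H : good t -> \det H != 0 -> unassuming (arr (moved (NK4 t) H)).
Proof.
move=> gt dH; case/and5P: (gt) => t0 t1 t2 _ _.
apply: (unassuming_moved dH (gen_NK4 t0 t1) _ (crossings_NK4 gt)).
  by rewrite (concurrent_NK4 gt); vm_compute.
by move=> C; exact: quad_NK4_eq0.
Qed.

Lemma unassuming_N2K3 z H : z ^+ 2 + z + 1 = 0 -> \det H != 0 ->
  unassuming (arr (moved (N2K3 z) H)).
Proof.
move=> zE dH; apply: (unassuming_moved dH (gen_N2K3 zE) _ (crossings_N2K3 zE)).
  by rewrite (concurrent_N2K3 zE); vm_compute.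
by move=> C; exact: quad_N2K3_eq0.
Qed.

Lemma arr_compose p l : l \in hexads -> arr (compose_seq p l) = arr p.
Proof.
move=> lH; have [sl ul hl] := hexadsP lH; apply/seteqP; split=> [_ [i li <-]|_ [i li <-]].
  by exists (nth 0%N l i); first exact: hl.
have il : i \in l.
  by move: lH; rewrite mem_permutations => /perm_mem ->; rewrite mem_iota.
exists (index i l); first by rewrite /= -sl index_mem.
by rewrite /compose_seq nth_index.
Qed.

Lemma size_concurrent p : gen p -> unassuming (arr p) -> size (concurrent p) = 6%N.
Proof.
move=> gp; rewrite /unassuming (lines_at_least2_arr gp) => -[_ _ [_ k3 _] _ _].
exact: card_II_uniq (kpoints3_joins gp) k3.
Qed.

Lemma good_of_peq t q H : gen q -> unassuming (arr q) -> peq (NK4 t) q H -> good t.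
Proof.
move=> gq uq NH; have gN : gen (NK4 t) by exact: gen_peq (peq_inv NH) gq.
apply: (good_NK4 gN); first by rewrite -(concurrent_peq NH); exact: size_concurrent.
have ncq : ~ on_conic (six_points q).
  by move: uq; rewrite /unassuming (lines_at_least2_arr gq) (kpoints5_joinsE gq) => -[].
apply/eqP => t1; apply: ncq.
apply: on_conic_peq NH (gen_neq0 gq) (_ : forall i, _ -> quad conicK4 _ = 0) _.
  by move=> i li; exact: quad_conicK4.
exists (vec3 1 0 0); rewrite quad_vec3 !mxE /=.
by apply: (neq0_eq (oner_neq0 F)); ring.
Qed.

Lemma normal_form p : gen p -> unassuming (arr p) -> exists2 l, l \in hexads &
  (exists t H, good t /\ peq (NK4 t) (compose_seq p l) H) \/
  (exists z H, z ^+ 2 + z + 1 = 0 /\ peq (N2K3 z) (compose_seq p l) H).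
Proof.
move=> gp up; have [l lH h] := classification (size_concurrent gp up).
exists l => //; have gq := gen_compose gp lH.
case: h => [[hc hn]|hc]; [left|right]; last exact: (normal_form_2K3 gq hc).
have [t [H NH]] := normal_form_K4 gq hc hn; exists t, H; split=> //.
by apply: (good_of_peq gq _ NH); rewrite arr_compose.
Qed.

End NormalFormProperties.

(** * Permutations and the two concurrency patterns *)

Section Stabilizer.

Definition stabilizes (K : seq (seq (nat * nat))) l :=
  all (fun s => relabels l s \in K) K.

Lemma no_K4_to_2K3 l : l \in hexads ->
  ~~ all (fun s => relabels l s \in synthemesK4) synthemes2K3.
Proof.
have /allP h : all (fun l => ~~ all (fun s => relabels l s \in synthemesK4) synthemes2K3)
  hexads by vm_compute.
exact: h.
Qed.

(** A conjunction that unfolds on an explicit list, so that an identity can be checked separately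
    for each permutation. *)
Fixpoint Forall_seq (T : Type) (P : T -> Prop) (s : seq T) : Prop :=
  if s is x :: s' then P x /\ Forall_seq P s' else True.

Lemma Forall_seqP (T : eqType) (P : T -> Prop) (s : seq T) :
  Forall_seq P s -> forall x, x \in s -> P x.
Proof.
elim: s => //= y s IHs [Py Ps] x; rewrite inE => /orP[/eqP-> //|].
exact: IHs.
Qed.

Lemma arr_perm l : size l = 6%N -> uniq l -> all (fun i => i < 6)%N l -> l \in hexads.
Proof.
move=> sl ul /allP al; rewrite mem_permutations; apply: uniq_perm => //.
have [] := @uniq_min_size _ l (iota 0 6) ul; rewrite ?sl //.
by move=> i il; rewrite mem_iota; exact: al.
Qed.

End Stabilizer.

(** * Projective equivalence of the normal forms and the action of the operator *)

Section Equivalence.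
Variable F : numClosedFieldType.
Implicit Types (p q : nat -> 'rV[F]_3) (t z : F) (H K C : 'M[F]_3).

(** Coordinate vectors of lines transform by the inverse transpose. Every invertible matrix is an
    inverse transpose, which is why [proj_equiv_arr] can speak of an arbitrary [H]. *)
Lemma limg_ker_dot (g : 'End('rV[F]_3)) (G : 'M[F]_3) v : (forall u, g u = u *m G) ->
  G \in unitmx -> (g @: ker_dot v)%VS = ker_dot (v *m (invmx G)^T).
Proof.
move=> gG uG; apply/vspaceP => x; rewrite mem_ker_dot -dot_mulmx.
apply/memv_imgP/idP => [[y + ->]|xv].
  by rewrite mem_ker_dot gG mulmxK.
by exists (x *m invmx G); rewrite ?mem_ker_dot // gG mulmxKV.
Qed.

Lemma moved_neq0 p H : \det H != 0 -> (forall i, (i < 6)%N -> p i != 0) ->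
  forall i, (i < 6)%N -> moved p H i != 0.
Proof.
move=> dH p0 i li; have uH : H \in unitmx by rewrite unitmxE unitfE.
by apply: contraNneq (p0 i li) => e; rewrite -(mulmxK uH (p i)) -/(moved p H i) e mul0mx.
Qed.

Lemma proj_equiv_arr p B : (forall i, (i < 6)%N -> p i != 0) ->
  proj_equiv (arr p) B <-> exists H, \det H != 0 /\ B = arr (moved p H).
Proof.
move=> p0; split=> [[g g0 gB]|[H [dH ->]]].
  pose G := lin1_mx g; have gG u : g u = u *m G by rewrite mul_rV_lin1.
  have uG : G \in unitmx.
    rewrite -row_free_unit; apply: inj_row_free => v; rewrite -gG => gv0.
    by apply: (lker0P g0); rewrite gv0 linear0.
  have dG : \det ((invmx G)^T) != 0 by rewrite det_tr det_inv invr_eq0 -unitfE -unitmxE.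
  exists ((invmx G)^T); split=> //.
  have m0 := moved_neq0 dG p0.
  apply/seteqP; split=> [l Bl|_ [i li <-]].
    have : [set val l | l in B] (val l) by exists l.
    rewrite gB => -[_ [i li <-]]; rewrite val_ln ?p0 // (limg_ker_dot _ gG uG) => e.
    by exists i => //; apply: val_inj; rewrite val_ln ?m0 //.
  have : [set (g @: val l)%VS | l in arr p] (ker_dot (moved p (invmx G)^T i)).
    exists (ln (p i)); first by exists i.
    by rewrite val_ln ?p0 // (limg_ker_dot _ gG uG).
  rewrite -gB => -[l Bl e]; suff -> : ln (moved p (invmx G)^T i) = l by [].
  by apply: val_inj; rewrite val_ln ?m0.
have uH : H \in unitmx by rewrite unitmxE unitfE.
have dK : \det (invmx H)^T != 0 by rewrite det_tr det_inv invr_eq0.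
pose g : 'End('rV[F]_3) := linfun (mulmxr (invmx H)^T).
have gG u : g u = u *m (invmx H)^T by rewrite lfunE.
have uK : (invmx H)^T \in unitmx by rewrite unitmxE unitfE.
have HE : (invmx (invmx H)^T)^T = H by rewrite -trmx_inv trmxK invmxK.
have m0 := moved_neq0 dH p0.
exists g.
  apply/lker0P => u v; rewrite !gG => e.
  by rewrite -(mulmxK uK u) e mulmxK.
apply/seteqP; split=> [_ [_ [i li <-] <-]|_ [_ [i li <-] <-]].
  exists (ln (p i)); first by exists i.
  by rewrite val_ln ?p0 // (limg_ker_dot _ gG uK) HE val_ln ?m0.
exists (ln (moved p H i)); first by exists i.
by rewrite val_ln ?m0 // [in RHS]val_ln ?p0 // (limg_ker_dot _ gG uK) HE.
Qed.

(** Pairing equal lines gives a map of indices, injective because the six lines are distinct;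
    vectors of the same line are proportional. *)
Lemma arr_eq_peq p q : gen p -> gen q -> arr p = arr q ->
  exists2 l, l \in hexads & peq (compose_seq p l) q 1%:M.
Proof.
move=> gp gq e; have [j jP] : {j : nat -> nat & forall i, (i < 6)%N ->
    (j i < 6)%N /\ ln (p (j i)) = ln (q i)}.
  apply: (@boolp.choice _ _ (fun i k => (i < 6)%N -> (k < 6)%N /\ ln (p k) = ln (q i))) => i.
  case: (ltnP i 6) => [li|]; last by exists 0%N.
  have : arr q (ln (q i)) by exists i.
  by rewrite -e => -[k lk kE]; exists k.
have lH : mkseq j 6 \in hexads.
  apply: arr_perm; first exact: size_mkseq.
    rewrite map_inj_in_uniq ?iota_uniq // => a b; rewrite !mem_iota => la lb ab.
    have [_ qa] := jP a la; have [_ qb] := jP b lb.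
    by apply: (ln_inj gq la lb); rewrite -qa -qb ab.
  by apply/allP => _ /mapP[i + ->]; rewrite mem_iota => li; case: (jP i li).
exists (mkseq j 6) => //; split; first by rewrite det1 oner_eq0.
move=> i li; rewrite mulmx1 /compose_seq nth_mkseq //; have [lj ej] := jP i li.
apply/pt_eq; rewrite ?(gen_neq0 gp) ?(gen_neq0 gq) //.
by apply/ln_eq; rewrite ?(gen_neq0 gp) ?(gen_neq0 gq).
Qed.

Lemma arr_eq_peq_trans p q p' q' H K : gen p -> gen q -> arr p = arr q ->
  peq p' p H -> peq q' q K ->
  exists l M, l \in hexads /\ peq (compose_seq p' l) q' M.
Proof.
move=> gp gq e pH qK; have [l lH pq] := arr_eq_peq gp gq e.
exists l, (H *m 1%:M *m invmx K); split=> //.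
apply: peq_trans (peq_inv qK); apply: peq_trans pq.
have [_ _ hl] := hexadsP lH.
by case: pH => dH pH; split=> // i li; apply: pH; exact: hl.
Qed.

Lemma moved_peq p q H K : peq p q H -> (forall i, (i < 6)%N -> q i != 0) ->
  \det K != 0 -> arr (moved q K) = arr (moved p (H *m K)).
Proof.
move=> pq q0 dK; apply: arr_peq; first exact: moved_neq0.
exact: peq_trans pq (peq_mulmx q dK).
Qed.

(** The triple points of the joins are the centres of the concurrent synthemes. The arrangement is a
    set, so [S] may list them in whatever order suits the normal form. *)
Lemma Lambda23_moved p H (S : seq (seq (nat * nat))) : gen p -> \det H != 0 ->
  size S = 6%N -> concurrent p =i S ->
  Lambda23 (arr (moved p H)) =
  arr (moved (fun i => center p (nth [::] S i)) H).
Proof.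
move=> gp dH s6 cS; have uH : H \in unitmx by rewrite unitmxE unitfE.
have gm : gen (moved p H) by exact: gen_peq (peq_mulmx p dH) gp.
rewrite (Lambda23_arr gm).
have incE x : inc (moved p H) (x *m H) = inc p x.
  apply: eq_filter => d; rewrite /join /moved -!/(br _ _ _) br_mulmx.
  by rewrite mulf_eq0 (negPf dH) orbF.
have cP s : s \in S -> [/\ center p s != 0, inc p (center p s) = s & size s = 3%N].
  rewrite -cS => sC; have [sM s3 _] := concurrent_matching sC.
  by split=> //; [apply: center_neq0; rewrite ?s3|exact: inc_center].
have mulH0 (x : 'rV[F]_3) : x != 0 -> x *m H != 0.
  by apply: contraNneq => e; rewrite -(mulmxK uH x) e mul0mx.
apply/seteqP; split=> [_ [x [x0 x3] <-]|_ [i li <-]].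
  pose y := x *m invmx H; have xE : x = y *m H by rewrite mulmxKV.
  have y0 : y != 0 by apply: contraNneq x0 => e; rewrite xE e mul0mx.
  move: x3; rewrite xE incE => y3; have yC := inc3P gp y0 y3.
  have yS : inc p y \in S by rewrite -cS.
  exists (index (inc p y) S); first by rewrite /= -s6 index_mem.
  rewrite /moved (nth_index _ yS); have [c0 cE _] := cP _ yS.
  have [yM _ _] := concurrent_matching yC.
  have /(pt_eq c0 y0)[a a0 ->] : pt (center p (inc p y)) = pt y.
    by apply: (inc_inj gp c0 y0 cE); rewrite cE; [exact: yM|rewrite y3].
  have yH := mulH0 _ y0; rewrite -scalemxAl.
  have aH : a *: (y *m H) != 0 by rewrite scaler_eq0 negb_or a0.
  by apply/(ln_eq aH yH); exact: (ptZ (n := 2)).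
have [c0 cE s3] : [/\ center p (nth [::] S i) != 0, inc p (center p (nth [::] S i)) =
    nth [::] S i & size (nth [::] S i) = 3%N] by apply: cP; rewrite mem_nth ?s6.
by exists (center p (nth [::] S i) *m H) => //; split; [exact: mulH0|rewrite incE cE].
Qed.

(** The members of [synthemesK4], ordered so that their centres match, index by index, the points of
    the normal form with parameter t^-2. *)
Definition centersK4 : seq (seq (nat * nat)) :=
  [:: [:: (0, 1); (2, 5); (3, 4)]; [:: (0, 1); (2, 4); (3, 5)];
      [:: (0, 5); (1, 4); (2, 3)]; [:: (0, 4); (1, 5); (2, 3)];
      [:: (0, 3); (1, 2); (4, 5)]; [:: (0, 2); (1, 3); (4, 5)]]%N.

(** The members of [synthemes2K3], ordered so that their centres match the points of [N2K3 z] index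
    by index. *)
Definition centers2K3 : seq (seq (nat * nat)) :=
  [:: [:: (0, 3); (1, 4); (2, 5)]; [:: (0, 5); (1, 3); (2, 4)];
      [:: (0, 4); (1, 5); (2, 3)]; [:: (0, 3); (1, 5); (2, 4)];
      [:: (0, 5); (1, 4); (2, 3)]; [:: (0, 4); (1, 3); (2, 5)]]%N.

Lemma Lambda23_NK4 t H : good t -> \det H != 0 -> exists K, \det K != 0 /\
  Lambda23 (arr (moved (NK4 t) H)) = arr (moved (NK4 (t^-1 ^+ 2)) K).
Proof.
move=> gt dH; case/and5P: (gt) => t0 t1 _ _ _.
have ti : t^-1 != 0 by rewrite invr_eq0.
have gN := gen_NK4 t0 t1.
have cS : concurrent (NK4 t) =i centersK4.
  by rewrite (concurrent_NK4 gt); apply: perm_mem; vm_compute.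
rewrite (Lambda23_moved (S := centersK4) gN dH erefl cS); set q := fun i => center _ _.
(* The centres lie again on the sides of the coordinate triangle, so a diagonal change suffices. *)
pose D := mx3 (vec3 (t^-1 ^+ 2) 0 0) (vec3 0 1 0) (vec3 0 0 t^-1).
have dD : \det D != 0.
  by rewrite det_diag3; exact: mulf_neq0 (mulf_neq0 (expf_neq0 _ ti) (oner_neq0 _)) ti.
have n2 := two_neq0 F.
have a0 : 2%:R * t != 0 by rewrite mulf_neq0.
have b0 : 2%:R * t ^+ 2 != 0 by rewrite mulf_neq0 ?expf_neq0.
have pq : peq (NK4 (t^-1 ^+ 2)) q D.
  split=> //; apply: ord6P; rewrite /q /center /join /= mulmx_diag3.
  - exists (- (2%:R * t)); first by rewrite oppr_eq0.
    by rewrite scale_vec3 /cross !vec3E; congr vec3; field.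
  - exists (2%:R * t) => //.
    by rewrite scale_vec3 /cross !vec3E; congr vec3; field.
  - exists (- (2%:R * t ^+ 2)); first by rewrite oppr_eq0.
    by rewrite scale_vec3 /cross !vec3E; congr vec3; field.
  - exists (2%:R * t ^+ 2) => //.
    by rewrite scale_vec3 /cross !vec3E; congr vec3; field.
  - exists (2%:R * t ^+ 2) => //.
    by rewrite scale_vec3 /cross !vec3E; congr vec3; field.
  - exists (2%:R * t ^+ 2) => //.
    by rewrite scale_vec3 /cross !vec3E; congr vec3; field.
exists (D *m H); split; first by rewrite det_mulmx mulf_neq0.
apply: moved_peq pq _ dH => i li.
have : nth [::] centersK4 i \in concurrent (NK4 t) by rewrite cS mem_nth.
by move=> /concurrent_matching[sM s3 _]; apply: center_neq0; rewrite ?s3.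
Qed.

Lemma Lambda23_N2K3 z H : z ^+ 2 + z + 1 = 0 -> \det H != 0 -> exists K, \det K != 0 /\
  Lambda23 (arr (moved (N2K3 z) H)) = arr (moved (N2K3 z) K).
Proof.
move=> zE dH; have [z0 zm zp z2] := cube_root_neq zE.
have gN := gen_N2K3 zE.
have cS : concurrent (N2K3 z) =i centers2K3.
  by rewrite (concurrent_N2K3 zE); apply: perm_mem; vm_compute.
rewrite (Lambda23_moved (S := centers2K3) gN dH erefl cS); set q := fun i => center _ _.
(* The rows are multiples of the first three centres, scaled so that their sum is a multiple of the
   fourth. *)
pose D := mx3 (vec3 (z ^+ 2) z z) (vec3 1 z 1) (vec3 1 1 z).
have dD : \det D != 0.
  rewrite det_mx3 brE !vec3E.
  apply: (neq0_eq (_ : z * (z - 1) * (z - 1) * (z + 2%:R) != 0)); last by ring.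
  by rewrite !mulf_neq0.
have n3 : (3%:R : F) != 0 by rewrite pnatr_eq0.
(* 2z + 1 is a square root of -3. *)
have zd : 2%:R * z + 1 != 0.
  apply/eqP => e; move/eqP: n3; apply.
  transitivity (4%:R * (z ^+ 2 + z + 1) - (2%:R * z + 1) ^+ 2); first by ring.
  by rewrite e zE; ring.
(* The cofactors [R] given below are the quotients on division by z^2 + z + 1. *)
have mod_eq R a b : a - b = R * (z ^+ 2 + z + 1) -> a = b.
  by move=> h; apply/eqP; rewrite -subr_eq0 h zE mulr0.
have pq : peq (N2K3 z) q D.
  split=> //; apply: ord6P; rewrite /q /center /join /= mulmx_mx3 !vec3E.
  - exists z => //; apply: row3P; rewrite !mxE /=;
      first [by ring | by apply: (mod_eq (1 - z)); ring].
  - by exists z => //; apply: row3P; rewrite !mxE /=; ring.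
  - exists (z ^+ 2); first by rewrite expf_neq0.
    by apply: row3P; rewrite !mxE /=; ring.
  - exists (- (z * (2%:R * z + 1)) / 3%:R).
      by rewrite mulf_neq0 ?invr_eq0 // oppr_eq0 mulf_neq0.
    apply: row3P; rewrite [RHS]mxE mulrAC; apply: (canRL (mulfK n3)); rewrite !mxE /=.
    + by apply: (mod_eq (2%:R * z ^+ 2 - z + 3%:R)); ring.
    + by apply: (mod_eq (4%:R * z)); ring.
    + by apply: (mod_eq (4%:R * z)); ring.
  - exists (- (2%:R * z + 1) / 3%:R).
      by rewrite mulf_neq0 ?invr_eq0 // oppr_eq0.
    apply: row3P; rewrite [RHS]mxE mulrAC; apply: (canRL (mulfK n3)); rewrite !mxE /=.
    + by apply: (mod_eq (4%:R * z)); ring.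
    + by apply: (mod_eq (3%:R * z ^+ 2 + z)); ring.
    + by apply: (mod_eq (2%:R * z ^+ 2 + 2%:R * z)); ring.
  - exists (- (z * (2%:R * z + 1)) / 3%:R).
      by rewrite mulf_neq0 ?invr_eq0 // oppr_eq0 mulf_neq0.
    apply: row3P; rewrite [RHS]mxE mulrAC; apply: (canRL (mulfK n3)); rewrite !mxE /=.
    + by apply: (mod_eq (4%:R * z ^+ 2)); ring.
    + by apply: (mod_eq (2%:R * z ^+ 3 - z ^+ 2 + 3%:R * z)); ring.
    + by apply: (mod_eq (4%:R * z ^+ 2)); ring.
exists (D *m H); split; first by rewrite det_mulmx mulf_neq0.
apply: moved_peq pq _ dH => i li.
have : nth [::] centers2K3 i \in concurrent (N2K3 z) by rewrite cS mem_nth.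
by move=> /concurrent_matching[sM s3 _]; apply: center_neq0; rewrite ?s3.
Qed.

(* With J = t^2 + t^-2 one has 16 (I1 / I2)^2 = J - 2 on NK4 t; in both brackets
   products each of the six points occurs once. *)
Definition I1 p := br (p 0%N) (p 2%N) (p 4%N) * br (p 1%N) (p 3%N) (p 5%N).
Definition I2 p := br (p 0%N) (p 1%N) (p 2%N) * br (p 3%N) (p 4%N) (p 5%N).

Lemma I12_peq p q H : peq p q H ->
  exists2 k, k != 0 & I1 q = k * I1 p /\ I2 q = k * I2 p.
Proof.
move=> [dH pq]; rewrite /I1 /I2.
have [c0 n0 ->] := pq 0%N isT; have [c1 n1 ->] := pq 1%N isT.
have [c2 n2 ->] := pq 2%N isT; have [c3 n3 ->] := pq 3%N isT.
have [c4 n4 ->] := pq 4%N isT; have [c5 n5 ->] := pq 5%N isT.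
exists (c0 * c1 * c2 * c3 * c4 * c5 * \det H * \det H); first by rewrite !mulf_neq0.
by rewrite !brZ !br_mulmx; split; ring.
Qed.

Definition stabilizer := [seq l <- hexads | stabilizes synthemesK4 l].

(** The 48 permutations preserving [synthemesK4] change [I1] and [I2] of the normal form at most by
    a sign, whence the squares. *)
Lemma I12_stabilizer t l : l \in stabilizer ->
  I1 (compose_seq (NK4 t) l) ^+ 2 = (t ^+ 2 - 1) ^+ 2 /\
  I2 (compose_seq (NK4 t) l) ^+ 2 = (4%:R * t) ^+ 2.
Proof.
move: l; apply: Forall_seqP.
(* The stabilizer is replaced by its computed list, leaving two polynomial identities for each
   permutation. *)
rewrite [stabilizer](_ : _ = ltac:(let x := eval vm_compute in stabilizer in exact x));
  last by vm_compute.
rewrite /Forall_seq /I1 /I2 /compose_seq; do !split; rewrite /= !brE !vec3E; ring.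
Qed.

Definition Jinv t := t ^+ 2 + t^-1 ^+ 2.

(** For good t only [synthemesK4] is concurrent, so a relabelling that makes these six concurrent
    again must permute them. *)
Lemma relabel_stabilizes t q l H : good t -> l \in hexads ->
  peq (compose_seq (NK4 t) l) q H -> (forall s, s \in synthemesK4 -> conc q s) ->
  l \in stabilizer.
Proof.
move=> gt lH pq qc; rewrite mem_filter lH andbT; apply/allP => s sK.
have sS : s \in synthemes by move: s sK; apply/allP; vm_compute.
have rS := relabels_syntheme lH sS.
rewrite -(conc_NK4_good gt rS).
have : conc q s by exact: qc.
rewrite (conc_peq pq sS).
by move: sS; rewrite mem_filter => /andP[+ _]; case: s {sK rS} => [|d [|e [|f []]]] // _;
   rewrite conc_relabels.
Qed.

(** The relation is homogeneous in [I1] and [I2], so the common factor of [I12_peq] cancels; it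
    recovers J from every labelling with the right concurrent synthemes. *)
Lemma I12_J t q l H : good t -> l \in hexads -> peq (compose_seq (NK4 t) l) q H ->
  (forall s, s \in synthemesK4 -> conc q s) ->
  I2 q != 0 /\ 2%:R * I2 q ^+ 2 + 16%:R * I1 q ^+ 2 = Jinv t * I2 q ^+ 2.
Proof.
move=> gt lH pq qc; have lS := relabel_stabilizes gt lH pq qc.
have [E1 E2] := I12_stabilizer t lS; have [k k0 [-> ->]] := I12_peq pq.
case/and5P: gt => t0 _ _ _ _; split.
  apply: mulf_neq0 => //; rewrite -sqrf_eq0 E2 sqrf_eq0 mulf_neq0 //.
  by rewrite pnatr_eq0.
rewrite [(k * I1 _) ^+ 2]exprMn [(k * I2 _) ^+ 2]exprMn E1 E2 /Jinv.
by field.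
Qed.

Lemma Jinv_peq t t' l H : good t -> l \in hexads -> peq (compose_seq (NK4 t) l) (NK4 t') H ->
  good t' -> Jinv t = Jinv t'.
Proof.
move=> gt lH pq gt'; have [n e] := I12_J gt lH pq (@conc_NK4 F t').
have id : [:: 0; 1; 2; 3; 4; 5]%N \in hexads by vm_compute.
have pq' : peq (compose_seq (NK4 t') [:: 0; 1; 2; 3; 4; 5]%N) (NK4 t') 1%:M.
  split; first by rewrite det1 oner_eq0.
  by apply: ord6P; exists 1; rewrite ?oner_eq0 // mulmx1 scale1r.
have [_ e'] := I12_J gt' id pq' (@conc_NK4 F t').
by apply: (mulIf (expf_neq0 2 n)); rewrite -e.
Qed.

Lemma NK4_oppr t : exists2 l, l \in hexads &
  forall i, (i < 6)%N -> NK4 (- t) i = compose_seq (NK4 t) l i.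
Proof.
exists [:: 0; 1; 2; 3; 5; 4]%N; first by vm_compute.
by apply: ord6P => //=; rewrite /compose_seq /= opprK.
Qed.

(** Interchanging the sides y = 0 and z = 0, and with them the pairs 23 and 45, inverts the
    parameter. *)
Lemma NK4_inv t : t != 0 -> exists K l, l \in hexads /\ peq (NK4 t^-1) (compose_seq (NK4 t) l) K.
Proof.
move=> t0; have ti : t^-1 != 0 by rewrite invr_eq0.
exists (mx3 (vec3 1 0 0) (vec3 0 0 t) (vec3 0 t 0)), [:: 0; 1; 4; 5; 2; 3]%N.
split; first by vm_compute.
have n1 : (1 : F) != 0 := oner_neq0 F.
split.
  rewrite det_mx3 brE !vec3E; apply: (neq0_eq (_ : - (t * t) != 0)); last by ring.
  by rewrite oppr_eq0 mulf_neq0.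
apply: ord6P; rewrite /compose_seq /= mulmx_mx3 !vec3E.
- by exists t^-1 => //; apply: row3P; rewrite !mxE /=; field.
- exists (- t^-1); first by rewrite oppr_eq0.
  by apply: row3P; rewrite !mxE /=; field.
- by exists 1 => //; apply: row3P; rewrite !mxE /=; field.
- exists (- 1); first by rewrite oppr_eq0.
  by apply: row3P; rewrite !mxE /=; field.
- by exists 1 => //; apply: row3P; rewrite !mxE /=; field.
- exists (- 1); first by rewrite oppr_eq0.
  by apply: row3P; rewrite !mxE /=; field.
Qed.

Lemma NK4_neq0 t i : t != 0 -> (i < 6)%N -> NK4 t i != 0.
Proof.
move=> t0; move: i; apply: ord6P; rewrite /= vec3_eq0 ?oppr_eq0 ?oner_eq0 /= ?andbF //.
Qed.

Lemma arr_NK4_oppr t H : arr (moved (NK4 (- t)) H) = arr (moved (NK4 t) H).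
Proof.
have [l lH e] := NK4_oppr t; rewrite -[RHS](arr_compose _ lH).
by apply: eq_imagel => i li; rewrite /moved e.
Qed.

Lemma arr_NK4_inv t H : t != 0 -> \det H != 0 -> exists K, \det K != 0 /\
  arr (moved (NK4 t^-1) H) = arr (moved (NK4 t) K).
Proof.
move=> t0 dH; have ti : t^-1 != 0 by rewrite invr_eq0.
have [K [l [lH pq]]] := NK4_inv t0.
have uH : H \in unitmx by rewrite unitmxE unitfE.
have dK : \det K != 0 by case: pq.
have uK : K \in unitmx by rewrite unitmxE unitfE.
exists (invmx K *m H); split; first by rewrite det_mulmx det_inv mulf_neq0 ?invr_eq0.
rewrite -(arr_compose (moved (NK4 t) (invmx K *m H)) lH).
rewrite -[arr (compose_seq _ l)]/(arr (moved (compose_seq (NK4 t) l) (invmx K *m H))).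
apply/esym; rewrite (moved_peq pq).
- by rewrite mulKVmx.
- by have [_ _ hl] := hexadsP lH => i li; apply: NK4_neq0 => //; exact: hl.
by rewrite det_mulmx det_inv mulf_neq0 ?invr_eq0.
Qed.

(** Multiplied by t'^2, the difference of the two values of J is a quartic in t' with roots t, -t,
    1/t, -1/t. *)
Lemma Jinv_eq t t' : t != 0 -> t' != 0 -> Jinv t = Jinv t' ->
  [\/ t' = t, t' = - t, t' = t^-1 | t' = - t^-1].
Proof.
move=> t0 t'0 e; have : (t' - t) * (t' + t) * ((t' - t^-1) * (t' + t^-1)) = 0.
  transitivity (t' ^+ 2 * (Jinv t' - Jinv t)); first by rewrite /Jinv; field; rewrite t0.
  by rewrite e subrr mulr0.
move/eqP; rewrite !mulf_eq0 => /orP[/orP[]|/orP[]];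
  rewrite ?subr_eq0 ?addr_eq0 => /eqP ->.
- exact: Or41.
- exact: Or42.
- exact: Or43.
- exact: Or44.
Qed.

Lemma Jinv_arr t t' H : t != 0 -> t' != 0 -> Jinv t = Jinv t' -> \det H != 0 ->
  exists K, \det K != 0 /\ arr (moved (NK4 t') H) = arr (moved (NK4 t) K).
Proof.
move=> t0 t'0 e dH; case: (Jinv_eq t0 t'0 e) => ->.
- by exists H.
- by exists H; rewrite arr_NK4_oppr.
- exact: arr_NK4_inv.
- by rewrite arr_NK4_oppr; exact: arr_NK4_inv.
Qed.

Lemma NK4_N2K3 t z l H : good t -> z ^+ 2 + z + 1 = 0 -> l \in hexads ->
  ~ peq (compose_seq (NK4 t) l) (N2K3 z) H.
Proof.
move=> gt zE lH pq; have /negP := no_K4_to_2K3 lH; apply; apply/allP => s sK.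
have sS : s \in synthemes by move: s sK; apply/allP; vm_compute.
have rS := relabels_syntheme lH sS; rewrite -(conc_NK4_good gt rS).
have : conc (N2K3 z) s by rewrite (conc_N2K3 zE sS).
rewrite (conc_peq pq sS).
by move: sS; rewrite mem_filter => /andP[+ _]; case: s {sK rS} => [|d [|e [|f []]]] // _;
   rewrite conc_relabels.
Qed.

(** Squaring exchanges the two primitive cube roots of unity, that is, the points 4 and 5. *)
Lemma arr_N2K3_sqr z H : z ^+ 2 + z + 1 = 0 ->
  arr (moved (N2K3 (z ^+ 2)) H) = arr (moved (N2K3 z) H).
Proof.
move=> zE; have lH : [:: 0; 1; 2; 3; 5; 4]%N \in hexads by vm_compute.
have z4 : (z ^+ 2) ^+ 2 = z.
  apply/eqP; rewrite -subr_eq0; apply/eqP.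
  by transitivity (z * (z - 1) * (z ^+ 2 + z + 1)); [ring|rewrite zE mulr0].
rewrite -[RHS](arr_compose _ lH); apply: eq_imagel; rewrite /moved /compose_seq.
by apply: ord6P; rewrite //= z4.
Qed.

Lemma cube_root_or z z' : z ^+ 2 + z + 1 = 0 -> z' ^+ 2 + z' + 1 = 0 ->
  z' = z \/ z' = z ^+ 2.
Proof.
move=> zE zE'; have : (z' - z) * (z' - z ^+ 2) = 0.
  transitivity ((z' ^+ 2 + z' + 1) + (z ^+ 2 + z + 1) * (z - 1 - z')); first by ring.
  by rewrite zE zE' mul0r addr0.
by move/eqP; rewrite mulf_eq0 !subr_eq0 => /orP[]/eqP ->; [left|right].
Qed.

End Equivalence.

(** * The classifying map [mu] and its image *)

Section Invariant.
Variable F : numClosedFieldType.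
Implicit Types (p q : nat -> 'rV[F]_3) (t z : F) (H K : 'M[F]_3) (A B : set (line F)).

Definition cube_root : F := (sqrtC (- 3%:R) - 1) / 2%:R.

Lemma cube_rootE : cube_root ^+ 2 + cube_root + 1 = 0.
Proof.
have n2 := two_neq0 F; have s3 := sqrtCK (- 3%:R : F).
transitivity ((sqrtC (- 3%:R) ^+ 2 + 3%:R) / 4%:R : F); last by rewrite s3 addNr mul0r.
by rewrite /cube_root; field; rewrite ?pnatr_eq0.
Qed.

Definition isK4 A t := good t /\ exists2 H, \det H != 0 & A = arr (moved (NK4 t) H).

Definition is2K3 A := exists2 H, \det H != 0 & A = arr (moved (N2K3 cube_root) H).

Lemma unassumingP A : unassuming A <-> (exists t, isK4 A t) \/ is2K3 A.
Proof.
split=> [uA|[[t [gt [H dH ->]]]|[H dH ->]]]; last 2 first.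
- exact: unassuming_NK4.
- exact: unassuming_N2K3 cube_rootE dH.
have [p [AE gp _ _]] := unassuming_ex uA; rewrite AE in uA.
have [l lH h] := normal_form gp uA; rewrite AE -(arr_compose p lH).
have q0 := gen_neq0 (gen_compose gp lH).
case: h => [[t [H [gt NH]]]|[z [H [zE NH]]]]; [left|right].
  by exists t; split=> //; exists H; [case: NH|exact: (arr_peq q0 NH)].
have dH : \det H != 0 by case: NH.
exists H => //; rewrite (arr_peq q0 NH).
have [->//|->] := cube_root_or cube_rootE zE.
by rewrite (arr_N2K3_sqr _ cube_rootE).
Qed.

Lemma gen_moved p H : gen p -> \det H != 0 -> gen (moved p H).
Proof. by move=> gp dH; exact: gen_peq (peq_mulmx p dH) gp. Qed.

Lemma good_gen t : good t -> gen (NK4 t).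
Proof. by case/and5P => t0 t1 _ _ _; exact: gen_NK4. Qed.

Lemma good_neq0 t : good t -> t != 0. Proof. by case/and5P. Qed.

Lemma isK4_J A t t' : isK4 A t -> isK4 A t' -> Jinv t = Jinv t'.
Proof.
move=> [gt [H dH ->]] [gt' [K dK e]].
have [l [M [lH pq]]] := arr_eq_peq_trans (gen_moved (good_gen gt) dH)
  (gen_moved (good_gen gt') dK) e (peq_mulmx _ dH) (peq_mulmx _ dK).
exact: Jinv_peq gt lH pq gt'.
Qed.

Lemma isK4_2K3 A t : isK4 A t -> ~ is2K3 A.
Proof.
move=> [gt [H dH ->]] [K dK e].
have [l [M [lH pq]]] := arr_eq_peq_trans (gen_moved (good_gen gt) dH)
  (gen_moved (gen_N2K3 cube_rootE) dK) e (peq_mulmx _ dH) (peq_mulmx _ dK).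
exact: NK4_N2K3 gt cube_rootE lH pq.
Qed.

Lemma proj_equiv_moved p A H : gen p -> \det H != 0 ->
  proj_equiv (arr (moved p H)) A <-> exists2 K, \det K != 0 & A = arr (moved p K).
Proof.
move=> gp dH; have m0 := gen_neq0 (gen_moved gp dH).
have uH : H \in unitmx by rewrite unitmxE unitfE.
split=> [/(proj_equiv_arr _ m0)[K [dK ->]]|[K dK ->]].
  exists (H *m K); first by rewrite det_mulmx mulf_neq0.
  exact: moved_peq (peq_mulmx p dH) m0 dK.
apply/(proj_equiv_arr _ m0); exists (invmx H *m K).
have dK' : \det (invmx H *m K) != 0 by rewrite det_mulmx mulf_neq0 // det_inv invr_eq0.
split=> //; rewrite (moved_peq (peq_mulmx p dH) m0 dK').
by rewrite mulKVmx.
Qed.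

Lemma isK4_equiv A B t : isK4 A t -> proj_equiv A B -> isK4 B t.
Proof.
by move=> [gt [H dH ->]] /(proj_equiv_moved _ (good_gen gt) dH)[K dK ->]; split=> //; exists K.
Qed.

Lemma is2K3_equiv A B : is2K3 A -> proj_equiv A B -> is2K3 B.
Proof.
by move=> [H dH ->] /(proj_equiv_moved _ (gen_N2K3 cube_rootE) dH)[K dK ->]; exists K.
Qed.

Lemma isK4_proj_equiv A B t t' : isK4 A t -> isK4 B t' -> Jinv t = Jinv t' ->
  proj_equiv A B.
Proof.
move=> [gt [H dH ->]] [gt' [K dK ->]] e.
have [M [dM ->]] := Jinv_arr (good_neq0 gt) (good_neq0 gt') e dK.
by apply/(proj_equiv_moved _ (good_gen gt) dH); exists M.
Qed.

Lemma is2K3_proj_equiv A B : is2K3 A -> is2K3 B -> proj_equiv A B.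
Proof.
move=> [H dH ->] [K dK ->].
by apply/(proj_equiv_moved _ (gen_N2K3 cube_rootE) dH); exists K.
Qed.

Definition pt3 (a b c : F) : proj F 2 := pt (vec3 a b c).

(** The chosen parameter is immaterial, since [isK4_J] shows that [Jinv] depends only on the
    arrangement. *)
Definition mu A : proj F 2 :=
  if pselect (exists t, isK4 A t) is left h then pt3 (Jinv (projT1 (cid h))) 1 0
  else pt3 0 0 1.

Lemma muK4 A t : isK4 A t -> mu A = pt3 (Jinv t) 1 0.
Proof.
move=> At; rewrite /mu; case: pselect => [h|[]]; last by exists t.
by rewrite (isK4_J (projT2 (cid h)) At).
Qed.

Lemma mu2K3 A : is2K3 A -> mu A = pt3 0 0 1.
Proof.
move=> AQ; rewrite /mu; case: pselect => // -[t At].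
by case: (isK4_2K3 At AQ).
Qed.

Lemma line_vec_neq0 (a : F) : vec3 a 1 0 != 0 :> 'rV[F]_3.
Proof. by rewrite vec3_eq0 oner_eq0 /= andbF. Qed.

Lemma e3_neq0 : vec3 0 0 1 != 0 :> 'rV[F]_3.
Proof. by rewrite vec3_eq0 oner_eq0 !andbF. Qed.

Lemma pt_line_inj (a b : F) : pt3 a 1 0 = pt3 b 1 0 -> a = b.
Proof.
move=> /(pt_eq (n := 2) (line_vec_neq0 a) (line_vec_neq0 b))[c _ /rowP e].
have := e o1; have := e o0; rewrite !mxE /= mulr1 => -> <-.
by rewrite mul1r.
Qed.

Lemma pt_line_e3 (a : F) : pt3 a 1 0 <> pt3 0 0 1.
Proof.
move=> /(pt_eq (n := 2) (line_vec_neq0 a) e3_neq0)[c _ /rowP e].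
by have /eqP := e o1; rewrite !mxE /= mulr0 oner_eq0.
Qed.

Lemma mu_proj_equiv A B : unassuming A -> unassuming B ->
  (mu A = mu B <-> proj_equiv A B).
Proof.
move=> /unassumingP[[t At]|AQ] /unassumingP[[t' Bt]|BQ].
- rewrite (muK4 At) (muK4 Bt); split=> [/pt_line_inj e|e].
    exact: isK4_proj_equiv At Bt e.
  by rewrite (isK4_J (isK4_equiv At e) Bt).
- rewrite (muK4 At) (mu2K3 BQ); split=> [/pt_line_e3 //|e].
  by case: (isK4_2K3 (isK4_equiv At e) BQ).
- rewrite (mu2K3 AQ) (muK4 Bt); split=> [/esym/pt_line_e3 //|e].
  by case: (isK4_2K3 Bt (is2K3_equiv AQ e)).
- rewrite (mu2K3 AQ) (mu2K3 BQ); split=> // _.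
  exact: is2K3_proj_equiv.
Qed.

Definition badJ : {poly F} :=
  ('X - 2%:R%:P) * ('X + 2%:R%:P) * ('X - 18%:R%:P).

Lemma badJE (j : F) : badJ.[j] = (j - 2%:R) * (j + 2%:R) * (j - 18%:R).
Proof. by rewrite /badJ !hornerE. Qed.

Lemma good_badJ t : t != 0 -> good t = (badJ.[Jinv t] != 0).
Proof.
move=> t0; rewrite badJE /good t0 /=.
have -> : Jinv t - 2%:R = (t ^+ 2 - 1) ^+ 2 / t ^+ 2 by rewrite /Jinv; field.
have -> : Jinv t + 2%:R = (t ^+ 2 + 1) ^+ 2 / t ^+ 2 by rewrite /Jinv; field.
have -> : Jinv t - 18%:R = (t ^+ 2 + 4%:R * t - 1) * (t ^+ 2 - 4%:R * t - 1) / t ^+ 2.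
  by rewrite /Jinv; field.
rewrite !mulf_eq0 !invr_eq0 !expf_eq0 (negPf t0) /= !orbF.
by rewrite !negb_or -!andbA; do 2![case: (_ != 0)].
Qed.

(** The quadratic u + 1/u = j has the two mutually inverse roots [u] and [w]; a square root of [u]
    is the parameter. *)
Lemma Jinv_surj (j : F) : exists2 t, t != 0 & Jinv t = j.
Proof.
have n2 := two_neq0 F.
pose s := sqrtC (j ^+ 2 - 4%:R); have sE : s ^+ 2 = j ^+ 2 - 4%:R by rewrite sqrtCK.
pose u := (j + s) / 2%:R; pose w := (j - s) / 2%:R.
have uw : u * w = 1.
  transitivity ((j ^+ 2 - s ^+ 2) / 4%:R); first by rewrite /u /w; field; rewrite ?pnatr_eq0.
  by rewrite sE opprB addrC subrK divff // pnatr_eq0.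
have u0 : u != 0.
  by apply: contra_eq_neq uw => ->; rewrite mul0r eq_sym oner_eq0.
have tE := sqrtCK u; exists (sqrtC u); first by rewrite -sqrf_eq0 tE.
rewrite /Jinv exprVn tE (_ : u^-1 = w); first by rewrite /u /w; field.
by apply: (mulfI u0); rewrite uw divff.
Qed.

Definition moduli : set (proj F 2) :=
  [set pt3 j 1 0 | j in [set j | badJ.[j] != 0]] `|` [set pt3 0 0 1].

Lemma det1_neq0 : \det (1%:M : 'M[F]_3) != 0.
Proof. by rewrite det1 oner_eq0. Qed.

Lemma isK4_std t : good t -> isK4 (arr (moved (NK4 t) 1%:M)) t.
Proof. by move=> gt; split=> //; exists 1%:M; rewrite ?det1_neq0. Qed.

Lemma is2K3_std : is2K3 (arr (moved (N2K3 cube_root) 1%:M)).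
Proof. by exists 1%:M; rewrite ?det1_neq0. Qed.

Lemma mu_image : mu @` @unassuming F = moduli.
Proof.
apply/seteqP; split=> [_ [A /unassumingP[[t At]|AQ] <-]|_ [[j jb <-]|->]].
- left; rewrite (muK4 At); exists (Jinv t) => //=.
  by rewrite -good_badJ; [case: At|apply: good_neq0; case: At].
- by right; rewrite (mu2K3 AQ).
- have [t t0 tE] := Jinv_surj j; have gt : good t by rewrite good_badJ // tE.
  exists (arr (moved (NK4 t) 1%:M)).
    by apply/unassumingP; left; exists t; exact: isK4_std.
  by rewrite (muK4 (isK4_std gt)) tE.
- exists (arr (moved (N2K3 cube_root) 1%:M)).
    by apply/unassumingP; right; exact: is2K3_std.
  by rewrite (mu2K3 is2K3_std).
Qed.

(* The operator acts on the one-parameter family by J |-> J^2 - 2 and fixes the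
   isolated class. *)
Lemma unassuming_Lambda23 A : unassuming A ->
  (forall t, isK4 A t -> badJ.[Jinv t ^+ 2 - 2%:R] != 0) -> unassuming (Lambda23 A).
Proof.
move=> /unassumingP[[t At]|[H dH ->]] h; last first.
  have [K [dK ->]] := Lambda23_N2K3 cube_rootE dH.
  exact: unassuming_N2K3 cube_rootE dK.
have := h t At; case: At => gt [H dH ->] b.
have [K [dK ->]] := Lambda23_NK4 gt dH; have t0 := good_neq0 gt.
apply: unassuming_NK4 => //; rewrite good_badJ ?expf_neq0 ?invr_eq0 //.
by rewrite (_ : Jinv (t^-1 ^+ 2) = Jinv t ^+ 2 - 2%:R) // /Jinv; field.
Qed.

End Invariant.

(** * Homogeneous polynomials and their restriction to curves *)

Section Homogeneous.
Variables (F : fieldType) (n : nat).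
Implicit Types (f : {mpoly F[n]}) (v : 'rV[F]_n) (c : F).

Definition ev f v : F := f.@[fun j => v 0 j].

Lemma ev_homogZ f d c v : f \is d.-homog -> ev f (c *: v) = c ^+ d * ev f v.
Proof.
move=> /dhomogP fd; rewrite /ev !mevalE mulr_sumr; apply: eq_big_seq => m /fd /= md.
rewrite mulrCA; congr (_ * _); rewrite -md mdegE -prodrXr -big_split.
by apply: eq_bigr => i _; rewrite mxE exprMn.
Qed.

Lemma polymap_homogZ m (f : 'I_m.+1 -> {mpoly F[n]}) d c v :
  (forall i, f i \is d.-homog) -> polymap f (c *: v) = c ^+ d *: polymap f v.
Proof. by move=> fd; apply/rowP => i; rewrite !mxE -/(ev _ _) (ev_homogZ c v (fd i)). Qed.

Lemma mpoly_along_curve (f : {mpoly F[n]}) (E : 'I_n -> {poly F}) :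
  exists P : {poly F}, forall t, P.[t] = f.@[fun j => (E j).[t]].
Proof.
exists (mmap (@polyC F) E f) => t; rewrite mevalE /mmap horner_sum.
apply: eq_bigr => m _; rewrite hornerM hornerC; congr (_ * _).
by rewrite /mmap1 horner_prod; apply: eq_bigr => i _; rewrite horner_exp.
Qed.

End Homogeneous.

(** * Closed sets given by finitely many forms *)

Section Zariski.
Variables (F : fieldType) (n : nat).
Implicit Types (f : {mpoly F[n.+1]}) (v : 'rV[F]_n.+1).

Lemma ev_hcoord f d v : f \is d.-homog -> v != 0 ->
  (ev f (hcoord (pt v)) = 0) <-> (ev f v = 0).
Proof.
move=> fd v0; have [c c0 ->] := hcoord_pt v0; rewrite (ev_homogZ _ _ fd).
split=> [/eqP|->]; last by rewrite mulr0.
by rewrite mulf_eq0 expf_eq0 (negPf c0) andbF => /eqP.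
Qed.

Definition zset (s : seq {mpoly F[n.+1]}) : set (proj F n) :=
  [set p | forall f, f \in s -> ev f (hcoord p) = 0].

Lemma zclosed_zset s : (forall f, f \in s -> exists d, f \is d.-homog) -> zclosed (zset s).
Proof. by move=> sh; exists [set f | f \in s]. Qed.

Lemma zset_pt s v : (forall f, f \in s -> exists d, f \is d.-homog) -> v != 0 ->
  zset s (pt v) <-> forall f, f \in s -> ev f v = 0.
Proof.
move=> sh v0; split=> h f fs; have [d fd] := sh f fs.
  by apply/(ev_hcoord fd v0)/h.
by apply/(ev_hcoord fd v0)/h.
Qed.

Lemma zirreducible1 (p : proj F n) : zirreducible [set p].
Proof.
split; first by exists p.
move=> Z W _ _ h; have [] := h p erefl; [left|right]; by move=> _ ->.
Qed.

End Zariski.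

(** * The line z = 0 and the point [0 : 0 : 1]: closure, components and isomorphism with the
    projective line *)

Section Plane.
Variable F : numClosedFieldType.
Implicit Types (f : {mpoly F[3]}) (v : 'rV[F]_3).

Lemma infinite_roots0 (p : {poly F}) : (forall k : nat, p.[k%:R] = 0) -> p = 0.
Proof.
move=> h; apply/eqP; apply: contraT => p0.
have := @max_poly_roots _ p [seq k%:R | k <- iota 0 (size p)] p0.
rewrite size_map size_iota ltnn => -> //.
  by apply/allP => _ /mapP[k _ ->]; apply/eqP.
by rewrite map_inj_uniq ?iota_uniq //; exact: mulrIn (oner_neq0 F).
Qed.

(** The product [p * b] vanishes at every natural number, hence identically. *)
Lemma generic_roots0 (p b : {poly F}) : b != 0 -> (forall j, b.[j] != 0 -> p.[j] = 0) ->
  p = 0.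
Proof.
move=> b0 h; have /eqP : p * b = 0.
  apply: infinite_roots0 => k; rewrite hornerM.
  have [->|bk] := eqVneq b.[k%:R] 0; first by rewrite mulr0.
  by rewrite h // mul0r.
by rewrite mulf_eq0 (negPf b0) orbF => /eqP.
Qed.

Lemma curve3 f (a b c : {poly F}) :
  exists P : {poly F}, forall t, P.[t] = ev f (vec3 a.[t] b.[t] c.[t]).
Proof.
have [P PE] := mpoly_along_curve f (fun j => [:: a; b; c]`_j).
exists P => t; rewrite PE /ev; apply: meval_eq; apply: ord3P; by rewrite mxE.
Qed.

(** Infinitely many zeros on the affine part settle y != 0 by homogeneity; y = 0 is then reached by
    fixing x and letting y vary. *)
Lemma line_vanish f d b : f \is d.-homog -> b != 0 ->
  (forall j, b.[j] != 0 -> ev f (vec3 j 1 0) = 0) -> forall x y, ev f (vec3 x y 0) = 0.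
Proof.
move=> fd b0 h; have [P PE] := curve3 f 'X 1 0.
have P0 : P = 0.
  by apply: (generic_roots0 b0) => j bj; rewrite PE hornerX hornerC horner0 h.
have f1 j : ev f (vec3 j 1 0) = 0.
  by have := PE j; rewrite hornerX hornerC horner0 => <-; rewrite P0 horner0.
have fy x y : y != 0 -> ev f (vec3 x y 0) = 0.
  move=> y0; rewrite (_ : vec3 x y 0 = y *: vec3 (x / y) 1 0).
    by rewrite (ev_homogZ _ _ fd) f1 mulr0.
  by rewrite scale_vec3 mulrCA divff // !mulr1 mulr0.
move=> x y; have [Q QE] := curve3 f x%:P 'X 0.
have Q0 : Q = 0.
  have X0 : 'X != 0 :> {poly F} by rewrite polyX_eq0.
  apply: (generic_roots0 X0) => j; rewrite hornerX => j0.
  by rewrite QE hornerX hornerC horner0 fy.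
by have := QE y; rewrite hornerX hornerC horner0 => <-; rewrite Q0 horner0.
Qed.

Definition line0 : set (proj F 2) := zset [:: 'X_o2].
Definition point0 : set (proj F 2) := [set pt3 0 0 1].

Lemma homogX (i : 'I_3) : ('X_i : {mpoly F[3]}) \is 1.-homog.
Proof. by rewrite dhomogX /= mdeg1. Qed.

Lemma line0P v : v != 0 -> line0 (pt v) <-> v 0 o2 = 0.
Proof.
move=> v0; rewrite /line0 zset_pt // => [|f]; last first.
  by rewrite inE => /eqP ->; exists 1%N; exact: homogX.
split=> [/(_ 'X_o2)|e f]; first by rewrite inE eqxx /ev mevalXU => /(_ isT).
by rewrite inE => /eqP ->; rewrite /ev mevalXU.
Qed.

Lemma line0_pt3 x y : vec3 x y 0 != 0 :> 'rV[F]_3 -> line0 (pt3 x y 0).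
Proof. by move=> v0; apply/line0P; rewrite ?vec3E. Qed.

Lemma line0_not_point0 : ~ line0 (pt3 0 0 1).
Proof. by move/(line0P (e3_neq0 F)); rewrite vec3E => /eqP; rewrite oner_eq0. Qed.

Lemma zclosed_line0 : zclosed line0.
Proof. by apply: zclosed_zset => f; rewrite inE => /eqP ->; exists 1%N; exact: homogX. Qed.

Lemma xy_homog (f : {mpoly F[3]}) : f \in [:: 'X_o0; 'X_o1] -> exists d, f \is d.-homog.
Proof. by rewrite !inE => /orP[]/eqP ->; exists 1%N; exact: homogX. Qed.

Lemma point0E : point0 = zset [:: 'X_o0; 'X_o1].
Proof.
apply/seteqP; split=> [_ ->|p].
  apply/(zset_pt xy_homog (e3_neq0 F)) => f.
  by rewrite !inE => /orP[]/eqP ->; rewrite /ev mevalXU vec3E.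
have [v v0 ->] := ptP p => /(zset_pt xy_homog v0) h.
have x0 : v 0 o0 = 0.
  by have := h 'X_o0; rewrite !inE eqxx /ev mevalXU => /(_ isT).
have y0 : v 0 o1 = 0.
  by have := h 'X_o1; rewrite !inE eqxx orbT /ev mevalXU => /(_ isT).
apply/(pt_eq (n := 2) v0 (e3_neq0 F)); exists (v 0 o2).
  by apply: contraNneq v0 => z0; apply/eqP/row3P; rewrite mxE.
by apply: row3P; rewrite !mxE /= ?mulr0 ?mulr1.
Qed.

Lemma zclosed_point0 : zclosed point0.
Proof. by rewrite point0E; apply: zclosed_zset; exact: xy_homog. Qed.

Definition line0U_point0_eqns : seq {mpoly F[3]} := [:: 'X_o0 * 'X_o2; 'X_o1 * 'X_o2].

Lemma line0U_point0_eqns_homog f : f \in line0U_point0_eqns -> exists d, f \is d.-homog.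
Proof.
by rewrite !inE => /orP[]/eqP ->; exists (1 + 1)%N; apply: dhomogM; exact: homogX.
Qed.

Lemma line0U_point0 : line0 `|` point0 = zset line0U_point0_eqns.
Proof.
rewrite point0E; apply/seteqP; split=> p; have [v v0 ->] := ptP p.
  case=> [/(line0P v0) z0|/(zset_pt xy_homog v0) h]; apply/(zset_pt line0U_point0_eqns_homog v0) => f;
    rewrite !inE => /orP[]/eqP ->; rewrite /ev mevalM !mevalXU ?z0 ?mulr0 //.
    by have := h 'X_o0; rewrite !inE eqxx /ev mevalXU => -> //; rewrite mul0r.
  by have := h 'X_o1; rewrite !inE eqxx orbT /ev mevalXU => -> //; rewrite mul0r.
move=> /(zset_pt line0U_point0_eqns_homog v0) h.
have := h ('X_o0 * 'X_o2); rewrite !inE eqxx /ev mevalM !mevalXU => /(_ isT) hx.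
have := h ('X_o1 * 'X_o2); rewrite !inE eqxx orbT /ev mevalM !mevalXU => /(_ isT) hy.
have [z0|z0] := eqVneq (v 0 o2) 0; first by left; apply/line0P.
right; apply/(zset_pt xy_homog v0) => f.
rewrite !inE => /orP[]/eqP ->; rewrite /ev mevalXU; apply: (mulIf z0);
  by rewrite mul0r.
Qed.

Lemma zclosed_line0U_point0 : zclosed (line0 `|` point0).
Proof. by rewrite line0U_point0; apply: zclosed_zset; exact: line0U_point0_eqns_homog. Qed.

(** A general [b] allows further values of J to be removed, as the generic locus requires. *)
Definition moduli_off (b : {poly F}) : set (proj F 2) :=
  [set pt3 j 1 0 | j in [set j | b.[j] != 0]] `|` point0.

Lemma zclosure_moduli_off b : b != 0 -> zclosure (moduli_off b) = line0 `|` point0.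
Proof.
move=> b0; apply/seteqP; split=> [p h|p pL Z [[S Sh ->] sub] f Sf].
  apply: h; split; first exact: zclosed_line0U_point0.
  move=> _ [[j _ <-]|->]; last by right.
  by left; apply: line0_pt3; exact: line_vec_neq0.
have [d fd] := Sh f Sf; case: pL => [|->]; last by apply: sub => //; right.
have [v v0 ->] := ptP p => /(line0P v0) z0; apply/(ev_hcoord fd v0).
rewrite -(vec3_eta v) z0; apply: (line_vanish fd b0) => j bj.
apply/(ev_hcoord fd (line_vec_neq0 j)); apply: sub => //.
by left; exists j.
Qed.

(** If neither closed set contains the line, each has an equation that is nonzero somewhere on it.
    Restricted to the points (k, 1, 0), the product of these two forms vanishes for all natural k,
    so one of them vanishes on the line. *)
Lemma zirreducible_line0 : zirreducible line0.
Proof.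
split; first by exists (pt3 0 1 0); apply: line0_pt3; exact: line_vec_neq0.
have pick (S : set {mpoly F[3]}) :
    ~ line0 `<=` [set p | forall f, S f -> f.@[fun j => hcoord p 0 j] = 0] ->
    exists p f, [/\ line0 p, S f & ev f (hcoord p) <> 0].
  move=> nS; apply: contrapT => h; apply: nS => p pL f Sf; apply: contrapT => fp.
  by apply: h; exists p, f.
move=> Z W [S Sh ->] [T Th ->] sub; apply: contrapT => /not_orP[].
move=> /pick[p [f [pL Sf fp]]] /pick[q [g [qL Tg gq]]].
have [d fd] := Sh f Sf; have [e ge] := Th g Tg.
have [P PE] := curve3 f 'X 1 0; have [Q QE] := curve3 g 'X 1 0.
have PQ : P * Q = 0.
  apply: infinite_roots0 => k; rewrite hornerM PE QE !(hornerX, hornerC, horner0).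
  have [] := sub (pt3 k%:R 1 0) (line0_pt3 (line_vec_neq0 _)) => h.
    by rewrite (iffLR (ev_hcoord fd (line_vec_neq0 _)) (h f Sf)) mul0r.
  by rewrite (iffLR (ev_hcoord ge (line_vec_neq0 _)) (h g Tg)) mulr0.
have vanish (r : {mpoly F[3]}) d' (U : {poly F}) (s : proj F 2) : r \is d'.-homog ->
    (forall t, U.[t] = ev r (vec3 ('X).[t] (1 : {poly F}).[t] (0 : {poly F}).[t])) ->
    U = 0 -> line0 s -> ev r (hcoord s) = 0.
  move=> rd UE U0; have [v v0 ->] := ptP s => /(line0P v0) z0; apply/(ev_hcoord rd v0).
  rewrite -(vec3_eta v) z0; apply: (line_vanish rd (oner_neq0 _)) => j _.
  by have := UE j; rewrite U0 horner0 hornerX hornerC => <-.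
move/eqP: PQ; rewrite mulf_eq0 => /orP[]/eqP e0.
  by apply: fp; exact: vanish fd PE e0 pL.
by apply: gq; exact: vanish ge QE e0 qL.
Qed.

(** An irreducible subset lies in one of the two closed pieces, and neither piece contains the
    other. *)
Lemma components C :
  irreducible_component (line0 `|` point0) C <-> C = line0 \/ C = point0.
Proof.
have le : line0 (pt3 0 1 0) by apply: line0_pt3; exact: line_vec_neq0.
split=> [[Ci Cs Cm]|[->|->]].
- have [sub|sub] := Ci.2 _ _ zclosed_line0 zclosed_point0 Cs.
    left; apply/esym; apply: (Cm _ zirreducible_line0 _ sub); exact: subsetUl.
  right; apply/esym; apply: (Cm _ (zirreducible1 _) _ sub); exact: subsetUr.
- split; [exact: zirreducible_line0|exact: subsetUl|].
  move=> D Di Ds sub; apply/seteqP; split=> //.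
  have [//|Dp] := Di.2 _ _ zclosed_line0 zclosed_point0 Ds.
  have : point0 (pt3 0 1 0) by apply/Dp/sub.
  by move=> e; case: line0_not_point0; rewrite -e.
- split; [exact: zirreducible1|exact: subsetUr|].
  move=> D Di Ds sub; apply/seteqP; split=> //.
  have [Dl|//] := Di.2 _ _ zclosed_line0 zclosed_point0 Ds.
  by case: line0_not_point0; apply/Dl/sub.
Qed.

Lemma line0_neq_point0 : line0 <> point0.
Proof. by move=> e; apply: line0_not_point0; rewrite e. Qed.

Definition vec2 (a b : F) : 'rV[F]_2 := \row_j [:: a; b]`_j.

Definition to_P1 (p : proj F 2) : proj F 1 := pt (vec2 (hcoord p 0 o0) (hcoord p 0 o1)).
Definition of_P1 (p : proj F 1) : proj F 2 := pt3 (hcoord p 0 0) (hcoord p 0 1) 0.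

Lemma vec2_eta (v : 'rV[F]_2) : vec2 (v 0 0) (v 0 1) = v.
Proof. by apply/rowP => -[[|[|//]] i]; rewrite mxE; congr (v 0 _); apply: val_inj. Qed.

Lemma vec2_neq0 v : v != 0 -> v 0 o2 = 0 -> vec2 (v 0 o0) (v 0 o1) != 0.
Proof.
move=> v0 z0; apply: contraNneq v0 => /rowP e; apply/eqP/row3P; rewrite mxE //.
  by have := e 0; rewrite !mxE.
by have := e 1; rewrite !mxE.
Qed.

Lemma vec30_neq0 (v : 'rV[F]_2) : v != 0 -> vec3 (v 0 0) (v 0 1) 0 != 0.
Proof.
rewrite vec3_eq0 eqxx andbT; apply: contraNN => /andP[/eqP e0 /eqP e1].
by rewrite -(vec2_eta v) e0 e1; apply/eqP/rowP => -[[|[|//]] i]; rewrite !mxE.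
Qed.

Lemma line0_iso : variety_isomorphic line0 [set: proj F 1].
Proof.
have l2 p : line0 p -> hcoord p 0 o2 = 0.
  by move=> pL; apply/(line0P (hcoord_neq0 p)); rewrite pt_hcoord.
exists to_P1, of_P1; split.
- move=> x xL; exists 1%N, (fun i : 'I_2 => if i == 0 then 'X_o0 else 'X_o1).
  have E v : polymap (fun i : 'I_2 => if i == 0 then 'X_o0 else 'X_o1) v =
      vec2 (v 0 o0) (v 0 o1).
    by apply/rowP => -[[|[|//]] i]; rewrite !mxE /= mevalXU.
  split=> [i||y yL]; first by case: ifP => _; exact: homogX.
    by rewrite E; apply: vec2_neq0; [exact: hcoord_neq0|exact: l2].
  by rewrite E => y0; rewrite /to_P1 val_pt.
- move=> x _; exists 1%N, (fun i : 'I_3 => [:: 'X_0; 'X_1; 0]`_i).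
  have E (v : 'rV[F]_2) : polymap (fun i : 'I_3 => [:: 'X_0; 'X_1; 0]`_i) v =
      vec3 (v 0 0) (v 0 1) 0.
    by apply: row3P; rewrite !mxE /= ?mevalXU ?meval0.
  split=> [||y _].
  + by apply: ord3P => /=; rewrite ?dhomogX /= ?mdeg1 //; exact: dhomog0.
  + by rewrite E; apply: vec30_neq0; exact: hcoord_neq0.
  + by rewrite E => y0; rewrite /of_P1 val_pt.
- move=> p pL; split=> //; rewrite -[RHS]pt_hcoord /of_P1 /to_P1.
  have h0 := hcoord_neq0 p; have v0 := vec2_neq0 h0 (l2 p pL).
  have [c c0 ->] := hcoord_pt v0.
  rewrite /pt3 !mxE /=.
  have -> : vec3 (c * hcoord p 0 o0) (c * hcoord p 0 o1) 0 = c *: hcoord p.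
    by rewrite -[in RHS](vec3_eta (hcoord p)) scale_vec3 (l2 p pL) mulr0.
  exact: (ptZ (n := 2)).
- move=> p _; have h0 := hcoord_neq0 p; have v0 := vec30_neq0 h0.
  split; first exact: line0_pt3.
  rewrite -[RHS]pt_hcoord /of_P1 /to_P1 /pt3; have [c c0 ->] := hcoord_pt v0.
  rewrite !mxE /=; have -> : vec2 (c * hcoord p 0 0) (c * hcoord p 0 1) = c *: hcoord p.
    by rewrite -[in RHS](vec2_eta (hcoord p)); apply/rowP => -[[|[|//]] i]; rewrite !mxE.
  exact: ptZ.
Qed.

End Plane.

(** * Regularity of [mu] as a function of the equations of the lines *)

Section Equations.
Variable F : numClosedFieldType.
Implicit Types (p q : nat -> 'rV[F]_3) (x y : 'rV[F]_(6 * 3)) (t : F) (l : seq nat).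

(** Rows are indexed by natural numbers, as in the configurations above; from 6 on, [inord] repeats
    row 0. *)
Definition rowsof x (i : nat) : 'rV[F]_3 := row (inord i : 'I_6) (vec_mx x).

Definition nonzero_rows x := [seq i <- iota 0 6 | rowsof x i != 0].

Lemma mem_nonzero_rows x i : (i \in nonzero_rows x) = (i < 6)%N && (rowsof x i != 0).
Proof. by rewrite mem_filter mem_iota andbC. Qed.

Lemma arrangement_rowsE x : arrangement_of (vec_mx x) =
  [set ln (rowsof x i) | i in [set` nonzero_rows x]].
Proof.
apply/seteqP; split=> [l [i i0 il]|_ [i + <-]].
  have rE : rowsof x i = row i (vec_mx x) by rewrite /rowsof inord_val.
  exists (val i); first by rewrite /= mem_nonzero_rows rE i0 ltn_ord.
  rewrite rE; have [v v0 lE] := lnP l; rewrite lE; apply/esym/(ln_eq v0 i0).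
  have [|c vE] := @cross_prop _ v _ i0.
    apply: ker_dot_sub => //; apply/subvP => z; rewrite !mem_ker_dot => zv.
    by apply/eqP/mul_tr_eq0/il; rewrite lE val_ln // mem_ker_dot.
  apply/(pt_eq (n := 2) v0 i0); exists c => //.
  by apply: contraNneq v0 => c0; rewrite vE c0 scale0r.
rewrite /= mem_nonzero_rows => /andP[li r0]; exists (inord i) => //.
move=> v; rewrite val_ln // mem_ker_dot => /eqP e; exact/mul_tr_eq0.
Qed.

Lemma arrangement_rows x : (forall i, (i < 6)%N -> rowsof x i != 0) ->
  arrangement_of (vec_mx x) = arr (rowsof x).
Proof.
move=> r0; rewrite arrangement_rowsE; apply/seteqP; split=> [_ [i + <-]|_ [i li <-]].
  by rewrite /= mem_nonzero_rows => /andP[li _]; exists i.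
by exists i => //=; rewrite mem_nonzero_rows li r0.
Qed.

Lemma image_seq_le (T : eqType) U (f : T -> U) (s : seq T) n :
  (f @` [set` s] #= `I_n)%card -> (n <= size s)%N.
Proof.
case: s => [|x0 s'].
  rewrite set_nil image_set0 card_eq_sym card_eq0 => /eqP e.
  by case: n e => // n /seteqP[/(_ 0%N (ltn0Sn _))].
move: (x0 :: s') => s.
have -> : f @` [set` s] = (fun i => f (nth x0 s i)) @` `I_(size s).
  apply/seteqP; split=> [_ [i si <-]|_ [i /= is_ <-]].
    by exists (index i s); rewrite /= ?index_mem ?nth_index.
  by exists (nth x0 s i) => //=; rewrite mem_nth.
by move=> e; rewrite -card_le_II -(card_le_eql e); exact: card_image_le.
Qed.

(** Six distinct lines need six nonzero rows, and no two of these rows may define the same line. *)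
Lemma unassuming_rows x : unassuming (arrangement_of (vec_mx x)) ->
  gen (rowsof x) /\ arrangement_of (vec_mx x) = arr (rowsof x).
Proof.
move=> u; have r0 i : (i < 6)%N -> rowsof x i != 0.
  case: (u) => c _ _ _ _; rewrite arrangement_rowsE in c.
  have := image_seq_le c; rewrite size_filter => h.
  have /allP a : all (fun i => rowsof x i != 0) (iota 0 6).
    by rewrite all_count eqn_leq count_size.
  by move=> li; apply: a; rewrite mem_iota.
have E := arrangement_rows r0; split=> //.
rewrite E in u; case: u => c [_ nk] _ _ _; apply: arr_gen => // i j li lj e.
apply/eqP; apply: contraT => ij.
(* If the rows i and j gave the same line, the five remaining rows would already give the whole
   arrangement. *)
pose others := rem j (iota 0 6).
have mo k : (k \in others) = (k != j) && (k < 6)%N.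
  by rewrite mem_rem_uniq ?iota_uniq // inE mem_iota.
have E' : arr (rowsof x) = [set ln (rowsof x k) | k in [set` others]].
  apply/seteqP; split=> [_ [k lk <-]|_ [k + <-]]; last first.
    by rewrite /= mo => /andP[_ lk]; exists k.
  have [->|kj] := eqVneq k j.
    by exists i; rewrite // /= mo ij li.
  by exists k; rewrite // /= mo kj lk.
rewrite E' in c; have := image_seq_le c.
by rewrite size_rem ?mem_iota.
Qed.

Definition coord_poly (i : nat) (c : 'I_3) : {mpoly F[6 * 3]} :=
  'X_(mxvec_index (inord i : 'I_6) c).

Lemma ev_coord x i c : ev (coord_poly i c) x = rowsof x i 0 c.
Proof. by rewrite /ev /coord_poly mevalXU !mxE. Qed.

Definition br_poly i j k : {mpoly F[6 * 3]} :=
  coord_poly i o0 * (coord_poly j o1 * coord_poly k o2 - coord_poly j o2 * coord_poly k o1) +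
  coord_poly i o1 * (coord_poly j o2 * coord_poly k o0 - coord_poly j o0 * coord_poly k o2) +
  coord_poly i o2 * (coord_poly j o0 * coord_poly k o1 - coord_poly j o1 * coord_poly k o0).

Lemma evD (f g : {mpoly F[6 * 3]}) x : ev (f + g) x = ev f x + ev g x.
Proof. exact: mevalD. Qed.
Lemma evB (f g : {mpoly F[6 * 3]}) x : ev (f - g) x = ev f x - ev g x.
Proof. exact: mevalB. Qed.
Lemma evM (f g : {mpoly F[6 * 3]}) x : ev (f * g) x = ev f x * ev g x.
Proof. exact: mevalM. Qed.

Lemma ev_br x i j k : ev (br_poly i j k) x = br (rowsof x i) (rowsof x j) (rowsof x k).
Proof. by rewrite brE /br_poly !(evB, evD, evM) !ev_coord. Qed.

Definition conc_poly l (s : seq (nat * nat)) : {mpoly F[6 * 3]} :=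
  let i := fun k => nth 0%N l (nth (0, 0)%N s k).1 in
  let j := fun k => nth 0%N l (nth (0, 0)%N s k).2 in
  br_poly (i 0%N) (j 0%N) (i 2%N) * br_poly (i 1%N) (j 1%N) (j 2%N) -
  br_poly (i 0%N) (j 0%N) (j 2%N) * br_poly (i 1%N) (j 1%N) (i 2%N).

Lemma ev_conc x l s : (ev (conc_poly l s) x == 0) = conc (compose_seq (rowsof x) l) s.
Proof. by rewrite /conc /join br_cross3 /conc_poly !(evB, evM) !ev_br. Qed.

(** The locus where this polynomial is nonzero is the chart on which, for unassuming equations in
    the order [l], the concurrent synthemes are exactly those of [S] when [S] has six members. *)
Definition off_poly l (S : seq (seq (nat * nat))) : {mpoly F[6 * 3]} :=
  \prod_(s <- synthemes | s \notin S) conc_poly l s.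

Lemma ev_off x l S : (ev (off_poly l S) x != 0) =
  all (fun s => (s \in S) || ~~ conc (compose_seq (rowsof x) l) s) synthemes.
Proof.
rewrite /ev /off_poly rmorph_prod prodf_seq_neq0; apply: eq_all => s.
by have := ev_conc x l s; rewrite /ev => <-; case: (s \in S).
Qed.

Definition I1_poly l : {mpoly F[6 * 3]} :=
  br_poly (nth 0 l 0)%N (nth 0 l 2)%N (nth 0 l 4)%N *
  br_poly (nth 0 l 1)%N (nth 0 l 3)%N (nth 0 l 5)%N.
Definition I2_poly l : {mpoly F[6 * 3]} :=
  br_poly (nth 0 l 0)%N (nth 0 l 1)%N (nth 0 l 2)%N *
  br_poly (nth 0 l 3)%N (nth 0 l 4)%N (nth 0 l 5)%N.

Lemma ev_I1 x l : ev (I1_poly l) x = I1 (compose_seq (rowsof x) l).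
Proof. by rewrite /I1_poly evM !ev_br. Qed.
Lemma ev_I2 x l : ev (I2_poly l) x = I2 (compose_seq (rowsof x) l).
Proof. by rewrite /I2_poly evM !ev_br. Qed.

(** All concurrent synthemes lie in [S], and both lists have six members. *)
Lemma concurrent_of_off q (S : seq (seq (nat * nat))) : size (concurrent q) = 6%N ->
  size S = 6%N -> all (fun s => (s \in S) || ~~ conc q s) synthemes ->
  concurrent q =i S.
Proof.
move=> s6 sS /allP h; have uC : uniq (concurrent q).
  by do 2!apply: filter_uniq; vm_compute.
have sub : {subset concurrent q <= S}.
  move=> s; rewrite mem_filter => /andP[sc sy].
  by have := h s sy; rewrite sc orbF.
have le : (size S <= size (concurrent q))%N by rewrite s6 sS.
by have [] := uniq_min_size uC sub le.
Qed.

Lemma compose_id p q H : peq p q H -> peq (compose_seq p [:: 0; 1; 2; 3; 4; 5]%N) q H.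
Proof.
by move=> [dH pq]; split=> // i li; have := pq i li; move: i li; apply: ord6P.
Qed.

Lemma id_hexad : [:: 0; 1; 2; 3; 4; 5]%N \in hexads. Proof. by vm_compute. Qed.

Lemma isK4_of_off q : gen q -> unassuming (arr q) ->
  all (fun s => (s \in synthemesK4) || ~~ conc q s) synthemes ->
  exists t, [/\ isK4 (arr q) t, I2 q != 0 &
    2%:R * I2 q ^+ 2 + 16%:R * I1 q ^+ 2 = Jinv t * I2 q ^+ 2].
Proof.
move=> gq uq off.
have cK := concurrent_of_off (S := synthemesK4) (size_concurrent gq uq) erefl off.
have qc s : s \in synthemesK4 -> conc q s by rewrite -cK => /concurrent_matching[].
have s0S : [:: (0, 1); (2, 3); (4, 5)]%N \in synthemes by vm_compute.
have q0 : ~~ conc q [:: (0, 1); (2, 3); (4, 5)]%N := allP off _ s0S.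
have [t [H NH]] := normal_form_K4 gq qc q0.
have gt := good_of_peq gq uq NH.
have [n e] := I12_J gt id_hexad (compose_id NH) qc.
exists t; split=> //; split=> //; exists H; first by case: NH.
exact: arr_peq (gen_neq0 gq) NH.
Qed.

Lemma is2K3_of_off q : gen q -> unassuming (arr q) ->
  all (fun s => (s \in synthemes2K3) || ~~ conc q s) synthemes -> is2K3 (arr q).
Proof.
move=> gq uq off.
have cK := concurrent_of_off (S := synthemes2K3) (size_concurrent gq uq) erefl off.
have qc s : s \in synthemes2K3 -> conc q s by rewrite -cK => /concurrent_matching[].
have [z [H [zE NH]]] := normal_form_2K3 gq qc.
exists H; first by case: NH.
rewrite (arr_peq (gen_neq0 gq) NH); have [->//|->] := cube_root_or (cube_rootE F) zE.
by rewrite (arr_N2K3_sqr _ (cube_rootE F)).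
Qed.

Lemma off_of_peq p q H (S : seq (seq (nat * nat))) : peq p q H ->
  (forall s, s \in synthemes -> conc p s = (s \in S)) ->
  all (fun s => (s \in S) || ~~ conc q s) synthemes.
Proof.
by move=> pq pS; apply/allP => s sy; rewrite (conc_peq pq sy) pS // orbN.
Qed.

Lemma polymap_K4 (f g h : {mpoly F[6 * 3]}) x :
  polymap (fun i : 'I_3 => [:: f * (2%:R * h ^+ 2 + 16%:R * g ^+ 2); f * h ^+ 2; 0]`_i) x =
  vec3 (ev f x * (2%:R * ev h x ^+ 2 + 16%:R * ev g x ^+ 2)) (ev f x * ev h x ^+ 2) 0.
Proof.
have evn k : ev (k%:R : {mpoly F[6 * 3]}) x = k%:R by exact: rmorph_nat.
apply: row3P; rewrite vec3E mxE -/(ev _ _) /=; last exact: meval0.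
  by rewrite evM evD !evM !evn.
by rewrite !evM.
Qed.

(** The labelling found at [x] is kept for all nearby equations, where [off_poly] is nonzero; J is
    then read off from [I1] and [I2] by [I12_J]. *)
Lemma regular_mu :
  regular_affine (@unassuming_equations F) (fun v => mu (arrangement_of (vec_mx v))).
Proof.
move=> x ux; have [gx Ex] := unassuming_rows ux.
have ux' : unassuming (arr (rowsof x)) by rewrite -Ex.
have [l lH h] := normal_form gx ux'.
have key y : unassuming_equations y -> [/\ gen (compose_seq (rowsof y) l),
    unassuming (arr (compose_seq (rowsof y) l)) &
    arrangement_of (vec_mx y) = arr (compose_seq (rowsof y) l)].
  move=> uy; have [gy Ey] := unassuming_rows uy.
  split; first exact: gen_compose gy lH.
    by rewrite (arr_compose _ lH) -Ey.
  by rewrite (arr_compose _ lH).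
have offK4 y : vec3 (ev (off_poly l synthemesK4) y *
      (2%:R * ev (I2_poly l) y ^+ 2 + 16%:R * ev (I1_poly l) y ^+ 2))
    (ev (off_poly l synthemesK4) y * ev (I2_poly l) y ^+ 2) 0 != 0 ->
    ev (off_poly l synthemesK4) y != 0.
  by apply: contraNneq => ->; rewrite !mul0r vec3_eq0 eqxx.
case: h => [[t [H [gt NH]]]|[z [H [zE NH]]]].
  (* These are [J : 1 : 0] with the denominator [I2] squared cleared. The factor [off_poly] makes
     the expression vanish outside the chart, so that it is correct wherever it is nonzero. *)
  exists (fun i => [:: off_poly l synthemesK4 *
      (2%:R * I2_poly l ^+ 2 + 16%:R * I1_poly l ^+ 2);
      off_poly l synthemesK4 * I2_poly l ^+ 2; 0]`_i).
  have E y := polymap_K4 (off_poly l synthemesK4) (I1_poly l) (I2_poly l) y.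
  split.
    have off := off_of_peq NH (fun s => conc_NK4_good gt).
    have := ev_off x l synthemesK4; rewrite off => o0.
    have [gq uq _] := key x ux.
    have [t' [_ i0 _]] := isK4_of_off gq uq off.
    rewrite E vec3_eq0 eqxx andbT negb_and; apply/orP; right.
    by rewrite mulf_neq0 // expf_neq0 // ev_I2.
  move=> y uy; rewrite E => f0; have := offK4 y f0; have [gq uq Ey] := key y uy.
  move=> o0; rewrite ev_off in o0; have [t' [At i0 e]] := isK4_of_off gq uq o0.
  rewrite Ey (muK4 At) ev_I1 ev_I2 e /pt3 val_pt ?line_vec_neq0 //.
  rewrite -ev_off in o0.
  apply/vline_eq; first exact: line_vec_neq0.
  exists ((ev (off_poly l synthemesK4) y * I2 (compose_seq (rowsof y) l) ^+ 2)^-1).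
    by rewrite invr_eq0 mulf_neq0 ?expf_neq0.
  rewrite scale_vec3 mulr0; congr vec3; field; rewrite ?i0 ?o0 //.
(* The value is constant on this chart, so the isolated class is also open. *)
exists (fun i => [:: 0; 0; off_poly l synthemes2K3]`_i).
have E y : polymap (fun i : 'I_3 => [:: 0; 0; off_poly l synthemes2K3]`_i) y =
    vec3 0 0 (ev (off_poly l synthemes2K3) y).
  by apply: row3P; rewrite !mxE /= ?meval0.
have E0 y : (vec3 0 0 (ev (off_poly l synthemes2K3) y) != 0) =
    (ev (off_poly l synthemes2K3) y != 0) by rewrite vec3_eq0 eqxx.
split.
  rewrite E E0 ev_off; apply: off_of_peq NH _ => s; exact: conc_N2K3.
move=> y uy; rewrite E E0 => o0; have [gq uq Ey] := key y uy.
have off := o0; rewrite ev_off in off.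
rewrite Ey (mu2K3 (is2K3_of_off gq uq off)) /pt3 val_pt ?e3_neq0 //.
apply/vline_eq; first exact: e3_neq0.
exists (ev (off_poly l synthemes2K3) y)^-1; first by rewrite invr_eq0.
by rewrite scale_vec3 !mulr0 mulVf.
Qed.

End Equations.

(** * Descent of invariants to the moduli space and the generic action of the operator *)

Section Universality.
Variable F : numClosedFieldType.
Implicit Types (t : F) (A B : set (line F)).

(** With a = t^2, b = t^-2 and ab = 1, the power sums satisfy S(k+2) = J S(k+1) - S(k); two
    consecutive cases carry the induction. *)
Lemma dickson k : exists G : {poly F}, forall t, t != 0 ->
  t ^+ 2 ^+ k + t^-1 ^+ 2 ^+ k = G.[Jinv t].
Proof.
have [] : (exists G : {poly F}, forall t, t != 0 -> t ^+ 2 ^+ k + t^-1 ^+ 2 ^+ k = G.[Jinv t]) /\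
  (exists G : {poly F}, forall t, t != 0 ->
     t ^+ 2 ^+ k.+1 + t^-1 ^+ 2 ^+ k.+1 = G.[Jinv t]); last by [].
elim: k => [|k [[G GE] [G' GE']]].
  split; first by exists 2%:R%:P => t t0; rewrite hornerC !expr0.
  by exists 'X => t t0; rewrite hornerX !expr1.
split; [by exists G'|exists ('X * G' - G) => t t0].
rewrite hornerD hornerN hornerM hornerX -GE // -GE' // /Jinv.
have : t ^+ 2 * t^-1 ^+ 2 = 1 by field.
move: (t ^+ 2) (t^-1 ^+ 2) => a b e; rewrite !exprS.
rewrite [RHS](_ : _ = a * (a * a ^+ k) + b * (b * b ^+ k) +
  (a * b - 1) * (a ^+ k + b ^+ k)); last by ring.
by rewrite e subrr mul0r addr0.
Qed.

(** Odd powers cancel between t and -t, and even powers give twice a sum treated by [dickson]. *)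
Lemma symmetric_monomial k : exists G : {poly F}, forall t, t != 0 ->
  t ^+ k + (- t) ^+ k + t^-1 ^+ k + (- t^-1) ^+ k = G.[Jinv t].
Proof.
rewrite -(odd_double_half k); move: (odd k) (k./2) => b h; have [G GE] := dickson h.
rewrite -mul2n; case: b => /=.
  exists 0 => t t0; rewrite horner0 add1n !exprS !exprM !sqrrN.
  by move: (_ ^+ h) (_ ^+ h) => a b; ring.
exists (2%:R *: G) => t t0; rewrite hornerZ -GE // add0n !exprM !sqrrN.
by move: (_ ^+ h) (_ ^+ h) => a b; ring.
Qed.

Lemma symmetric_poly (R : {poly F}) : exists G : {poly F}, forall t, t != 0 ->
  R.[t] + R.[- t] + R.[t^-1] + R.[- t^-1] = G.[Jinv t].
Proof.
suff h n (a : nat -> F) : exists G : {poly F}, forall t, t != 0 ->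
    (\sum_(i < n) a i * t ^+ i) + (\sum_(i < n) a i * (- t) ^+ i) +
    (\sum_(i < n) a i * t^-1 ^+ i) + (\sum_(i < n) a i * (- t^-1) ^+ i) = G.[Jinv t].
  have [G GE] := h (size R) (fun i => R`_i); exists G => t t0.
  by rewrite -GE // !horner_coef.
elim: n => [|n [G GE]]; first by exists 0 => t _; rewrite !big_ord0 horner0 !addr0.
have [G' GE'] := symmetric_monomial n; exists (G + a n *: G') => t t0.
by rewrite !big_ord_recr /= hornerD hornerZ -GE // -GE' //; ring.
Qed.

(** A curve in the space of equations that meets every class of the one-parameter family; along it,
    local expressions of an invariant become polynomials in t. *)
Definition eqns_NK4 t : 'rV[F]_(6 * 3) := mxvec (\matrix_(i < 6, j < 3) NK4 t i 0 j).

Lemma rowsof_NK4 t i : (i < 6)%N -> rowsof (eqns_NK4 t) i = NK4 t i.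
Proof. by move=> li; apply/rowP => j; rewrite /rowsof !mxE mxvecE mxE inordK. Qed.

Lemma arrangement_NK4 t : t != 0 ->
  arrangement_of (vec_mx (eqns_NK4 t)) = arr (moved (NK4 t) 1%:M).
Proof.
move=> t0; rewrite arrangement_rows.
  by apply: eq_imagel => i li; rewrite rowsof_NK4 // /moved mulmx1.
by move=> i li; rewrite rowsof_NK4 //; exact: NK4_neq0.
Qed.

Definition poly_NK4 (i j : nat) : {poly F} :=
  match i with
  | 0 => [:: 0; 1; 1]`_j | 1 => [:: 0; 1; - 1]`_j
  | 2 => [:: 1; 0; 1]`_j | 3 => [:: - 1; 0; 1]`_j
  | 4 => [:: 1; 'X; 0]`_j | _ => [:: 1; - 'X; 0]`_j
  end.

Lemma poly_NK4E t i (j : 'I_3) : (poly_NK4 i j).[t] = NK4 t i 0 j.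
Proof.
move: j; apply: ord3P; case: i => [|[|[|[|[|i]]]]];
  by rewrite mxE /= ?hornerN ?hornerX ?hornerC ?horner0.
Qed.

Lemma poly_along_NK4 (f : {mpoly F[6 * 3]}) :
  exists P : {poly F}, forall t, P.[t] = ev f (eqns_NK4 t).
Proof.
have [P PE] := mpoly_along_curve f
  (fun k => mxvec (\matrix_(i < 6, j < 3) poly_NK4 i j) 0 k).
exists P => t; rewrite PE /ev; apply: meval_eq => k.
by case/mxvec_indexP: k => i j; rewrite /eqns_NK4 !mxvecE !mxE poly_NK4E.
Qed.

Lemma val_proj n (p : proj F n) v : v \in val p -> v != 0 -> val p = <[v]>%VS.
Proof.
move=> vp v0; apply/esym/eqP; rewrite -dimv_leqif_eq; last by rewrite -memvE.
by rewrite dim_vline v0 (eqP (valP p)).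
Qed.

(* G(X, Y) = Y^N G(X / Y) *)
Definition homogenize N (G : {poly F}) : {mpoly F[3]} :=
  \sum_(k < N) G`_k *: ('X_o0 ^+ k * 'X_o1 ^+ (N - k)).

Lemma homogenize_homog N (G : {poly F}) : homogenize N G \is N.-homog.
Proof.
apply: rpred_sum => k _; apply: dhomogZ.
rewrite -[N in N.-homog](subnKC (ltnW (ltn_ord k))); apply: dhomogM.
  by rewrite -[X in X.-homog]mul1n; apply: dhomogMn; exact: homogX.
by rewrite -[X in X.-homog]mul1n; apply: dhomogMn; exact: homogX.
Qed.

Lemma ev_homogenize N (G : {poly F}) j : (size G <= N)%N ->
  ev (homogenize N G) (vec3 j 1 0) = G.[j].
Proof.
move=> sG; rewrite /ev /homogenize raddf_sum /= (horner_coef_wide _ sG).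
apply: eq_bigr => k _; rewrite mevalZ mevalM !rmorphXn /= !mevalXU !mxE /=.
by rewrite expr1n mulr1.
Qed.

(** The summation stops before k = N, so every term contains a positive power of Y. *)
Lemma ev_homogenize_e3 N (G : {poly F}) : ev (homogenize N G) (vec3 0 0 1) = 0.
Proof.
rewrite /ev /homogenize raddf_sum /=; apply: big1 => k _.
rewrite mevalZ mevalM !rmorphXn /= !mevalXU !mxE /= [X in _ * (_ * X)]expr0n.
by rewrite subn_eq0 leqNgt ltn_ord !mulr0.
Qed.

Lemma good_Jinv t t' : t' != 0 -> good t -> Jinv t' = Jinv t -> good t'.
Proof. by move=> t'0 gt e; rewrite good_badJ // e -good_badJ ?(good_neq0 gt). Qed.

Section Factor.
Variables (m : nat) (phi : set (line F) -> proj F m).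
Hypothesis phi_inv : forall A B, unassuming A -> unassuming B -> proj_equiv A B ->
  phi A = phi B.
Hypothesis phi_reg : regular_affine (@unassuming_equations F)
  (fun v => phi (arrangement_of (vec_mx v))).

(** A preimage under [mu] is chosen. Preimages of one point are projectively equivalent by
    [mu_proj_equiv], so the invariance of [phi] makes the choice harmless. *)
Definition factor (q : proj F 2) : proj F m :=
  if pselect (exists A, unassuming A /\ mu A = q) is left h then phi (projT1 (cid h))
  else default_proj F m.

Lemma factorE A : unassuming A -> phi A = factor (mu A).
Proof.
move=> uA; rewrite /factor; case: pselect => [h|[]]; last by exists A.
by case: (projT2 (cid h)) => uB e; apply: phi_inv => //; apply/mu_proj_equiv.
Qed.

Lemma unassuming_eqns_NK4 t : good t -> unassuming_equations (eqns_NK4 t).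
Proof.
move=> gt; rewrite /unassuming_equations /= (arrangement_NK4 (good_neq0 gt)).
by apply/unassumingP; left; exists t; exact: isK4_std.
Qed.

Lemma phi_Jinv t t' : good t -> good t' -> Jinv t = Jinv t' ->
  phi (arrangement_of (vec_mx (eqns_NK4 t'))) = phi (arrangement_of (vec_mx (eqns_NK4 t))).
Proof.
move=> gt gt' e; apply: phi_inv; [exact: unassuming_eqns_NK4|exact: unassuming_eqns_NK4|].
rewrite !arrangement_NK4 ?(good_neq0 gt) ?(good_neq0 gt') //.
exact: isK4_proj_equiv (isK4_std gt') (isK4_std gt) (esym e).
Qed.

Lemma factor_NK4 t : good t ->
  factor (pt3 (Jinv t) 1 0) = phi (arrangement_of (vec_mx (eqns_NK4 t))).
Proof.
move=> gt; rewrite (arrangement_NK4 (good_neq0 gt)) factorE ?(muK4 (isK4_std gt)) //.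
by apply/unassumingP; left; exists t; exact: isK4_std.
Qed.

(* The map t |-> J(t) is the quotient by {t, -t, 1/t, -1/t}, which acts freely on
   good t; a local expression P of phi near t0 is therefore made invariant by
   averaging c P over the orbit, where c vanishes at the three other points of
   the orbit of t0. *)
Lemma local_factor t0 : good t0 -> exists G : 'I_m.+1 -> {poly F},
  (\row_i (G i).[Jinv t0] != 0) /\
  forall t, good t -> \row_i (G i).[Jinv t] \in
    val (phi (arrangement_of (vec_mx (eqns_NK4 t)))).
Proof.
move=> g0; have [f [f0 fP]] := phi_reg (unassuming_eqns_NK4 g0).
have [P PE] : {P : 'I_m.+1 -> {poly F} & forall i t, (P i).[t] = ev (f i) (eqns_NK4 t)}.
  apply: (@boolp.choice _ _ (fun i (Q : {poly F}) => forall t, Q.[t] = ev (f i) (eqns_NK4 t))) => i.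
  exact: poly_along_NK4.
pose c : {poly F} := ('X + t0%:P) * ('X - t0^-1%:P) * ('X + t0^-1%:P).
have cE t : c.[t] = (t + t0) * (t - t0^-1) * (t + t0^-1) by rewrite /c !hornerE.
have [G GE] : {G : 'I_m.+1 -> {poly F} & forall i t, t != 0 ->
    (c * P i).[t] + (c * P i).[- t] + (c * P i).[t^-1] + (c * P i).[- t^-1] = (G i).[Jinv t]}.
  apply: (@boolp.choice _ _ (fun i (Q : {poly F}) => forall t, t != 0 ->
    (c * P i).[t] + (c * P i).[- t] + (c * P i).[t^-1] + (c * P i).[- t^-1] = Q.[Jinv t])) => i.
  exact: symmetric_poly.
have rowE t : t != 0 -> \row_i (G i).[Jinv t] = c.[t] *: polymap f (eqns_NK4 t) +
    c.[- t] *: polymap f (eqns_NK4 (- t)) + c.[t^-1] *: polymap f (eqns_NK4 t^-1) +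
    c.[- t^-1] *: polymap f (eqns_NK4 (- t^-1)).
  by move=> tn; apply/rowP => i; rewrite !mxE -GE // !hornerM !PE.
have t00 := good_neq0 g0; exists G; split.
  rewrite rowE // !cE addNr !mul0r !scale0r addr0 subrr mulr0 mul0r scale0r addr0.
  rewrite addNr !mulr0 scale0r addr0 scaler_eq0 negb_or f0 andbT.
  case/and5P: g0 => _ h1 h2 _ _.
  (* This is c(t0); it is nonzero because the four points of the orbit of a good t0 are distinct. *)
  apply: (neq0_eq (_ : 2%:R * (t0 ^+ 2 - 1) * (t0 ^+ 2 + 1) / t0 != 0)).
    by rewrite !mulf_neq0 ?two_neq0 ?invr_eq0.
  by field.
move=> t gt; have tn := good_neq0 gt; rewrite rowE //.
(* The parameters in one orbit have the same image under [phi], so the four vectors lie on one line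
   through the origin, and so does their sum; a vector where the local expression vanishes does no
   harm. *)
have mem t' k : t' != 0 -> Jinv t' = Jinv t -> k *: polymap f (eqns_NK4 t') \in
    val (phi (arrangement_of (vec_mx (eqns_NK4 t)))).
  move=> t'0 e; have gt' := good_Jinv t'0 gt e.
  rewrite -(phi_Jinv gt gt' (esym e)); have [->|n0] := eqVneq (polymap f (eqns_NK4 t')) 0.
    by rewrite scaler0 mem0v.
  by rewrite (fP _ (unassuming_eqns_NK4 gt') n0) memvZ // memv_line.
have ti : t^-1 != 0 by rewrite invr_eq0.
rewrite !memvD // mem ?oppr_eq0 // /Jinv ?invrN ?invrK ?sqrrN // addrC //.
Qed.

Lemma regular_factor : regular (@mu F @` @unassuming F) factor.
Proof.
rewrite mu_image => q [[j jb <-]|->]; last first.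
  (* At the isolated point a constant vector times the third coordinate works, since that coordinate
     vanishes on the rest of the moduli space. *)
  pose h := hcoord (factor (pt3 0 0 1)).
  exists 1%N, (fun i => h 0 i *: 'X_o2).
  have E v : polymap (fun i : 'I_m.+1 => h 0 i *: 'X_o2 : {mpoly F[3]}) v = v 0 o2 *: h.
    by apply/rowP => i; rewrite !mxE mevalZ mevalXU mulrC.
  have z0 : hcoord (pt3 0 0 1 : proj F 2) 0 o2 != 0.
    have [c c0 ->] := hcoord_pt (e3_neq0 F).
    by rewrite !mxE mulr1.
  split=> [i||y My]; first by apply: dhomogZ; exact: homogX.
    by rewrite E scaler_eq0 negb_or z0 hcoord_neq0.
  rewrite E scaler_eq0 negb_or => /andP[y0 h0].
  have yE : y = pt3 0 0 1.
    case: My => [[k _ e]|//]; move: y0; rewrite -e.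
    have [c c0 ->] := hcoord_pt (line_vec_neq0 k).
    by rewrite !mxE mulr0 eqxx.
  rewrite yE in y0 *; apply: val_proj; last by rewrite scaler_eq0 negb_or y0 h0.
  by rewrite memvZ // memv_pick.
have [t t0 tE] := Jinv_surj j; have gt : good t by rewrite good_badJ // tE.
have [G [G0 GP]] := local_factor gt.
pose N := (\max_i size (G i)).+1.
have sG i : (size (G i) <= N)%N by apply: leqW; apply: leq_bigmax.
exists N, (fun i => homogenize N (G i)).
have hN i : homogenize N (G i) \is N.-homog by exact: homogenize_homog.
have E k : exists2 c, c != 0 & polymap (fun i => homogenize N (G i)) (hcoord (pt3 k 1 0)) =
    c *: \row_i (G i).[k].
  have [c c0 ->] := hcoord_pt (line_vec_neq0 k); exists (c ^+ N); first exact: expf_neq0.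
  rewrite (polymap_homogZ c _ hN); congr (_ *: _); apply/rowP => i.
  by rewrite !mxE -/(ev _ _) ev_homogenize.
split=> //.
  by have [c c0 ->] := E j; rewrite scaler_eq0 negb_or c0 -tE.
(* At the isolated point the homogenized forms vanish, so nothing is required there. *)
move=> _ [[k kb <-]|->]; last first.
  have [c c0 ->] := hcoord_pt (e3_neq0 F).
  rewrite (polymap_homogZ c _ hN) (_ : polymap _ _ = 0) ?scaler0 ?eqxx //.
  by apply/rowP => i; rewrite !mxE -/(ev _ _) ev_homogenize_e3.
have [s s0 sE] := Jinv_surj k; have gs : good s by rewrite good_badJ // sE.
have [c c0 ->] := E k; move=> n0; apply: val_proj => //.
by rewrite -sE factor_NK4 // memvZ // GP.
Qed.

End Factor.

Lemma moduliE : @moduli F = moduli_off (badJ F). Proof. by []. Qed.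

Lemma badJ_neq0 : badJ F != 0.
Proof.
apply/eqP => e; have := badJE (0 : F); rewrite e horner0 => /esym/eqP.
by rewrite sub0r add0r sub0r !mulf_eq0 !oppr_eq0 !pnatr_eq0.
Qed.

Lemma zlocally_closed_moduli : zlocally_closed (@moduli F).
Proof.
(* The homogenized [badJ] with an extra factor y, which removes the point J = infinity. Requiring z
   = 0 as well keeps [0 : 0 : 1] out of the removed set. *)
pose r : {mpoly F[3]} := 'X_o1 * ('X_o0 - 2%:R *: 'X_o1) * ('X_o0 + 2%:R *: 'X_o1) *
  ('X_o0 - 18%:R *: 'X_o1).
have rh f : f \in [:: 'X_o2; r] -> exists d, f \is d.-homog.
  rewrite !inE => /orP[]/eqP ->; first by exists 1%N; exact: homogX.
  exists (1 + 1 + 1 + 1)%N; rewrite /r; do 3?[apply: dhomogM]; first exact: homogX.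
  - by apply: rpredB; [exact: homogX|apply: dhomogZ; exact: homogX].
  - by apply: rpredD; [exact: homogX|apply: dhomogZ; exact: homogX].
  - by apply: rpredB; [exact: homogX|apply: dhomogZ; exact: homogX].
have rE v : ev r v = v 0 o1 * (v 0 o0 - 2%:R * v 0 o1) * (v 0 o0 + 2%:R * v 0 o1) *
    (v 0 o0 - 18%:R * v 0 o1).
  by rewrite /ev /r !(mevalB, mevalM, mevalD, mevalZ) !mevalXU.
exists (@line0 F `|` @point0 F), (zset [:: 'X_o2; r]); split.
- exact: zclosed_line0U_point0.
- exact: zclosed_zset.
apply/seteqP; split=> [_ [[j jb <-]|->]|p].
- split; first by left; apply: line0_pt3; exact: line_vec_neq0.
  move=> /(zset_pt rh (line_vec_neq0 j))/(_ r); rewrite !inE eqxx orbT => /(_ isT).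
  rewrite rE !vec3E => e; move/eqP: jb; apply.
  by rewrite badJE -[RHS]e; ring.
- split; first by right.
  move=> /(zset_pt rh (e3_neq0 F))/(_ 'X_o2); rewrite !inE eqxx => /(_ isT)/eqP.
  by rewrite /ev mevalXU vec3E oner_eq0.
have [v v0 ->] := ptP p => -[[/(line0P v0) z0|]]; last by right.
move=> nW; left; have rv : ev r v != 0.
  apply/eqP => e; apply: nW; apply/(zset_pt rh v0) => f.
  by rewrite !inE => /orP[]/eqP -> //; rewrite /ev mevalXU.
move: rv; rewrite rE !mulf_eq0 !negb_or -!andbA => /and4P[y0 h1 h2 h3].
exists (v 0 o0 / v 0 o1).
  rewrite /= badJE; apply: (neq0_eq (_ : (v 0 o0 - 2%:R * v 0 o1) *
    (v 0 o0 + 2%:R * v 0 o1) * (v 0 o0 - 18%:R * v 0 o1) / v 0 o1 ^+ 3 != 0)).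
    by rewrite !mulf_neq0 ?invr_eq0 ?expf_neq0.
  by field.
apply/esym/(pt_eq (n := 2) v0 (line_vec_neq0 _)); exists (v 0 o1) => //.
by rewrite scale_vec3 mulrCA divff // !mulr1 mulr0 -[in RHS]z0 vec3_eta.
Qed.

Lemma coarse_mu : coarse_moduli (@mu F).
Proof.
split.
- by rewrite mu_image; exact: zlocally_closed_moduli.
- exact: mu_proj_equiv.
- exact: regular_mu.
move=> m phi pi pr; exists (factor phi); first exact: regular_factor.
by move=> A uA; exact: factorE.
Qed.

Definition badJ' : {poly F} := badJ F \Po ('X ^+ 2 - 2%:R%:P).

Lemma badJ'E j : badJ'.[j] = (badJ F).[j ^+ 2 - 2%:R].
Proof. by rewrite /badJ' horner_comp !hornerE. Qed.

Lemma generic_Lambda23 : generic_unassuming (@mu F) (fun A => unassuming (Lambda23 A)).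
Proof.
(* The homogenization of [badJ] at J^2 - 2, which is (J^2 - 4) J^2 (J^2 - 20). Imposing z = 0 as
   well keeps the isolated class generic. *)
pose r : {mpoly F[3]} := ('X_o0 ^+ 2 - 4%:R *: 'X_o1 ^+ 2) * 'X_o0 ^+ 2 *
  ('X_o0 ^+ 2 - 20%:R *: 'X_o1 ^+ 2).
have h2 (i : 'I_3) : ('X_i ^+ 2 : {mpoly F[3]}) \is 2.-homog.
  by rewrite -[X in X.-homog](mul1n 2); apply: dhomogMn; exact: homogX.
have rh f : f \in [:: 'X_o2; r] -> exists d, f \is d.-homog.
  rewrite !inE => /orP[]/eqP ->; first by exists 1%N; exact: homogX.
  exists (2 + 2 + 2)%N; rewrite /r; do 2?[apply: dhomogM]; rewrite ?h2 //.
  - by apply: rpredB => //; apply: dhomogZ.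
  - by apply: rpredB => //; apply: dhomogZ.
have rE v : ev r v = (v 0 o0 ^+ 2 - 4%:R * v 0 o1 ^+ 2) * v 0 o0 ^+ 2 *
    (v 0 o0 ^+ 2 - 20%:R * v 0 o1 ^+ 2).
  by rewrite /ev /r !(mevalB, mevalM, mevalZ) ?rmorphXn /= !mevalXU; ring.
have rb j : ev r (vec3 j 1 0) = badJ'.[j].
  by rewrite rE !vec3E badJ'E badJE; ring.
have zW j : zset [:: 'X_o2; r] (pt3 j 1 0) <-> badJ'.[j] = 0.
  split=> [/(zset_pt rh (line_vec_neq0 j))/(_ r)|e].
    by rewrite !inE eqxx orbT rb => /(_ isT).
  apply/(zset_pt rh (line_vec_neq0 j)) => f; rewrite !inE => /orP[]/eqP ->.
    by rewrite /ev mevalXU vec3E.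
  by rewrite rb.
exists (zset [:: 'X_o2; r]); last first.
  move=> A uA nW; apply: unassuming_Lambda23 => // t At; rewrite -badJ'E.
  by apply/eqP => /zW; rewrite -(muK4 At).
split; first exact: zclosed_zset.
have b0 : badJ F * badJ' != 0.
  rewrite mulf_neq0 ?badJ_neq0 //; apply/eqP => e.
  (* At J = 1 the operator leads to J = -1, which is not an excluded value. *)
  have := badJ'E (1 : F); rewrite e horner0 badJE expr1n => /esym/eqP.
  rewrite !mulf_eq0 => /orP[/orP[]|].
  - by rewrite (_ : 1 - _ - _ = - 3%:R) ?oppr_eq0 ?pnatr_eq0 //; ring.
  - by rewrite (_ : 1 - _ + _ = 1%:R) ?pnatr_eq0 //; ring.
  - by rewrite (_ : 1 - _ - _ = - 19%:R) ?oppr_eq0 ?pnatr_eq0 //; ring.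
(* Density: what remains contains the moduli space with finitely many values of J removed, and by
   [zclosure_moduli_off] this has the full line and the isolated point as its closure. *)
have sub : moduli_off (badJ F * badJ') `<=` @mu F @` @unassuming F `\` zset [:: 'X_o2; r].
  rewrite mu_image => _ [[j + <-]|->]; last first.
    split; first by right.
    move=> /(zset_pt rh (e3_neq0 F))/(_ 'X_o2); rewrite !inE eqxx => /(_ isT)/eqP.
    by rewrite /ev mevalXU vec3E oner_eq0.
  rewrite /= hornerM mulf_eq0 negb_or => /andP[j1 j2]; split; first by left; exists j.
  by move/zW/eqP; rewrite (negPf j2).
apply: (@subset_trans _ (zclosure (moduli_off (badJ F * badJ')))).
  rewrite zclosure_moduli_off // mu_image => _ [[j _ <-]|->]; last by right.
  by left; apply: line0_pt3; exact: line_vec_neq0.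
move=> p h Z [cZ Zs]; apply: h; split=> //; exact: subset_trans Zs.
Qed.

End Universality.

Theorem theorem1p1 (R : realType) :
  exists (n : nat) (mu : set (line R[i]) -> proj R[i] n),
    [/\ coarse_moduli mu,
        generic_unassuming mu (fun A => unassuming (Lambda23 A)) &
        exists C1 C2 : set (proj R[i] n),
          [/\ C1 <> C2,
              forall C, irreducible_component
                          (zclosure (mu @` @unassuming R[i])) C
                        <-> C = C1 \/ C = C2,
              variety_isomorphic C1 [set: proj R[i] 1] &
              exists p : proj R[i] n, C2 = [set p]]].
Proof.
pose C : numClosedFieldType := R[i].
exists 2%N, (@mu C); split.
- exact: (coarse_mu C).
- exact: (generic_Lambda23 C).
exists (@line0 C), (@point0 C); split.
- exact: (@line0_neq_point0 C).
- move=> K; rewrite (mu_image C) (moduliE C) (zclosure_moduli_off (badJ_neq0 C)).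
  exact: components.
- exact: (line0_iso C).
- by exists (@pt3 C 0 0 1).
Qed.
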